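(* Let $k$ be an algebraically closed field. The map $M_{0,4}\hookrightarrow\mathbb{P}\,\mathrm{H}^0((\mathbb{P}^1)^4,\mathcal{O}(1,1,1,1))$ sending a configuration of four distinct points on the line to the form cutting out its $\mathrm{PGL}_2$-orbit closure in $(\mathbb{P}^1)^4$ extends to a map from $\overline{M}_{0,4}$ which is an isomorphism onto its image, and this image is the Hilbert quotient, which equals the Chow quotient: $$\overline{M}_{0,4}\;\xrightarrow{\ \sim\ }\;(\mathbb{P}^1)^4/\!/_H\,\mathrm{PGL}_2=(\mathbb{P}^1)^4/\!/_{Ch}\,\mathrm{PGL}_2\hookrightarrow\mathbb{P}\,\mathrm{H}^0((\mathbb{P}^1)^4,\mathcal{O}(1,1,1,1)).$$
   Context: Everything is over $k$. $\overline{M}_{0,4}$ is the moduli space of stable $4$-pointed rational curves, $M_{0,4}$ its open locus of smooth curves. $\mathrm{PGL}_2$ acts diagonally on $(\mathbb{P}^1)^4$. The orbit closure of a configuration of four distinct points is a hypersurface in $(\mathbb{P}^1)^4$ cut out by a multihomogeneous form of multidegree $(1,1,1,1)$, unique up to scalar. Accordingly, the relevant components of the Hilbert scheme and of the Chow variety of $(\mathbb{P}^1)^4$ coincide: $\mathrm{Hilb}((\mathbb{P}^1)^4)=\mathrm{Chow}((\mathbb{P}^1)^4)=\mathbb{P}\,\mathrm{H}^0((\mathbb{P}^1)^4,\mathcal{O}(1,1,1,1))=\mathbb{P}^{15}$. The Hilbert quotient $(\mathbb{P}^1)^4/\!/_H\,\mathrm{PGL}_2$ (resp. Chow quotient $(\mathbb{P}^1)^4/\!/_{Ch}\,\mathrm{PGL}_2$)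 is the closure, in the Hilbert scheme (resp. Chow variety), of the image of $M_{0,4}$ under the map sending a configuration of four distinct points to its orbit closure. *)

(* Defs.v *)
From HB Require Import structures.
From mathcomp Require Import all_boot all_order all_algebra.
From mathcomp Require Import boolp.
From mathcomp Require Import mpoly.

Set Implicit Arguments.
Unset Strict Implicit.
Unset Printing Implicit Defensive.

Import GRing.Theory.

Local Open Scope ring_scope.

(* Varieties over the algebraically closed field k are treated classically, as
   spaces with functions: a set of k-points, its Zariski open subsets, and for
   each open subset the regular k-valued functions on it.  Functions are total;
   only the values of f on W matter in [zregular X W f].  Subsets are plain
   predicates T -> Prop: the sets of classical_sets live in too small a universe
   to contain the isomorphism classes of curves considered below.             *)

Record zspace (k : closedFieldType) (T : Type) := ZSpace {
  zopen : (T -> Prop) -> Prop;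
  zregular : (T -> Prop) -> (T -> k) -> Prop }.

Section Spaces.
Variable k : closedFieldType.

Definition zmorphism (S T : Type) (X : zspace k S) (Y : zspace k T)
    (f : S -> T) : Prop :=
  (forall W, zopen Y W -> zopen X (W \o f)) /\
  (forall W g, zregular Y W g -> zregular X (W \o f) (g \o f)).

Definition zisomorphism (S T : Type) (X : zspace k S) (Y : zspace k T)
    (f : S -> T) : Prop :=
  exists g : T -> S,
    [/\ cancel f g, cancel g f, zmorphism X Y f & zmorphism Y X g].

(* The structure induced on S by a map f : S -> T into a space (f being the
   inclusion of a locally closed subset, this is its reduced structure).      *)
Definition induced (S T : Type) (Y : zspace k T) (f : S -> T) : zspace k S :=
  let open W := exists2 O, zopen Y O & forall x, W x <-> O (f x) in
  ZSpace open
    (fun W h => open W /\ forall x, W x -> exists O g,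
       [/\ zopen Y O, O (f x), zregular Y O g &
           forall y, W y -> O (f y) -> h y = g (f y)]).

Definition subspace (T : Type) (Y : zspace k T) (A : T -> Prop) :
    zspace k {y : T | A y} :=
  induced Y (@sval T A).

(* The quotient structure on T for a map q : S -> T out of a space.           *)
Definition coinduced (S T : Type) (X : zspace k S) (q : S -> T) : zspace k T :=
  ZSpace (fun W => zopen X (W \o q))
         (fun W h => zregular X (W \o q) (h \o q)).

Definition image_of (S T : Type) (f : S -> T) : T -> Prop :=
  fun y => exists x, f x = y.

Definition corestrict (S T : Type) (f : S -> T) (x : S) :
    {y : T | image_of f y} :=
  exist _ (f x) (ex_intro _ x erefl).

Definition iso_onto_image (S T : Type) (X : zspace k S) (Y : zspace k T)
    (f : S -> T) : Prop :=
  zisomorphism X (subspace Y (image_of f)) (corestrict f).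

Definition zclosure (T : Type) (X : zspace k T) (A : T -> Prop) : T -> Prop :=
  fun x => forall W, zopen X W -> W x -> exists2 y, W y & A y.

(* Affine space with coordinates indexed by a finite type I; the variable of
   index i is 'X_(enum_rank i).                                               *)
Definition peval (I : finType) (p : {mpoly k[#|I|]}) (x : {ffun I -> k^o}) : k :=
  p.@[fun i => x (enum_val i)].

Definition pvar (I : finType) (i : I) : {mpoly k[#|I|]} := 'X_(enum_rank i).

Definition affine (I : finType) : zspace k {ffun I -> k^o} :=
  let open W := exists S : {mpoly k[#|I|]} -> Prop,
    forall x, W x <-> exists2 p, S p & peval p x != 0 in
  ZSpace open
    (fun W f => open W /\ forall x, W x -> exists a b : {mpoly k[#|I|]},
       peval b x != 0 /\
       forall y, W y -> peval b y != 0 -> f y = peval a y / peval b y).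

(* P(k^I): its points are the lines of k^I, its structure is that of the
   quotient of k^I \ {0} by scalars.                                          *)
Definition proj (I : finType) : Type :=
  {L : {vspace {ffun I -> k^o}} | \dim L == 1%N}.

Definition nonzero (I : finType) : Type := {v : {ffun I -> k^o} | v != 0}.

Lemma dim_line (I : finType) (v : nonzero I) : \dim <[sval v]>%VS == 1%N.
Proof. by rewrite dim_vline (svalP v). Qed.

Definition line (I : finType) (v : nonzero I) : proj I :=
  exist (fun L : {vspace _} => \dim L == 1%N) <[sval v]>%VS (dim_line v).

Definition proj_space (I : finType) : zspace k (proj I) :=
  coinduced (induced (affine I) sval) (@line I).

Definition P1 : Type := proj 'I_2.
Definition P1_space : zspace k P1 := proj_space 'I_2.

(* (P^1)^4; the variable of index (i, j) is the j-th homogeneous coordinate on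
   the i-th factor.                                                           *)
Definition coords : Type := 'I_4 -> nonzero 'I_2.

Definition flat_coords (A : coords) : {ffun 'I_4 * 'I_2 -> k^o} :=
  [ffun ij => sval (A ij.1) ij.2].

Definition points (A : coords) : 'I_4 -> P1 := fun i => line (A i).

Definition P1_4_space : zspace k ('I_4 -> P1) :=
  coinduced (induced (affine _) flat_coords) points.

(* PGL_2 acts on the lines of k^2 through the automorphisms of k^2.           *)
Definition PGL2_orbit (x : 'I_4 -> P1) : ('I_4 -> P1) -> Prop :=
  fun y => exists2 g : 'End({ffun 'I_2 -> k^o}),
     lker g = 0%VS & forall i, sval (y i) = (g @: sval (x i))%VS.

Definition orbit_closure (x : 'I_4 -> P1) : ('I_4 -> P1) -> Prop :=
  zclosure P1_4_space (PGL2_orbit x).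

(* The polynomials vanishing on Z are the multiples of F.                     *)
Definition generates_ideal_of (I : finType) (F : {mpoly k[#|I|]})
    (Z : {ffun I -> k^o} -> Prop) : Prop :=
  forall G : {mpoly k[#|I|]},
    (forall v, Z v -> peval G v = 0) <-> exists H, G = H * F.

Definition irreducible (n : nat) (F : {mpoly k[n]}) : Prop :=
  [/\ F != 0, F \isn't a GRing.unit &
      forall G H : {mpoly k[n]}, F = G * H ->
        G \is a GRing.unit \/ H \is a GRing.unit].

(* P H^0((P^1)^4, O(1,1,1,1)): the coordinate of index s : 'I_4 -> 'I_2 is the
   coefficient of the monomial \prod_i x_(i, s i).                            *)
Definition monos : finType := {ffun 'I_4 -> 'I_2}.

Definition form (c : {ffun monos -> k^o}) : {mpoly k[#|{: 'I_4 * 'I_2}|]} :=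
  \sum_(s : monos) (c s : k) *: \prod_(i < 4) pvar (i, s i).

Definition P15 : Type := proj monos.
Definition P15_space : zspace k P15 := proj_space monos.

(* P15 as a component of the Hilbert scheme: [F] stands for the subscheme with
   multihomogeneous ideal (F), so the reduced subscheme Z is the point [F] such
   that F cuts out Z, that is, generates the multihomogeneous ideal of Z.     *)
Definition hilbert_point (Z : ('I_4 -> P1) -> Prop) (h : P15) : Prop :=
  forall c, c != 0 -> c \in sval h ->
    generates_ideal_of (form c)
      (fun v => exists2 A : coords, v = flat_coords A & Z (points A)).

(* P15 as a component of the Chow variety: [F] stands for the divisor of F, so
   the cycle 1.Z with Z integral is the point [F] such that F is irreducible
   with zero locus Z.                                                         *)
Definition chow_point (Z : ('I_4 -> P1) -> Prop) (h : P15) : Prop :=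
  forall c, c != 0 -> c \in sval h ->
    irreducible (form c) /\
    forall A : coords, Z (points A) <-> peval (form c) (flat_coords A) = 0.

Definition hilbert_quotient : P15 -> Prop :=
  zclosure P15_space
    (fun h => exists2 x, injective x & hilbert_point (orbit_closure x) h).

Definition chow_quotient : P15 -> Prop :=
  zclosure P15_space
    (fun h => exists2 x, injective x & chow_point (orbit_closure x) h).

Record pointed_curve := PointedCurve {
  curve_pt : Type;
  curve_space : zspace k curve_pt;
  mark : 'I_4 -> curve_pt }.

Definition pointed_iso (C D : pointed_curve) : Prop :=
  exists2 f : curve_pt C -> curve_pt D,
    zisomorphism (curve_space C) (curve_space D) f &
    forall i, f (mark C i) = mark D i.

(* C is a connected projective curve of arithmetic genus 0 with at most
   ordinary double points, that is, a tree of projective lines: phi v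
   parametrizes the component of index v.  That the singularities of the curve
   are ordinary double points is expressed by saying that at most two
   components, smooth, pass through any point and that the structure of C is
   the gluing of those of its components: at a point common to two components,
   a function is regular as soon as its two restrictions are.                 *)
Section Trees.
Variables (C : pointed_curve) (V : finType) (phi : V -> P1 -> curve_pt C).

Definition adjacent : rel V :=
  fun v w => (v != w) && `[< exists y z, phi v y = phi w z >].

Definition tree_of_lines : Prop :=
  [/\ (forall v, injective (phi v)) /\ (forall x, exists v y, x = phi v y),
      forall W, zopen (curve_space C) W <->
        forall v, zopen P1_space (W \o phi v),
      forall W f, zregular (curve_space C) W f <->
        forall v, zregular P1_space (W \o phi v) (f \o phi v),
      (forall v w y z y' z', v != w ->
         phi v y = phi w z -> phi v y' = phi w z' -> y = y') /\
      (forall u v w x y z, phi u x = phi v y -> phi v y = phi w z ->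
         [\/ u = v, v = w | u = w]) &
      (forall v w, connect adjacent v w) /\
      (forall s, ucycle adjacent s -> (size s <= 2)%N)].

Definition node_at (v : V) (y : P1) : Prop :=
  exists w z, w != v /\ phi v y = phi w z.

Definition special (v : V) (y : P1) : Prop :=
  node_at v y \/ exists i, mark C i = phi v y.

Definition stable_marking : Prop :=
  [/\ injective (mark C),
      forall i v y, mark C i = phi v y -> ~ node_at v y &
      forall v, exists2 t : 'I_3 -> P1, injective t & forall j, special v (t j)].

End Trees.

Definition stable (C : pointed_curve) : Prop :=
  exists (V : finType) (phi : V -> P1 -> curve_pt C),
    tree_of_lines phi /\ stable_marking phi.

(* The points of \bar M_(0,4): isomorphism classes of stable curves.           *)
Definition iso_class (C : pointed_curve) : pointed_curve -> Prop :=
  fun D => pointed_iso C D.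

Definition Mbar04 : Type :=
  {m : pointed_curve -> Prop | exists2 C, stable C & m = iso_class C}.

Definition moduli_pt (C : pointed_curve) (sC : stable C) : Mbar04 :=
  exist _ (iso_class C) (ex_intro2 _ _ C sC erefl).

(* The variety structure of \bar M_(0,4) is that of the quotient by PGL_3 of
   the parameter space of log-canonically embedded stable curves: for a stable
   4-pointed rational curve C, the sheaf omega_C(p_1 + p_2 + p_3 + p_4) is very
   ample of degree 2 with three sections, and embeds C in P^2 as a reduced
   conic.  Conics and points of P^2 are parametrized by homogeneous coordinates.
   The coordinate of index (i, j), i <= j, of a conic is the coefficient of
   x_i x_j.                                                                   *)
Definition mono2 : finType := {ij : 'I_3 * 'I_3 | (ij.1 <= ij.2)%N}.

Definition conic_form (c : {ffun mono2 -> k^o}) : {mpoly k[#|'I_3|]} :=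
  \sum_(ij : mono2)
    (c ij : k) *: (pvar (sval ij).1 * pvar (sval ij).2).

Definition conic_locus (c : {ffun mono2 -> k^o}) : proj 'I_3 -> Prop :=
  fun L => forall v, v \in sval L -> peval (conic_form c) v = 0.

Record marked_conic := MarkedConic {
  conic : nonzero mono2;
  conic_reduced : generates_ideal_of (conic_form (sval conic))
    (fun v => peval (conic_form (sval conic)) v = 0);
  conic_mark : 'I_4 -> nonzero 'I_3;
  conic_markP : forall i, conic_locus (sval conic) (line (conic_mark i)) }.

Definition conic_curve (Q : marked_conic) : pointed_curve :=
  PointedCurve (subspace (proj_space 'I_3) (conic_locus (sval (conic Q))))
    (fun i => exist _ (line (conic_mark Q i)) (@conic_markP Q i)).

Definition stable_conic : Type := {Q : marked_conic | stable (conic_curve Q)}.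

Definition conic_coords (Q : stable_conic) :
    {ffun mono2 + 'I_4 * 'I_3 -> k^o} :=
  [ffun z => match z with
             | inl ij => sval (conic (sval Q)) ij
             | inr ij => sval (conic_mark (sval Q) ij.1) ij.2
             end].

Definition stable_conic_space : zspace k stable_conic :=
  induced (affine _) conic_coords.

Definition Mbar04_space : zspace k Mbar04 :=
  coinduced stable_conic_space (fun Q => moduli_pt (svalP Q)).

(* M_(0,4): the smooth stable curves are the configurations of four distinct
   points on the line.                                                        *)
Definition config_curve (x : 'I_4 -> P1) : pointed_curve :=
  PointedCurve P1_space x.

Lemma config_stable (x : 'I_4 -> P1) : injective x -> stable (config_curve x).
Proof.
move=> x_inj; exists unit, (fun _ => id).
have noadj (v w : unit) :
    adjacent (C := config_curve x) (fun=> id) v w = false.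
  by rewrite /adjacent; case: v; case: w.
split; split=> //.
- by split=> [v y z|y] //; exists tt, y.
- by move=> W; split=> [? //|H]; exact: H tt.
- by move=> W f; split=> [? //|H]; exact: H tt.
- by split=> [[] []|[] [] [] *] //; constructor 1.
- split=> [[] []|]; first exact: connect0.
  by move=> [|v [|w s]] // /andP[] /=; rewrite noadj.
- by move=> i [] y _ [[] [z []]].
- move=> v; exists (fun j : 'I_3 => x (widen_ord (isT : 3 <= 4)%N j)).
    by move=> i j /x_inj /(congr1 val) /= /val_inj.
  by move=> j; right; exists (widen_ord (isT : 3 <= 4)%N j).
Qed.

Definition of_config (x : 'I_4 -> P1) (x_inj : injective x) : Mbar04 :=
  moduli_pt (config_stable x_inj).

End Spaces.

(* Main.v *)
(* Writing [ij] for the brackets of four vectors of k^2, the orbit closure of four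
   distinct points x is the zero locus of
     F = b D01 D23 - a D02 D13,  (a : b) = ([01][23] : [02][13]) at x,
   a form linear in each variable, so that a division by F, with leading
   coefficient itself linear in a further variable, shows that F is prime and
   generates the ideal of its zeros.  Hence hilbert_point and chow_point both
   single out the point [F] of a line in P^15.

   A stable curve has at most two components, by counting special points on a
   tree.  It is therefore isomorphic to a plane conic carrying four marks, no
   three of which are collinear, hence, after a change of coordinates, to a member
     - a x0 x1 + b x0 x2 + (a - b) x1 x2 = 0
   of the pencil of conics through four fixed points.  The ratio (a : b) is
   given on all stable conics by polynomials in the coefficients of the conic and
   the marks (conic_num, conic_den), which makes the map to P^15 a morphism; the
   pencil itself provides the inverse.  That (a : b) only depends on the
   isomorphism class follows from the rigidity of the projective line for smooth
   curves, and for nodal ones from the fact that two marks lie on the same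
   component exactly when they have no disjoint open neighbourhoods. *)

From HB Require Import structures.
From mathcomp Require Import all_boot all_order all_algebra.
From mathcomp Require Import boolp.
From mathcomp Require Import mpoly.
From mathcomp Require Import ring zify.
Require Import Defs.

Set Implicit Arguments.
Unset Strict Implicit.
Unset Printing Implicit Defensive.

Import GRing.Theory.

Local Open Scope ring_scope.

(** Every structure involved is presented by coordinates in which openness and regularity are tested
    by polynomials, so a morphism amounts to a locally polynomial lift between coordinates. In
    positive characteristic a bijective morphism need not be an isomorphism: the inverse too must be
    given by polynomials, and the pencil supplies them because the coefficients of its members are
    linear in (a, b), itself read linearly on the coordinates of P^15. As the characteristic is
    arbitrary, conics are handled through both the values of a quadratic form and its polar form.
    Neither the smoothness nor the stability of a member of the pencil is checked on its equation. A
    curve of the required type is built elsewhere, as a Veronese conic or as two crossing lines, put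
    in normal form, and recognized by its cross-ratio or by the separation of its marks; it is then
    the given member because (a, b) determines that member. The image is a line of P^15, cut out by
    linear equations, hence closed; configurations of distinct points are dense in it because a b (a
    - b) is a nonzero polynomial. *)

Section PolynomialFunctions.
Variable k : closedFieldType.

Lemma poly_fun_eq0 (p : {poly k}) : (forall x, p.[x] = 0) -> p = 0.
Proof.
move=> p0; apply/eqP/negP => /negP /closed_nonrootP[x].
by rewrite /root p0 eqxx.
Qed.

Lemma meval_muni n (p : {mpoly k[n.+1]}) (v : 'I_n.+1 -> k) :
  p.@[v] = (map_poly (meval (fun i : 'I_n => v (widen_ord (leqnSn n) i)))
             (muni p)).[v ord_max].
Proof.
rewrite muniE rmorph_sum /= horner_sum {1}(mpolyE p) raddf_sum /=.
apply: eq_bigr => m _; rewrite mevalZ mevalX big_ord_recr /=.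
rewrite -!mul_polyC !rmorphM /= !map_polyC /= map_polyXn !hornerE.
rewrite mevalZ mevalX -[RHS]mulrA -[LHS]mulrA; congr (_ * (_ * _)).
by apply: eq_bigr => i _; rewrite mnmE.
Qed.

Lemma muni_inj0 n (p : {mpoly k[n.+1]}) : muni p = 0 -> p = 0.
Proof.
move=> p0; apply/mpolyP => m; rewrite mcoeff0.
have [m_in|/memN_msupp_eq0 //] := boolP (m \in msupp p).
have := congr1 (fun q : {poly {mpoly k[n]}} =>
  (q`_(m ord_max))@_[multinom m (widen_ord (leqnSn n) i) | i < n]) p0.
rewrite muniE coef_sum coef0 mcoeff0 raddf_sum /= (bigD1_seq m) ?msupp_uniq //=.
rewrite big1 => [|m' nm].
  by rewrite -mul_polyC coefCM coefXn eqxx mulr1 mcoeffZ mcoeffX eqxx mulr1 addr0.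
rewrite -mul_polyC coefCM coefXn; case: eqP => [emax|_]; last first.
  by rewrite mulr0 mcoeff0.
rewrite mulr1 mcoeffZ mcoeffX; case: eqP => [ew|_]; last by rewrite mulr0.
case/eqP: nm; apply/mnmP => i.
have [j ->|->] := unliftP ord_max i; last by [].
have := congr1 (fun w : 'X_{1.. n} => w j) ew; rewrite !mnmE.
by rewrite (_ : widen_ord _ j = lift ord_max j) //; apply: val_inj; rewrite /= /bump leqNgt ltn_ord.
Qed.

(** Induction on the number of variables: for fixed values of the others, the polynomial in the last
    variable vanishes on an infinite field, so each of its coefficients vanishes everywhere. *)
Lemma meval_eq0 n (p : {mpoly k[n]}) : (forall v, p.@[v] = 0) -> p = 0.
Proof.
elim: n p => [|n IHn] p p0.
  have := p0 (fun=> 0); rewrite mevalE => p00.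
  apply/mpolyP => m; rewrite mcoeff0.
  have [m_in|/memN_msupp_eq0 //] := boolP (m \in msupp p).
  have e0 (m' : 'X_{1..0}) : m' = m by apply/mnmP => -[].
  move: p00; rewrite (bigD1_seq m) ?msupp_uniq //= big_ord0 mulr1.
  by rewrite big1 ?addr0 // => m'; rewrite (e0 m') eqxx.
apply: muni_inj0; apply/polyP => e; rewrite coef0; apply: IHn => v.
have -> : ((muni p)`_e).@[v] = (map_poly (meval v) (muni p))`_e.
  by rewrite coef_map.
suff -> : map_poly (meval v) (muni p) = 0 by rewrite ?coef0.
apply: poly_fun_eq0 => x.
rewrite -(p0 (fun i => oapp v x (unlift ord_max i))) meval_muni unlift_none /=.
congr (_.[_]); apply: eq_map_poly => q; apply: meval_eq => i.
by rewrite (_ : widen_ord _ i = lift ord_max i) ?liftK //; apply: val_inj; rewrite /= /bump leqNgt ltn_ord.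
Qed.

End PolynomialFunctions.

(** * Values of polynomials at vectors indexed by a finite type *)

Section Peval.
Variables (k : closedFieldType) (I : finType).
Implicit Types (p q : {mpoly k[#|I|]}) (v : {ffun I -> k^o}).

Lemma peval0 v : peval 0 v = 0. Proof. exact: meval0. Qed.
Lemma peval1 v : peval 1 v = 1. Proof. exact: meval1. Qed.
Lemma pevalD p q v : peval (p + q) v = peval p v + peval q v.
Proof. exact: mevalD. Qed.
Lemma pevalN p v : peval (- p) v = - peval p v.
Proof. exact: mevalN. Qed.
Lemma pevalB p q v : peval (p - q) v = peval p v - peval q v.
Proof. exact: mevalB. Qed.
Lemma pevalM p q v : peval (p * q) v = peval p v * peval q v.
Proof. exact: mevalM. Qed.
Lemma pevalZ c p v : peval (c *: p) v = c * peval p v.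
Proof. exact: mevalZ. Qed.
Lemma pevalC c v : peval c%:MP v = c.
Proof. exact: mevalC. Qed.
Lemma peval_exp p n v : peval (p ^+ n) v = peval p v ^+ n.
Proof. exact: rmorphXn. Qed.
Lemma peval_sum (J : Type) (r : seq J) (P : pred J) F v :
  peval (\sum_(j <- r | P j) F j) v = \sum_(j <- r | P j) peval (F j) v.
Proof. exact: raddf_sum. Qed.
Lemma peval_prod (J : Type) (r : seq J) (P : pred J) F v :
  peval (\prod_(j <- r | P j) F j) v = \prod_(j <- r | P j) peval (F j) v.
Proof. exact: rmorph_prod. Qed.
Lemma peval_var i v : peval (pvar k i) v = v i.
Proof. by rewrite /peval /pvar mevalXU enum_rankK. Qed.

Definition pevalE := (peval0, peval1, pevalD, pevalB, pevalN, pevalM, pevalZ,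
  pevalC, peval_exp, peval_var).

Lemma peval_eq0 p : (forall v, peval p v = 0) -> p = 0.
Proof.
move=> p0; apply: meval_eq0 => v.
rewrite -(p0 [ffun i => v (enum_rank i)]); apply: meval_eq => i.
by rewrite ffunE enum_valK.
Qed.

(** Reduces identities between multivariate polynomials to identities in [k], where [ring]
    applies. *)
Lemma peval_inj p q : (forall v, peval p v = peval q v) -> p = q.
Proof.
move=> pq; apply/eqP; rewrite -subr_eq0; apply/eqP; apply: peval_eq0 => v.
by rewrite pevalB pq subrr.
Qed.

Lemma peval_neq0 p : p != 0 -> exists v, peval p v != 0.
Proof.
move=> p0; apply: contrapT => H; case/eqP: p0; apply: peval_eq0 => v.
by apply: contrapT => /eqP pv; apply: H; exists v.
Qed.

Lemma peval_nz p v : peval p v != 0 -> p != 0.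
Proof. by apply: contra_neq => ->; exact: peval0. Qed.

Lemma mpoly_varind (P : {mpoly k[#|I|]} -> Prop) :
  (forall c, P c%:MP) -> (forall i, P (pvar k i)) ->
  (forall p q, P p -> P q -> P (p + q)) ->
  (forall p q, P p -> P q -> P (p * q)) -> forall p, P p.
Proof.
move=> PC PX PD PM; elim/mpolyind => [|c m p _ _ Pp]; first by rewrite -mpolyC0.
apply: (PD) => //; rewrite -mul_mpolyC; apply: (PM) => //.
rewrite mpolyXE_id; apply: (big_ind P) => [||i _]; first by rewrite -mpolyC1.
  exact: PM.
have Pi : P 'X_i by have := PX (enum_val i); rewrite /pvar enum_valK.
by elim: (m i) => [|n IHn]; rewrite ?expr0 -?mpolyC1 // exprS; apply: PM.
Qed.

End Peval.

Section Comp.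
Variables (k : closedFieldType) (I J : finType).

Definition pcomp (p : {mpoly k[#|J|]}) (P : J -> {mpoly k[#|I|]}) :
  {mpoly k[#|I|]} := p \mPo [tuple P (enum_val i) | i < #|J|].

Lemma peval_comp p P v : peval (pcomp p P) v = peval p [ffun j => peval (P j) v].
Proof.
rewrite /peval /pcomp comp_mpoly_meval; apply: meval_eq => i.
by rewrite tnth_mktuple ffunE.
Qed.

End Comp.

(** * Polynomials of degree one in some variable *)

(** Has the shape of the existential in [generates_ideal_of], so that the two are convertible. *)
Definition pdvd (R : pzRingType) (F G : R) : Prop := exists H, G = H * F.

Section LinearInOneVariable.
Variables (k : closedFieldType) (I : finType) (i : I).
Local Notation poly := {mpoly k[#|I|]}.
Implicit Types (F G H : poly) (v : {ffun I -> k^o}).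

(** Independence of the variable [i] is stated on values: stability under the ring operations is
    then immediate and no degree has to be handled. *)
Definition free_of (F : poly) : Prop :=
  forall v v', (forall j, j != i -> v j = v' j) -> peval F v = peval F v'.

Lemma free_ofC c : free_of c%:MP. Proof. by move=> v v' _; rewrite !pevalE. Qed.
Lemma free_of1 : free_of 1. Proof. by rewrite -mpolyC1; apply: free_ofC. Qed.
Lemma free_of0 : free_of 0. Proof. by rewrite -mpolyC0; apply: free_ofC. Qed.
Lemma free_ofX j : j != i -> free_of (pvar k j).
Proof. by move=> ji v v' vv; rewrite !pevalE vv. Qed.
Lemma free_ofD F G : free_of F -> free_of G -> free_of (F + G).
Proof. by move=> hF hG v v' vv; rewrite !pevalE (hF v v') // (hG v v'). Qed.
Lemma free_ofB F G : free_of F -> free_of G -> free_of (F - G).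
Proof. by move=> hF hG v v' vv; rewrite !pevalE (hF v v') // (hG v v'). Qed.
Lemma free_ofM F G : free_of F -> free_of G -> free_of (F * G).
Proof. by move=> hF hG v v' vv; rewrite !pevalE (hF v v') // (hG v v'). Qed.
Lemma free_ofZ c F : free_of F -> free_of (c *: F).
Proof. by move=> hF v v' vv; rewrite !pevalE (hF v v'). Qed.
Lemma free_of_exp F n : free_of F -> free_of (F ^+ n).
Proof. by move=> hF v v' vv; rewrite !pevalE (hF v v'). Qed.

Variables P A B : poly.
Hypotheses (A0 : A != 0) (fA : free_of A) (fB : free_of B).
Hypothesis PE : P = A * pvar k i + B.

(** [P] has degree one in the variable [i], so the remainder is free of it; the power of [A]
    compensates for a leading coefficient that is not a unit. *)
Lemma pseudo_division G :
  exists n Q R, A ^+ n * G = Q * P + R /\ free_of R.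
Proof.
elim/(@mpoly_varind k I): G => [c|j|F G|F G].
- by exists 0%N, 0, c%:MP; rewrite expr0; split; [ring|apply: free_ofC].
- have [->|ji] := eqVneq j i.
    exists 1%N, 1, (- B); rewrite PE; split; first by ring.
    by rewrite -sub0r; apply: free_ofB => //; apply: free_of0.
  by exists 0%N, 0, (pvar k j); rewrite expr0; split; [ring|apply: free_ofX].
- move=> [n [Q [R [e fR]]]] [n' [Q' [R' [e' fR']]]].
  exists (n + n')%N, (A ^+ n' * Q + A ^+ n * Q'), (A ^+ n' * R + A ^+ n * R').
  split; last by apply: free_ofD; apply: free_ofM => //; apply: free_of_exp.
  transitivity (A ^+ n' * (A ^+ n * F) + A ^+ n * (A ^+ n' * G)).
    by rewrite exprD; ring.
  by rewrite e e'; ring.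
- move=> [n [Q [R [e fR]]]] [n' [Q' [R' [e' fR']]]].
  exists (n + n')%N, (Q * (Q' * P + R') + R * Q'), (R * R').
  split; last exact: free_ofM.
  transitivity ((A ^+ n * F) * (A ^+ n' * G)); first by rewrite exprD; ring.
  by rewrite e e'; ring.
Qed.

(** Solves [P] = 0 for the variable [i], where [A] does not vanish. *)
Definition move_to_zero v : {ffun I -> k^o} :=
  [ffun j => if j == i then - peval B v / peval A v else v j].

Lemma peval_move F v : free_of F -> peval F (move_to_zero v) = peval F v.
Proof. by move=> fF; apply: fF => j /negPf ji; rewrite ffunE ji. Qed.

Lemma move_to_zeroP v : peval A v != 0 -> peval P (move_to_zero v) = 0.
Proof.
move=> Av; rewrite PE !pevalE !peval_move // ffunE eqxx.
by field.
Qed.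

(** The zeros of [P] project onto the locus [A] != 0 of the other coordinates, so [R] times [A]
    vanishes identically. *)
Lemma free_of_vanish (R : poly) : free_of R ->
  (forall v, peval P v = 0 -> peval A v != 0 -> peval R v = 0) -> R = 0.
Proof.
move=> fR RZ; suff /eqP : R * A = 0.
  by rewrite mulf_eq0 (negPf A0) orbF => /eqP.
apply: peval_eq0 => v; rewrite pevalM.
have [->|Av] := eqVneq (peval A v) 0; first by rewrite mulr0.
by rewrite -(peval_move _ fR) RZ ?mul0r ?move_to_zeroP // peval_move.
Qed.

Hypothesis AB : forall H, pdvd A (H * B) -> pdvd A H.

(** If a power of [A] times [G] equals q (A X + B), then [A] divides q B, hence q by the coprimality
    [AB], and one factor [A] cancels. *)
Lemma pdvd_lead_cancel n G : pdvd P (A ^+ n * G) -> pdvd P G.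
Proof.
elim: n => [|n IHn]; first by rewrite expr0 mul1r.
move=> [q e]; apply: IHn.
have [q' eq] : pdvd A q.
  apply: AB; exists (A ^+ n * G - q * pvar k i).
  by rewrite mulrBl mulrAC -exprSr e PE; ring.
exists q'; apply: (mulfI A0).
by rewrite mulrA -exprS e eq; ring.
Qed.

(* Modulo P, a power of A times G is a polynomial R free of the variable i; as the
   zero of P in that variable can be solved for where A does not vanish, R = 0. *)
Lemma nullstellensatz_linear G :
  (forall v, peval P v = 0 -> peval A v != 0 -> peval G v = 0) -> pdvd P G.
Proof.
move=> GZ; have [n [Q [R [e fR]]]] := pseudo_division G.
apply: (@pdvd_lead_cancel n); exists Q; rewrite e.
rewrite (free_of_vanish fR) ?addr0 // => v Pv Av.
have := congr1 (fun F => peval F v) e.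
by rewrite !pevalE Pv (GZ v) // !mulr0 add0r => /esym.
Qed.

(** Up to powers of [A] and modulo [P], both factors become polynomials free of the variable [i];
    their product vanishes identically, and polynomials form a domain. *)
Lemma prime_linear F G : pdvd P (F * G) -> pdvd P F \/ pdvd P G.
Proof.
move=> [S eS].
have [n [Q [R [e fR]]]] := pseudo_division F.
have [n' [Q' [R' [e' fR']]]] := pseudo_division G.
have : R * R' = 0.
  apply: free_of_vanish; first exact: free_ofM.
  move=> v Pv Av; have := congr1 (fun F => peval F v) eS.
  have := congr1 (fun F => peval F v) e; have := congr1 (fun F => peval F v) e'.
  rewrite !pevalE Pv !mulr0 !add0r => <- <- FG.
  by rewrite mulrACA FG mulr0.
move/eqP; rewrite mulf_eq0 => /orP[] /eqP R0; [left|right].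
  by apply: (@pdvd_lead_cancel n); exists Q; rewrite e R0 addr0.
by apply: (@pdvd_lead_cancel n'); exists Q'; rewrite e' R0 addr0.
Qed.

(** [P] divides G D and is prime, and it cannot divide [D], which is nonzero at some zero of [P]. *)
Lemma nullstellensatz_linear_open (D : poly) G :
  (exists2 v, peval P v = 0 & peval D v != 0) ->
  (forall v, peval P v = 0 -> peval A v != 0 -> peval D v != 0 ->
     peval G v = 0) -> pdvd P G.
Proof.
move=> [v Pv Dv] GZ.
have /prime_linear [//|[Q eD]] : pdvd P (G * D).
  apply: nullstellensatz_linear => w Pw Aw; rewrite pevalM.
  by have [->|Dw] := eqVneq (peval D w) 0; rewrite ?mulr0 // GZ // mul0r.
by case/eqP: Dv; rewrite eD pevalM Pv mulr0.
Qed.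

End LinearInOneVariable.

(** * Points of projective space and their representatives *)

Section Lines.
Variables (k : closedFieldType) (I : finType).

Definition nz (u : {ffun I -> k^o}) (u0 : u != 0) : nonzero k I :=
  exist (fun u : {ffun I -> k^o} => u != 0) u u0.

Implicit Types (v w : nonzero k I) (L : proj k I).

Lemma line_surj L : exists v, L = line v.
Proof.
case: L => L dL; have L0 : L != 0%VS by rewrite -dimv_eq0 (eqP dL).
have v0 : vpick L != 0 by rewrite vpick0.
exists (exist _ (vpick L) v0); apply: val_inj => /=.
apply/esym/eqP; rewrite eqEdim -memvE memv_pick (eqP dL) /=.
by rewrite dim_vline v0.
Qed.

Lemma line_eq v w : line v = line w <-> exists c : k, sval w = c *: sval v.
Proof.
split=> [/(congr1 sval) /= e|[c e]].
  have /vlineP[c ->] : sval w \in <[sval v]>%VS by rewrite e memv_line.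
  by exists c.
apply: val_inj => /=; apply/esym/eqP; rewrite eqEdim !dim_vline.
rewrite (svalP v) (svalP w) andbT -memvE e; exact/memvZ/memv_line.
Qed.

Lemma line_scale_neq0 v w (c : k) : sval w = c *: sval v -> c != 0.
Proof. by move=> e; apply: contra_neq (svalP w) => c0; rewrite e c0 scale0r. Qed.

Lemma scaled_neq0 v (c : k) : c != 0 -> c *: sval v != 0.
Proof. by move=> c0; rewrite scaler_eq0 negb_or c0 (svalP v). Qed.

Definition scaled v (c : k) (c0 : c != 0) : nonzero k I :=
  exist _ (c *: sval v) (scaled_neq0 v c0).

Lemma line_scaled v c c0 : line (@scaled v c c0) = line v.
Proof. by apply/esym/line_eq; exists c. Qed.

Lemma in_line v (u : {ffun I -> k^o}) :
  u \in sval (line v) <-> exists c : k, u = c *: sval v.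
Proof. by split=> [/vlineP|[c ->]]; last exact/memvZ/memv_line. Qed.

Lemma nonzero_coord v : exists i, sval v i != 0.
Proof.
apply: contrapT => H; have := svalP v; apply/negP/negPn/eqP.
apply/ffunP => i; rewrite [RHS]ffunE; apply: contrapT => /eqP vi.
by apply: H; exists i.
Qed.

Lemma nonzero_at (u : {ffun I -> k^o}) i : u i != 0 -> u != 0.
Proof. by apply: contra_neq => ->; rewrite ffunE. Qed.

End Lines.

(** * Spaces presented by coordinates *)

Section Presentations.
Variable k : closedFieldType.

Section Affine.
Variables (I : finType) (E : Type) (r : E -> {ffun I -> k^o}).

Definition aopen (W : E -> Prop) : Prop :=
  exists S : {mpoly k[#|I|]} -> Prop,
    forall x, W x <-> exists2 p, S p & peval p (r x) != 0.

Definition areg (W : E -> Prop) (h : E -> k) : Prop :=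
  aopen W /\ forall x, W x -> exists a b, peval b (r x) != 0 /\
    forall y, W y -> peval b (r y) != 0 -> h y = peval a (r y) / peval b (r y).

Lemma open_induced_affine W : zopen (induced (affine k I) r) W <-> aopen W.
Proof.
split=> [[O [S OS] WO]|[S WS]].
  by exists S => x; rewrite WO OS.
exists (fun u => exists2 p, S p & peval p u != 0) => //.
by exists S.
Qed.

Lemma regular_induced_affine W h :
  zregular (induced (affine k I) r) W h <-> areg W h.
Proof.
split=> [[oW H]|[oW H]].
  have oW' := oW; split; first by rewrite -open_induced_affine.
  move=> x Wx; have [O [g [[S OS] Ox [_ gO] hg]]] := H x Wx.
  have [a [b [bx gab]]] := gO _ Ox.
  have [p Sp px] := (OS _).1 Ox.
  exists (a * p), (b * p); rewrite !pevalE mulf_neq0 //; split=> // y Wy.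
  rewrite !pevalE mulf_eq0 negb_or => /andP[bY pY].
  have Oy : O (r y) by apply/OS; exists p.
  rewrite (hg y) // (gab (r y)) // -mulf_div divff ?mulr1 //.
split; first by apply/open_induced_affine.
move=> x Wx; have [a [b [bx hab]]] := H x Wx.
exists (fun u => peval b u != 0), (fun u => peval a u / peval b u).
have oO : zopen (affine k I) (fun u => peval b u != 0).
  by exists (eq b) => u; split=> [|[_ <-]] //; exists b.
split; [exact: oO|exact: bx| |by move=> y Wy bY; apply: hab].
by split; [exact: oO | move=> u bu; exists a, b].
Qed.

End Affine.

(** [q] parametrizes the space by [E], and [r] gives coordinates on [E]. Quotients of affine pieces
    and subspaces of projective spaces are both of this form, so that one criterion for morphisms
    serves everywhere. *)
Record presented (T : Type) (X : zspace k T) (I : finType) (E : Type)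
    (q : E -> T) (r : E -> {ffun I -> k^o}) : Prop := Presented {
  presented_open : forall W, zopen X W <-> aopen r (W \o q);
  presented_regular : forall W h, zregular X W h <-> areg r (W \o q) (h \o q) }.

Lemma presented_coinduced (I : finType) E (r : E -> {ffun I -> k^o}) T
    (q : E -> T) : presented (coinduced (induced (affine k I) r) q) q r.
Proof.
split=> [W|W h]; first exact: (open_induced_affine r (W \o q)).
exact: (regular_induced_affine r (W \o q)).
Qed.

Lemma presented_proj (I : finType) :
  presented (proj_space k I) (@line k I) sval.
Proof. exact: presented_coinduced. Qed.

(** A relation [R], instead of a function, lets the same notion serve for a map and for its inverse.
    No denominators are allowed in the lift: homogeneous coordinates can be rescaled instead. *)
Definition poly_lift (I J : finType) E E' (r : E -> {ffun I -> k^o})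
    (r' : E' -> {ffun J -> k^o}) (R : E -> E' -> Prop) : Prop :=
  forall e, exists b (P : J -> {mpoly k[#|I|]}), peval b (r e) != 0 /\
    forall e1, peval b (r e1) != 0 ->
      exists e', R e1 e' /\ forall j, r' e' j = peval (P j) (r e1).

Lemma poly_lift_morphism S T (X : zspace k S) (Y : zspace k T)
    (I J : finType) E E' (q : E -> S) (r : E -> {ffun I -> k^o})
    (q' : E' -> T) (r' : E' -> {ffun J -> k^o}) (f : S -> T) :
  presented X q r -> presented Y q' r' ->
  poly_lift r r' (fun e e' => q' e' = f (q e)) -> zmorphism X Y f.
Proof.
move=> [oX gX] [oY gY] lft.
have comp (p : {mpoly k[#|J|]}) (P : J -> {mpoly k[#|I|]}) (e : E) (e' : E') :
    (forall j, r' e' j = peval (P j) (r e)) ->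
    peval (pcomp p P) (r e) = peval p (r' e').
  by move=> H; rewrite peval_comp; congr peval; apply/ffunP => j; rewrite ffunE H.
have oWf W : aopen r' (W \o q') -> aopen r ((W \o f) \o q).
  move=> [S0 WS].
  (* The preimage is the union, over all local lifts P, of the loci where both b and the pulled back
     equation are nonzero. *)
  exists (fun p' => exists b P p, [/\ S0 p, p' = b * pcomp p P &
     forall e1, peval b (r e1) != 0 -> exists e', q' e' = f (q e1) /\
       forall j, r' e' j = peval (P j) (r e1)]).
  move=> e; split=> /=.
    move=> Wfe; have [b [P [be H]]] := lft e; have [e' [qe' re']] := H e be.
    have [p Sp pe'] : exists2 p, S0 p & peval p (r' e') != 0.
      by apply/WS; rewrite /= qe'.
    exists (b * pcomp p P); first by exists b, P, p.
    by rewrite pevalM (comp _ _ _ _ re') mulf_neq0.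
  move=> [_ [b [P [p [Sp -> H]]]]]; rewrite pevalM mulf_eq0 negb_or => /andP[be].
  have [e' [<- re']] := H e be; rewrite (comp _ _ _ _ re') => pe'.
  by apply/WS; exists p.
split=> [W /oY /oWf /oX //|W g /gY [oW gW]].
apply/gX; split; first exact: oWf.
move=> e /= Wfe; have [b [P [be H]]] := lft e; have [e' [qe' re']] := H e be.
have [a [c [ce' hac]]] : exists a c, peval c (r' e') != 0 /\ forall y, W (q' y) ->
    peval c (r' y) != 0 -> g (q' y) = peval a (r' y) / peval c (r' y).
  by apply: gW; rewrite /= qe'.
exists (b * pcomp a P), (b * pcomp c P).
rewrite !pevalM (comp _ _ _ _ re') mulf_neq0 //; split=> // e1 Wfe1.
rewrite !pevalM mulf_eq0 negb_or => /andP[be1].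
have [e1' [qe1' re1']] := H e1 be1; rewrite !(comp _ _ _ _ re1') => ce1'.
by rewrite -qe1' hac ?qe1' // -mulf_div divff ?mul1r.
Qed.

(** Bijectivity would not make the inverse a morphism, as Frobenius shows, hence a lift in each
    direction; the second one also yields the surjectivity of [f]. *)
Lemma poly_lift_isomorphism S T (X : zspace k S) (Y : zspace k T)
    (I J : finType) E E' (q : E -> S) (r : E -> {ffun I -> k^o})
    (q' : E' -> T) (r' : E' -> {ffun J -> k^o}) (f : S -> T) :
  presented X q r -> presented Y q' r' ->
  injective f -> (forall y, exists e', y = q' e') ->
  poly_lift r r' (fun e e' => q' e' = f (q e)) ->
  poly_lift r' r (fun e' e => q' e' = f (q e)) ->
  zisomorphism X Y f.
Proof.
move=> pX pY f_inj q'_surj lft lft'.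
have f_surj y : exists x, f x = y.
  have [e' ->] := q'_surj y; have [b [P [be' /(_ e' be') [e [-> _]]]]] := lft' e'.
  by exists (q e).
pose g y := sval (cid (f_surj y)).
have fg : cancel g f by move=> y; rewrite /g; case: cid.
have gf : cancel f g by move=> x; apply: f_inj; rewrite fg.
exists g; split=> //; first exact: poly_lift_morphism lft.
apply: (poly_lift_morphism pY pX) => e'.
have [b [P [be' H]]] := lft' e'; exists b, P; split=> // e1 /H [e [qe re]].
by exists e; split=> //; rewrite qe gf.
Qed.

Lemma zmorphism_comp S T U (X : zspace k S) (Y : zspace k T) (Z : zspace k U)
    (f : S -> T) (g : T -> U) :
  zmorphism X Y f -> zmorphism Y Z g -> zmorphism X Z (g \o f).
Proof.
move=> [of_ rf] [og rg]; split=> [W /og /of_ //|W h /rg /rf //].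
Qed.

Lemma zisomorphism_comp S T U (X : zspace k S) (Y : zspace k T)
    (Z : zspace k U) (f : S -> T) (g : T -> U) :
  zisomorphism X Y f -> zisomorphism Y Z g -> zisomorphism X Z (g \o f).
Proof.
move=> [f' [ff' f'f mf mf']] [g' [gg' g'g mg mg']]; exists (f' \o g').
by split; [exact: can_comp|exact: can_comp|exact: zmorphism_comp mg
  |exact: zmorphism_comp mf'].
Qed.

Lemma pointed_iso_refl (C : pointed_curve k) : pointed_iso C C.
Proof. by exists id => //; exists id; split=> //; split. Qed.

Lemma pointed_iso_sym (C D : pointed_curve k) :
  pointed_iso C D -> pointed_iso D C.
Proof.
move=> [f [g [fg gf mf mg]] fm]; exists g; first by exists f.
by move=> i; rewrite -fm fg.
Qed.

Lemma pointed_iso_trans (C D E : pointed_curve k) :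
  pointed_iso C D -> pointed_iso D E -> pointed_iso C E.
Proof.
move=> [f isof fm] [g isog gm]; exists (g \o f); first exact: zisomorphism_comp isog.
by move=> i /=; rewrite fm gm.
Qed.

Lemma iso_class_eq (C D : pointed_curve k) :
  iso_class C = iso_class D <-> pointed_iso C D.
Proof.
split=> [/(congr1 (fun m => m D)) e|CD].
  by have : iso_class D D := pointed_iso_refl D; rewrite -e.
apply/funext => E; apply/propext; split=> [CE|DE].
  exact/(pointed_iso_trans _ CE)/pointed_iso_sym.
exact: pointed_iso_trans DE.
Qed.

Lemma moduli_pt_eq (C D : pointed_curve k) (sC : stable C) (sD : stable D) :
  moduli_pt sC = moduli_pt sD <-> pointed_iso C D.
Proof.
rewrite -iso_class_eq; split=> [/(congr1 sval) //|e].
exact: eq_exist.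
Qed.

End Presentations.

Lemma scale_regular (k : closedFieldType) (a : k) (b : k^o) : a *: b = a * b.
Proof. by []. Qed.

(** * Subspaces of projective space, presented by their cones *)

Section ProjectiveSubspaces.
Variables (k : closedFieldType) (I : finType).
Implicit Types (v w : nonzero k I) (L : proj k I) (p : {mpoly k[#|I|]}).

Definition pscale (c : k) p : {mpoly k[#|I|]} :=
  pcomp p (fun i => c *: pvar k i).

Lemma peval_scale c p (u : {ffun I -> k^o}) :
  peval (pscale c p) u = peval p (c *: u).
Proof.
by rewrite peval_comp; congr peval; apply/ffunP => i; rewrite !ffunE pevalZ peval_var.
Qed.

(** Clears the denominators of p(u / u_i); [N] is large enough for the degree of [p], which need not
    be homogeneous. *)
Lemma dehomogenize i p : exists N p', forall u : {ffun I -> k^o}, u i != 0 ->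
  peval p' u = u i ^+ N * peval p ((u i)^-1 *: u).
Proof.
elim/(@mpoly_varind k I): p => [c|j|p q|p q].
- by exists 0%N, c%:MP => u _; rewrite !pevalE expr0 mul1r.
- exists 1%N, (pvar k j) => u ui; rewrite !pevalE ffunE expr1.
  by rewrite scale_regular mulVKf.
- move=> [N [p' ep]] [M [q' eq]].
  exists (N + M)%N, (pvar k i ^+ M * p' + pvar k i ^+ N * q') => u ui.
  by rewrite !pevalE ep // eq // exprD; ring.
- move=> [N [p' ep]] [M [q' eq]].
  exists (N + M)%N, (p' * q') => u ui.
  by rewrite !pevalE ep // eq // exprD; ring.
Qed.

Variable A : proj k I -> Prop.

Definition cone : Type := {v : nonzero k I | A (line v)}.

Definition cone_line (e : cone) : {L | A L} := exist _ (line (sval e)) (svalP e).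

Definition cone_val (e : cone) : {ffun I -> k^o} := sval (sval e).

Lemma cone_line_surj (x : {L | A L}) : exists e, x = cone_line e.
Proof.
case: x => L AL; have [v e] := line_surj L; subst L.
by exists (exist (fun v => A (line v)) v AL); apply: eq_exist.
Qed.

(** The equations of an open subset of the cone need not be homogeneous. The open set of projective
    space inducing it is obtained by adding all their rescalings [pscale c p], whose joint
    nonvanishing locus is stable under scalars. *)
Lemma subspace_open W :
  zopen (subspace (proj_space k I) A) W <-> aopen cone_val (W \o cone_line).
Proof.
split=> [[O /(presented_open (presented_proj k I)) [S OS] WO]|[S WS]].
  by exists S => e; rewrite /= WO /= -OS.
exists (fun L => exists v, L = line v /\ exists2 p, S p & peval p (sval v) != 0).
  apply/(presented_open (presented_proj k I)).
  exists (fun p' => exists p (c : k), [/\ S p, c != 0 & p' = pscale c p]).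
  move=> v; split=> /=.
    move=> [w [/line_eq [c ew] [p Sp pw]]]; exists (pscale c p).
      by exists p, c; split=> //; apply: line_scale_neq0 ew.
    by rewrite peval_scale -ew.
  move=> [_ [p [c [Sp c0 ->]]]]; rewrite peval_scale => pv.
  by exists (scaled v c0); rewrite line_scaled; split=> //; exists p.
move=> x; have [e ex] := cone_line_surj x; subst x; split=> /=.
  by move=> /WS He; exists (sval e).
move=> [v [ev H]]; have Av : A (line v) by rewrite -ev; apply: (svalP e).
have -> : cone_line e = cone_line (exist (fun v => A (line v)) v Av).
  exact: eq_exist.
exact/WS.
Qed.

Definition chart i L : {ffun I -> k^o} :=
  let v := sval (cid (line_surj L)) in (sval v i)^-1 *: sval v.

Lemma chart_line i v : sval v i != 0 ->
  chart i (line v) = (sval v i)^-1 *: sval v.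
Proof.
rewrite /chart; case: cid => w /= /line_eq [c e] vi.
have c0 := line_scale_neq0 e.
rewrite e scalerA ffunE; congr (_ *: _).
by rewrite scale_regular invfM mulrAC mulVf ?mul1r.
Qed.

(* Quotients of polynomials are not assumed homogeneous: evaluated at the
   representative whose i-th coordinate is 1, they depend on the line only. *)
Lemma subspace_regular W h :
  zregular (subspace (proj_space k I) A) W h <->
  areg cone_val (W \o cone_line) (h \o cone_line).
Proof.
split=> [[oW H]|[oW H]].
  split; first exact/subspace_open.
  move=> e We; have [O [g [/(presented_open (presented_proj k I)) [S OS] Oe
     /(presented_regular (presented_proj k I)) [_ gO] hg]]] := H _ We.
  have [a [b [be gab]]] := gO (sval e) Oe.
  have [p Sp pe] := (OS (sval e)).1 Oe.
  exists (a * p), (b * p); rewrite !pevalM mulf_neq0 //; split=> // e1 We1.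
  rewrite !pevalM mulf_eq0 negb_or => /andP[be1 pe1].
  have Oe1 : O (line (sval e1)) by apply/(OS (sval e1)); exists p.
  have /= gab1 := gab (sval e1) Oe1 be1.
  rewrite /= (hg (cone_line e1)) //= gab1.
  by rewrite -mulf_div divff ?mulr1.
split; first exact/subspace_open.
move=> x Wx; have [e ex] := cone_line_surj x; subst x.
have [i ei] := nonzero_coord (sval e).
have ci : (cone_val e i)^-1 != 0 by rewrite invr_eq0.
have Ae' : A (line (scaled (sval e) ci)) by rewrite line_scaled; apply: (svalP e).
pose e' : cone := exist (fun v => A (line v)) _ Ae'.
have ee' : cone_line e' = cone_line e by apply: eq_exist; rewrite line_scaled.
have [a [b [be' hab]]] : exists a b, peval b (cone_val e') != 0 /\
    forall y, W (cone_line y) -> peval b (cone_val y) != 0 ->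
    h (cone_line y) = peval a (cone_val y) / peval b (cone_val y).
  by apply: H; rewrite /= ee'.
have [N [a1 ea]] := dehomogenize i a; have [M [b1 eb]] := dehomogenize i b.
pose O L := exists v, [/\ L = line v, sval v i != 0 & peval b1 (sval v) != 0].
have Oline v : O (line v) <-> sval v i != 0 /\ peval b1 (sval v) != 0.
  split=> [[w [/line_eq[c e1] wi bw]]|[vi bv]]; last by exists v.
  have c0 := line_scale_neq0 e1.
  have vi : sval v i != 0.
    by move: wi; rewrite e1 ffunE mulf_eq0 negb_or => /andP[].
  split=> //; move: bw; rewrite !eb // !mulf_eq0 !negb_or => /andP[_ bw].
  rewrite expf_eq0 (negPf vi) andbF /=.
  by move: bw; rewrite -!chart_line // (line_eq v w).2 //; exists c.
pose g L := peval a (chart i L) / peval b (chart i L).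
have oO : zopen (proj_space k I) O.
  apply/(presented_open (presented_proj k I)).
  exists (eq (pvar k i * b1)) => v; rewrite /= Oline; split.
    move=> [vi bv]; exists (pvar k i * b1) => //.
    by rewrite pevalM peval_var mulf_neq0.
  by move=> [_ <-]; rewrite pevalM peval_var mulf_eq0 negb_or => /andP[].
exists O, g; split=> //.
- apply/Oline; split=> //; rewrite eb // mulf_neq0 //.
  by rewrite expf_neq0.
- apply/(presented_regular (presented_proj k I)).
  split; first exact/(presented_open (presented_proj k I)).
  move=> v /Oline [vi bv].
  (* The exponents cross: a and b at u / u_i are a1 / u_i^N and b1 / u_i^M. *)
  exists (a1 * pvar k i ^+ M), (b1 * pvar k i ^+ N); split.
    by rewrite !pevalE mulf_neq0 // expf_neq0.
  move=> w /Oline [wi bw] _; rewrite /= /g chart_line // !pevalE ea // eb //.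
  have Nw : sval w i ^+ N != 0 by rewrite expf_neq0.
  have Mw : sval w i ^+ M != 0 by rewrite expf_neq0.
  have bw' : peval b ((sval w i)^-1 *: sval w) != 0.
    by move: bw; rewrite eb // mulf_eq0 negb_or => /andP[].
  by field; rewrite Nw Mw bw'.
- move=> y Wy Oy; have [e1 ey] := cone_line_surj y; subst y.
  move: Oy => /Oline [e1i be1].
  have ci1 : (cone_val e1 i)^-1 != 0 by rewrite invr_eq0.
  have Ae1 : A (line (scaled (sval e1) ci1)) by rewrite line_scaled; apply: (svalP e1).
  pose e1' : cone := exist (fun v => A (line v)) _ Ae1.
  have ee1 : cone_line e1' = cone_line e1 by apply: eq_exist; rewrite line_scaled.
  rewrite -{1}ee1 hab ?ee1 //; first by rewrite /g /= chart_line.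
  by move: be1; rewrite eb // mulf_eq0 negb_or => /andP[].
Qed.

Lemma presented_subspace :
  presented (subspace (proj_space k I) A) cone_line cone_val.
Proof.
split=> [W|W h]; [exact: subspace_open|exact: subspace_regular].
Qed.

End ProjectiveSubspaces.

(** * Linear maps *)

Section Linear.
Variable k : closedFieldType.

Section Mx.
Variables (I J : finType) (M : J -> I -> k).

Definition mxfun (u : {ffun I -> k^o}) : {ffun J -> k^o} :=
  [ffun j => (\sum_i M j i * u i : k^o)].

Lemma mxfun_is_linear : linear mxfun.
Proof.
move=> a u w; apply/ffunP => j; rewrite !ffunE scaler_sumr -big_split /=.
by apply: eq_bigr => i _; rewrite !ffunE !scale_regular; ring.
Qed.

HB.instance Definition _ := GRing.isLinear.Build k
  {ffun I -> k^o} {ffun J -> k^o} _ mxfun mxfun_is_linear.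

Definition lin : 'Hom({ffun I -> k^o}, {ffun J -> k^o}) := linfun mxfun.

Lemma linE u : lin u = mxfun u. Proof. exact: lfunE. Qed.

End Mx.

Section Pmap.
Variables (I J : finType) (g : 'Hom({ffun I -> k^o}, {ffun J -> k^o})).
Hypothesis g_inj : lker g == 0%VS.

Lemma pmap_subproof (L : proj k I) : \dim (g @: sval L)%VS == 1%N.
Proof.
rewrite limg_dim_eq ?(eqP (svalP L)) //.
by rewrite (eqP g_inj) capv0.
Qed.

Definition pmap (L : proj k I) : proj k J :=
  exist (fun L : {vspace _} => \dim L == 1%N) _ (pmap_subproof L).

Lemma nzmap_subproof (v : nonzero k I) : g (sval v) != 0.
Proof.
rewrite -(linear0 g) (inj_eq (lker0P g_inj)); exact: (svalP v).
Qed.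

Definition nzmap (v : nonzero k I) : nonzero k J :=
  exist (fun u : {ffun J -> k^o} => u != 0) _ (nzmap_subproof v).

Lemma pmap_line v : pmap (line v) = line (nzmap v).
Proof. by apply: val_inj; rewrite /= limg_line. Qed.

Lemma pmap_inj : injective pmap.
Proof.
move=> L L' /(congr1 sval) /= e; apply: val_inj => /=.
have K := lker0_lfunK g_inj.
have KV U : (g^-1 @: (g @: U))%VS = U.
  by rewrite -limg_comp lker0_compVf // lim1g.
by rewrite -(KV (sval L)) e KV.
Qed.

End Pmap.

Definition lfun_poly (I J : finType) (g : 'Hom({ffun I -> k^o}, {ffun J -> k^o}))
    (j : J) : {mpoly k[#|I|]} :=
  \sum_i (g [ffun l => (l == i)%:R : k^o] j : k) *: pvar k i.

Lemma peval_lfun (I J : finType) (g : 'Hom({ffun I -> k^o}, {ffun J -> k^o}))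
    (u : {ffun I -> k^o}) j : peval (lfun_poly g j) u = g u j.
Proof.
have {2}-> : u = \sum_i u i *: [ffun l => (l == i)%:R : k^o].
  apply/ffunP => l; rewrite sum_ffunE (bigD1 l) //= big1 => [|i /negPf il].
    by rewrite !ffunE eqxx scale_regular mulr1 addr0.
  by rewrite !ffunE eq_sym il scaler0.
rewrite peval_sum linear_sum sum_ffunE.
apply: eq_bigr => i _; rewrite pevalZ peval_var linearZ ffunE scale_regular.
by rewrite mulrC.
Qed.

Lemma pmap_proj_iso (I : finType) (g : 'End({ffun I -> k^o}))
    (g_inj : lker g == 0%VS) :
  zisomorphism (proj_space k I) (proj_space k I) (pmap g_inj).
Proof.
have gV_inj : lker (g^-1)%VF == 0%VS.
  by apply/lker0P; apply: (can_inj (lker0_lfunVK g_inj)).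
apply: (poly_lift_isomorphism (presented_proj k I) (presented_proj k I)).
- exact: pmap_inj.
- exact: line_surj.
- move=> v; exists 1, (lfun_poly g); rewrite peval1 oner_eq0; split=> // w _.
  exists (nzmap g_inj w); rewrite pmap_line; split=> // j.
  by rewrite peval_lfun.
- move=> v; exists 1, (lfun_poly (g^-1)%VF); rewrite peval1 oner_eq0; split=> // w _.
  exists (nzmap gV_inj w); rewrite pmap_line; split=> [|j].
    by congr line; apply: val_inj; rewrite /= lker0_lfunVK.
  by rewrite peval_lfun.
Qed.

Lemma pmap_subspace_iso (I : finType) (A A' : proj k I -> Prop)
    (g : 'End({ffun I -> k^o})) (g_inj : lker g == 0%VS)
    (f : {L | A L} -> {L | A' L}) :
  (forall x, sval (f x) = pmap g_inj (sval x)) ->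
  (forall L, A' (pmap g_inj L) -> A L) ->
  zisomorphism (subspace (proj_space k I) A) (subspace (proj_space k I) A') f.
Proof.
move=> fE A'A.
have gV_inj : lker (g^-1)%VF == 0%VS.
  by apply/lker0P; apply: (can_inj (lker0_lfunVK g_inj)).
apply: (poly_lift_isomorphism (presented_subspace A) (presented_subspace A')).
- move=> x y /(congr1 sval); rewrite !fE => /pmap_inj.
  by case: x y => [x Ax] [y Ay] /= e; apply: eq_exist.
- exact: cone_line_surj.
- move=> v; exists 1, (lfun_poly g); rewrite peval1 oner_eq0; split=> // w _.
  have Aw : A' (line (nzmap g_inj (sval w))).
    by rewrite -pmap_line -(fE (cone_line w)); apply: (svalP (f _)).
  exists (exist (fun v => A' (line v)) _ Aw); split=> [|j]; last first.
    by rewrite peval_lfun.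
  have := fE (cone_line w); case: (f _) => y Ay /= ey; apply: eq_exist.
  by rewrite ey pmap_line.
- move=> v; exists 1, (lfun_poly (g^-1)%VF); rewrite peval1 oner_eq0; split=> // w _.
  have ew : pmap g_inj (line (nzmap gV_inj (sval w))) = line (sval w).
    by rewrite pmap_line; congr line; apply: val_inj; rewrite /= lker0_lfunVK.
  have Aw : A (line (nzmap gV_inj (sval w))).
    by apply: A'A; rewrite ew; apply: (svalP w).
  exists (exist (fun v => A (line v)) _ Aw); split=> [|j]; last first.
    by rewrite peval_lfun.
  have := fE (cone_line (exist (fun v => A (line v)) _ Aw)).
  case: (f _) => y Ay /= ey; apply: eq_exist.
  by rewrite ey ew.
Qed.
End Linear.

(** Ordinals are written with [ord0] and [lift], the form in which [big_ord_recl] expands sums, so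
    that case analysis and expansion agree. *)
Lemma ord2P (P : 'I_2 -> Prop) : P (ord0 : 'I_2) -> P (lift ord0 ord0 : 'I_2) -> forall i : 'I_2, P i.
Proof.
move=> P0 P1 [[|[|//]] lt]; first by rewrite (_ : Ordinal _ = ord0) //; apply: val_inj.
by rewrite (_ : Ordinal _ = lift ord0 ord0) //; apply: val_inj.
Qed.

Lemma ord3P (P : 'I_3 -> Prop) : P (ord0 : 'I_3) -> P (lift ord0 ord0 : 'I_3) ->
  P (lift ord0 (lift ord0 ord0) : 'I_3) -> forall i : 'I_3, P i.
Proof.
move=> P0 P1 P2 [[|[|[|//]]] lt].
- by rewrite (_ : Ordinal _ = ord0) //; apply: val_inj.
- by rewrite (_ : Ordinal _ = lift ord0 ord0) //; apply: val_inj.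
- by rewrite (_ : Ordinal _ = lift ord0 (lift ord0 ord0)) //; apply: val_inj.
Qed.

Lemma ord4P (P : 'I_4 -> Prop) : P (ord0 : 'I_4) -> P (lift ord0 ord0 : 'I_4) ->
  P (lift ord0 (lift ord0 ord0) : 'I_4) ->
  P (lift ord0 (lift ord0 (lift ord0 ord0)) : 'I_4) -> forall i : 'I_4, P i.
Proof.
move=> P0 P1 P2 P3 [[|[|[|[|//]]]] lt].
- by rewrite (_ : Ordinal _ = ord0) //; apply: val_inj.
- by rewrite (_ : Ordinal _ = lift ord0 ord0) //; apply: val_inj.
- by rewrite (_ : Ordinal _ = lift ord0 (lift ord0 ord0)) //; apply: val_inj.
- by rewrite (_ : Ordinal _ = lift ord0 (lift ord0 (lift ord0 ord0))) //; apply: val_inj.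
Qed.

Notation "'a0" := (ord0 : 'I_2) (at level 0).
Notation "'a1" := (lift ord0 ord0 : 'I_2) (at level 0).
Notation "'c0" := (ord0 : 'I_3) (at level 0).
Notation "'c1" := (lift ord0 ord0 : 'I_3) (at level 0).
Notation "'c2" := (lift ord0 (lift ord0 ord0) : 'I_3) (at level 0).
Notation "'m0" := (ord0 : 'I_4) (at level 0).
Notation "'m1" := (lift ord0 ord0 : 'I_4) (at level 0).
Notation "'m2" := (lift ord0 (lift ord0 ord0) : 'I_4) (at level 0).
Notation "'m3" := (lift ord0 (lift ord0 (lift ord0 ord0)) : 'I_4) (at level 0).

(** * Brackets of plane vectors and transitivity on triples of points *)

Section Brackets.
Variable k : closedFieldType.
Local Notation V := {ffun 'I_2 -> k^o}.
Implicit Types (u v w : V).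

Definition vec2 (a b : k) : V := [ffun i => if i == 'a0 then a else b].

Lemma vec2_0 a b : vec2 a b 'a0 = a. Proof. by rewrite ffunE. Qed.
Lemma vec2_1 a b : vec2 a b 'a1 = b. Proof. by rewrite ffunE. Qed.

Lemma vec2P u v : u 'a0 = v 'a0 -> u 'a1 = v 'a1 -> u = v.
Proof. by move=> e0 e1; apply/ffunP; apply: ord2P. Qed.

Definition br u v : k := u 'a0 * v 'a1 - u 'a1 * v 'a0.

Lemma br_anti u v : br v u = - br u v.
Proof. by rewrite /br; ring. Qed.

Lemma br_self u : br u u = 0.
Proof. by rewrite /br; ring. Qed.

Lemma brZl c u v : br (c *: u) v = c * br u v.
Proof. by rewrite /br !ffunE !scale_regular; ring. Qed.

Lemma brZr c u v : br u (c *: v) = c * br u v.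
Proof. by rewrite /br !ffunE !scale_regular; ring. Qed.

Lemma br_eq0 u v : u != 0 -> br u v = 0 -> exists c : k, v = c *: u.
Proof.
move=> u0 /eqP; rewrite subr_eq0 => /eqP e.
have [u00|u00] := eqVneq (u 'a0) 0; last first.
  exists (v 'a0 / u 'a0); apply: vec2P; rewrite ffunE scale_regular ?divfK //.
  by rewrite mulrAC [v 'a0 * _]mulrC -e; field.
have u1 : u 'a1 != 0.
  apply: contra_neq u0 => u10; apply: vec2P; rewrite ffunE //.
move: e; rewrite u00 mul0r => /esym/eqP; rewrite mulf_eq0 (negPf u1) /= => /eqP v0.
by exists (v 'a1 / u 'a1); apply: vec2P; rewrite ffunE scale_regular ?divfK // u00 v0 mulr0.
Qed.

Lemma line_eq2 (v w : nonzero k 'I_2) : line v = line w <-> br (sval v) (sval w) = 0.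
Proof.
rewrite line_eq; split=> [[c ->]|]; first by rewrite brZr br_self mulr0.
by move/br_eq0 => /(_ (svalP v)).
Qed.

Lemma line_neq2 (v w : nonzero k 'I_2) : line v <> line w <-> br (sval v) (sval w) != 0.
Proof. by rewrite line_eq2; split=> /eqP. Qed.

Definition mx2 (a b c d : k) : 'I_2 -> 'I_2 -> k :=
  fun j i => if j == 'a0 then (if i == 'a0 then a else b)
             else (if i == 'a0 then c else d).

Lemma mx2E a b c d u :
  lin (mx2 a b c d) u = vec2 (a * u 'a0 + b * u 'a1) (c * u 'a0 + d * u 'a1).
Proof.
by rewrite linE; apply: vec2P; rewrite !ffunE /mx2 !big_ord_recl big_ord0 /= addr0.
Qed.

Lemma br_mx2 a b c d u v : br (lin (mx2 a b c d) u) (lin (mx2 a b c d) v) =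
  (a * d - b * c) * br u v.
Proof. by rewrite !mx2E /br !vec2_0 !vec2_1; ring. Qed.

Lemma lker_mx2 a b c d : a * d - b * c != 0 -> lker (lin (mx2 a b c d)) == 0%VS.
Proof.
move=> D0; apply/lker0P => u v e; apply/eqP; rewrite -subr_eq0; apply/eqP.
have e0 w : br (u - v) w = 0.
  apply: (mulfI D0); rewrite mulr0 -br_mx2 raddfB /= e subrr.
  by rewrite /br !ffunE !mul0r subrr.
move: (u - v) e0 => w e0; apply: vec2P; rewrite ffunE.
  by have := e0 (vec2 0 1); rewrite /br vec2_0 vec2_1 mulr1 mulr0 subr0.
by have := e0 (vec2 (-1) 0); rewrite /br vec2_0 vec2_1 !mulr0 mulrN1 opprK add0r.
Qed.

Lemma linear2_br (g : 'End(V)) : lker g == 0%VS ->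
  exists2 D : k, D != 0 & forall u v, br (g u) (g v) = D * br u v.
Proof.
move=> g0; pose a := g (vec2 1 0); pose b := g (vec2 0 1).
have E u : g u = u 'a0 *: a + u 'a1 *: b.
  rewrite /a /b -!linearZ -raddfD /=; congr (g _).
  by apply: vec2P; rewrite !ffunE /= !scale_regular ?mulr1 ?mulr0 ?addr0 ?add0r.
have brE u v : br (g u) (g v) = br a b * br u v.
  by rewrite !E /br !ffunE !scale_regular; ring.
exists (br a b) => //; apply/eqP => D0.
have a0 : a != 0.
  rewrite /a -(linear0 g) (inj_eq (lker0P g0)); apply: (@nonzero_at _ _ _ 'a0).
  by rewrite vec2_0 oner_eq0.
have [c bc] := br_eq0 a0 D0.
have /(lker0P g0) : g (vec2 0 1) = g (vec2 c 0).
  by rewrite -/b bc E vec2_0 vec2_1 scale0r addr0.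
move=> /(congr1 (fun f : V => f 'a1)); rewrite !vec2_1.
by apply/eqP/oner_neq0.
Qed.

Lemma three_transitive (v1 v2 v3 w1 w2 w3 : V) :
  br v1 v2 != 0 -> br v1 v3 != 0 -> br v2 v3 != 0 ->
  br w1 w2 != 0 -> br w1 w3 != 0 -> br w2 w3 != 0 ->
  exists g : 'End(V), [/\ lker g == 0%VS,
    br (g v1) w1 = 0, br (g v2) w2 = 0, br (g v3) w3 = 0 &
    forall v4 w4, (br v1 v3 * br v2 v4) * (br w1 w2 * br w3 w4) =
                  (br v1 v2 * br v3 v4) * (br w1 w3 * br w2 w4) ->
      br (g v4) w4 = 0].
Proof.
move=> v12 v13 v23 w12 w13 w23.
pose al := br w3 w2 * br v3 v1; pose be := - br w3 w1 * br v3 v2.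
(* [g u = al (u, v2) w1 + be (u, v1) w2], where the ratio of [al] and [be] is
   dictated by the line of [g v3]. *)
pose g := lin (mx2 (al * v2 'a1 * w1 'a0 + be * v1 'a1 * w2 'a0)
                   (- (al * v2 'a0 * w1 'a0) - be * v1 'a0 * w2 'a0)
                   (al * v2 'a1 * w1 'a1 + be * v1 'a1 * w2 'a1)
                   (- (al * v2 'a0 * w1 'a1) - be * v1 'a0 * w2 'a1)).
have gE u j : g u j = al * br u v2 * w1 j + be * br u v1 * w2 j.
  by move: j; apply: ord2P; rewrite mx2E ?vec2_0 ?vec2_1 /br; ring.
exists g; split.
- apply: lker_mx2.
  rewrite (_ : _ - _ = - (al * be * br v1 v2 * br w1 w2)); last by rewrite /br; ring.
  rewrite oppr_eq0 !mulf_neq0 // ?oppr_eq0 // br_anti oppr_eq0 //.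
- by rewrite /br !gE br_self; ring.
- by rewrite /br !gE br_self; ring.
- by rewrite /br !gE /al /be /br; ring.
- move=> v4 w4 e.
  (* The two sides of the cross-ratio equation are exactly the two terms of this bracket. *)
  have -> : br (g v4) w4 = (br v1 v3 * br v2 v4) * (br w1 w2 * br w3 w4) -
                  (br v1 v2 * br v3 v4) * (br w1 w3 * br w2 w4).
    by rewrite /br !gE /al /be /br; ring.
  by rewrite e subrr.
Qed.

End Brackets.

(** * Cross-ratio forms and orbit closures *)

Section CrossRatioForms.
Variable k : closedFieldType.
Local Notation V4 := {ffun 'I_4 * 'I_2 -> k^o}.
Local Notation XX i j := (pvar k (i, j) : {mpoly k[#|{: 'I_4 * 'I_2}|]}).

Definition brp (i j : 'I_4) : {mpoly k[#|{: 'I_4 * 'I_2}|]} :=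
  XX i 'a0 * XX j 'a1 - XX i 'a1 * XX j 'a0.

Definition cr_form (a b : k) : {mpoly k[#|{: 'I_4 * 'I_2}|]} :=
  b *: (brp 'm0 'm1 * brp 'm2 'm3) - a *: (brp 'm0 'm2 * brp 'm1 'm3).

Definition pt4 (v : V4) (i : 'I_4) : {ffun 'I_2 -> k^o} := [ffun j => v (i, j)].

Lemma peval_brp i j v : peval (brp i j) v = br (pt4 v i) (pt4 v j).
Proof. by rewrite !pevalE /br !ffunE. Qed.

Lemma peval_cr_form a b v : peval (cr_form a b) v =
  b * (br (pt4 v 'm0) (pt4 v 'm1) * br (pt4 v 'm2) (pt4 v 'm3)) -
  a * (br (pt4 v 'm0) (pt4 v 'm2) * br (pt4 v 'm1) (pt4 v 'm3)).
Proof. by rewrite pevalB !pevalZ !pevalM !peval_brp. Qed.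

Definition vec4 (x00 x01 x10 x11 x20 x21 x30 x31 : k) : V4 :=
  [ffun ij : 'I_4 * 'I_2 => nth 0 [:: x00; x01; x10; x11; x20; x21; x30; x31]
                  (ij.1 * 2 + ij.2)%N].

Section Generic.
Variables a b : k.
Hypotheses (a0 : a != 0) (b0 : b != 0) (ab : a != b).

Let F := cr_form a b.
(* F is linear in X30, and its leading coefficient A is linear in X00. *)
Let A := a *: (brp 'm0 'm2 * XX 'm1 'a1) - b *: (brp 'm0 'm1 * XX 'm2 'a1).
Let B := (b *: (brp 'm0 'm1 * XX 'm2 'a0) - a *: (brp 'm0 'm2 * XX 'm1 'a0))
           * XX 'm3 'a1.
Let A' := (a - b) *: (XX 'm1 'a1 * XX 'm2 'a1).
Let B' := (b *: (XX 'm1 'a0 * XX 'm2 'a1) - a *: (XX 'm2 'a0 * XX 'm1 'a1))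
            * XX 'm0 'a1.

Let FE : F = A * XX 'm3 'a0 + B.
Proof. by apply: peval_inj => v; rewrite /F /A /B /cr_form /brp !pevalE; ring. Qed.

Let AE : A = A' * XX 'm0 'a0 + B'.
Proof. by apply: peval_inj => v; rewrite /A /A' /B' /brp !pevalE; ring. Qed.

Ltac free := repeat first [apply: free_ofB | apply: free_ofD | apply: free_ofM |
  apply: free_ofZ | by apply: free_ofX].

Let fA : free_of ('m3, 'a0) A. Proof. by free. Qed.
Let fB : free_of ('m3, 'a0) B. Proof. by free. Qed.
Let fA' : free_of ('m0, 'a0) A'. Proof. by free. Qed.
Let fB' : free_of ('m0, 'a0) B'. Proof. by free. Qed.

Ltac evalv := rewrite !pevalE ?peval_brp /br !ffunE /=.

Let A'0 : A' != 0.
Proof.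
apply: (@peval_nz _ _ _ (vec4 0 0 0 1 0 1 0 0)); evalv.
by rewrite !mulr1 subr_eq0.
Qed.

Let A0 : A != 0.
Proof.
apply: (@peval_nz _ _ _ (vec4 1 0 0 1 0 1 0 0)); evalv.
by rewrite !(mulr1, mulr0, mul1r, mul0r, subr0) subr_eq0.
Qed.

(** A variable is the linear case with leading coefficient 1 and constant term 0. *)
Lemma prime_var (I : finType) (i : I) (G H : {mpoly k[#|I|]}) :
  pdvd (pvar k i) (G * H) -> pdvd (pvar k i) G \/ pdvd (pvar k i) H.
Proof.
apply: (@prime_linear k I i _ 1 0) => //.
- exact: oner_neq0.
- exact: free_of1.
- exact: free_of0.
- by rewrite mul1r addr0.
- by move=> H' _; exists H'; rewrite mulr1.
Qed.

(** [A'] is a nonzero constant, as a != b, times X11 X21. Neither variable divides [B'], which takes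
    the value b, respectively -a, at a point where that variable vanishes. *)
Let A'B' H : pdvd A' (H * B') -> pdvd A' H.
Proof.
move=> [q e].
have n1 : ~ pdvd (XX 'm1 'a1) B'.
  move=> [r /(congr1 (fun G => peval G (vec4 0 1 1 0 0 1 0 0)))]; evalv.
  by rewrite !(mulr1, mulr0, mul1r, mul0r, subr0) => /eqP; rewrite (negPf b0).
have n2 : ~ pdvd (XX 'm2 'a1) B'.
  move=> [r /(congr1 (fun G => peval G (vec4 0 1 0 1 1 0 0 0)))]; evalv.
  by rewrite !(mulr1, mulr0, mul1r, mul0r, sub0r) => /eqP; rewrite oppr_eq0 (negPf a0).
have X0 : XX 'm1 'a1 != 0.
  apply: (@peval_nz _ _ _ (vec4 0 0 0 1 0 1 0 0)); evalv; exact: oner_neq0.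
have [|[H1 e1] | //] := @prime_var _ ('m1, 'a1) H B'.
  by exists ((a - b) *: (q * XX 'm2 'a1)); rewrite e /A' -!mul_mpolyC; ring.
have [|[H2 e2] | //] := @prime_var _ ('m2, 'a1) H1 B'.
  exists ((a - b) *: q); apply: (mulfI X0).
  by rewrite mulrA [_ * H1]mulrC -e1 e /A' -!mul_mpolyC; ring.
exists ((a - b)^-1 *: H2); rewrite e1 e2 /A' -!scalerAr -scalerAl scalerA divff ?subr_eq0 //.
by rewrite scale1r; ring.
Qed.

(** [A] is itself linear in X00, hence prime by the same criterion; it remains to see that it does
    not divide [B]. At the chosen point [A] vanishes and [B] equals a - b. *)
Let AB H : pdvd A (H * B) -> pdvd A H.
Proof.
case/(prime_linear A'0 fA' fB' AE A'B') => // -[r e].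
have /(congr1 (fun G => peval G (vec4 0 1 1 0 1 0 0 1))) := e.
evalv; rewrite !(mulr1, mulr0, mul1r, mul0r, subr0, sub0r, add0r, addr0, oppr0, mulrN1, opprK) => /eqP.
by rewrite addrC subr_eq0 (negPf ab).
Qed.

Lemma cr_form_prime G H : pdvd F (G * H) -> pdvd F G \/ pdvd F H.
Proof. exact: (prime_linear A0 fA fB FE AB). Qed.

Lemma cr_form_neq0 : F != 0.
Proof.
apply: (@peval_nz _ _ _ (vec4 1 0 1 0 0 1 0 1)); rewrite /F peval_cr_form /br !ffunE /=.
by rewrite !(mulr1, mulr0, mul1r, mul0r, subr0, sub0r) oppr_eq0.
Qed.

Lemma cr_form_irreducible : irreducible F.
Proof.
split=> [||G H e]; first exact: cr_form_neq0.
  apply/negP => /unitrP [G [_ /(congr1 (fun H => peval H 0))]].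
  rewrite pevalM peval1 /F peval_cr_form /br !ffunE !mul0r subrr !mulr0 subrr mul0r.
  by move/esym/eqP; rewrite oner_eq0.
have unit_r (G' H' : {mpoly k[#|{: 'I_4 * 'I_2}|]}) : F = G' * H' ->
    pdvd F G' -> H' \is a GRing.unit.
  move=> e' [Q eQ]; apply/unitrP; exists Q.
  have QH : Q * H' = 1.
    apply: (mulfI cr_form_neq0); rewrite mulr1 {2}e' eQ; ring.
  by rewrite [H' * Q]mulrC.
have /cr_form_prime [] : pdvd F (G * H) by exists 1; rewrite mul1r.
  by move/(unit_r _ _ e); right.
by move/(unit_r H G); rewrite mulrC => /(_ e); left.
Qed.

Lemma cr_form_nullstellensatz (D G : {mpoly k[#|{: 'I_4 * 'I_2}|]}) :
  (exists2 v, peval F v = 0 & peval D v != 0) ->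
  (forall v, peval F v = 0 -> peval D v != 0 -> peval G v = 0) -> pdvd F G.
Proof.
move=> FD FDG; apply: (nullstellensatz_linear_open A0 fA fB FE AB FD).
by move=> v Fv _ Dv; apply: FDG.
Qed.

End Generic.

(** The alternating symbol: the bracket [ij] is the sum over s, t of [sgn2 s t] x_(i, s) x_(j, t),
    from which [cr_coef] reads the coefficients of [cr_form]. *)
Definition sgn2 (i j : 'I_2) : k :=
  if (i == 'a0) && (j == 'a1) then 1 else
  if (i == 'a1) && (j == 'a0) then -1 else 0.

Definition cr_coef (a b : k) : {ffun monos -> k^o} :=
  [ffun s : monos => b * (sgn2 (s 'm0) (s 'm1) * sgn2 (s 'm2) (s 'm3)) -
            a * (sgn2 (s 'm0) (s 'm2) * sgn2 (s 'm1) (s 'm3))].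

Definition mono4 (i : 'I_2 * 'I_2 * 'I_2 * 'I_2) : monos :=
  [ffun t : 'I_4 => if t == 'm0 then i.1.1.1 else if t == 'm1 then i.1.1.2 else
            if t == 'm2 then i.1.2 else i.2].

Lemma sum_monos (G : monos -> k) :
  \sum_s G s = \sum_i \sum_j \sum_l \sum_m G (mono4 (i, j, l, m)).
Proof.
rewrite !pair_big /= (reindex mono4) /=; last first.
  exists (fun s : monos => (s 'm0, s 'm1, s 'm2, s 'm3)).
    by move=> [[[i j] l] m] _; rewrite !ffunE.
  by move=> s _; apply/ffunP; apply: ord4P; rewrite ffunE.
by apply: eq_bigr => -[[[i j] l] m] _.
Qed.

Lemma peval_form (c : {ffun monos -> k^o}) v : peval (form c) v =
  \sum_(s : monos) c s * \prod_(i < 4) v (i, s i).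
Proof.
rewrite peval_sum; apply: eq_bigr => s _; rewrite pevalZ peval_prod.
by congr (_ * _); apply: eq_bigr => i _; rewrite peval_var.
Qed.

Lemma form_cr_coef a b : form (cr_coef a b) = cr_form a b.
Proof.
apply: peval_inj => v; rewrite peval_form sum_monos peval_cr_form.
rewrite !big_ord_recl !big_ord0 /= !ffunE /sgn2 /= /br !ffunE.
ring.
Qed.

Lemma formZ c (u : {ffun monos -> k^o}) : form (c *: u) = c *: form u.
Proof.
rewrite /form scaler_sumr; apply: eq_bigr => s _.
by rewrite ffunE scalerA.
Qed.

(** The point with coordinate 1 at each (i, s i) and 0 elsewhere kills every monomial but that of
    index s. *)
Lemma form_inj : injective (@form k).
Proof.
move=> c d e; apply/ffunP => s.
have ev (u : {ffun monos -> k^o}) :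
    peval (form u) [ffun ij : 'I_4 * 'I_2 => ((s ij.1 == ij.2)%:R : k^o)] = u s.
  rewrite peval_form (bigD1 s) //= [X in _ + X]big1 => [|t ts].
    rewrite big1 ?mulr1 ?addr0 // => i _.
    by rewrite ffunE eqxx.
  have /existsP [i ti] : [exists i, t i != s i].
    rewrite -negb_forall; apply: contra ts => /forallP H.
    by apply/eqP/ffunP => i; apply/eqP.
  by rewrite (bigD1 i) //= ffunE /= eq_sym (negPf ti) mul0r mulr0.
by rewrite -(ev c) -(ev d) e.
Qed.

End CrossRatioForms.

(** * Orbit closures of four distinct points and their forms *)

Section OrbitClosures.
Variable k : closedFieldType.
Implicit Types A B : coords k.

Definition brc A i j : k := br (sval (A i)) (sval (A j)).
Definition cr_num A : k := brc A 'm0 'm1 * brc A 'm2 'm3.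
Definition cr_den A : k := brc A 'm0 'm2 * brc A 'm1 'm3.

(** The Plücker relation; it shows that a != b for four distinct points. *)
Lemma plucker A : cr_den A - cr_num A = brc A 'm0 'm3 * brc A 'm1 'm2.
Proof. by rewrite /cr_den /cr_num /brc /br; ring. Qed.

Lemma pt4_flat A i : pt4 (flat_coords A) i = sval (A i).
Proof. by apply/ffunP => j; rewrite !ffunE. Qed.

Lemma points_surj (x : 'I_4 -> P1 k) : exists A, x = points A.
Proof.
exists (fun i => sval (cid (line_surj (x i)))).
by apply/funext => i; rewrite /points; case: cid.
Qed.

Lemma points_inj A : injective (points A) <->
  (forall i j, i != j -> brc A i j != 0).
Proof.
split=> [inj i j ij|H i j].
  by apply/line_neq2 => /inj e; rewrite e eqxx in ij.
move/line_eq2 => /eqP e; apply/eqP; apply: contraLR e; exact: H.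
Qed.

Lemma peval_cr_flat a b A : peval (cr_form a b) (flat_coords A) =
  b * cr_num A - a * cr_den A.
Proof. by rewrite peval_cr_form !pt4_flat. Qed.

(** Its nonvanishing cuts out the configurations of distinct points; it is the polynomial [D] of the
    open form of the Nullstellensatz. *)
Definition all_brp : {mpoly k[#|{: 'I_4 * 'I_2}|]} :=
  brp k 'm0 'm1 * brp k 'm0 'm2 * brp k 'm0 'm3 * brp k 'm1 'm2 * brp k 'm1 'm3
    * brp k 'm2 'm3.

Lemma points_inj_all_brp A :
  injective (points A) <-> peval all_brp (flat_coords A) != 0.
Proof.
rewrite points_inj /all_brp !pevalM !peval_brp !pt4_flat !mulf_eq0 !negb_or.
split=> [H|]; first by do ![apply/andP; split]; apply: H.
rewrite -!andbA => /andP[n01 /and5P[n02 n03 n12 n13 n23]].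
have anti i j : brc A i j != 0 -> brc A j i != 0.
  by rewrite /brc br_anti oppr_eq0.
by apply: ord4P; apply: ord4P => //; rewrite ?eqxx // => _; apply: anti.
Qed.

Lemma all_brp_flat (v : {ffun 'I_4 * 'I_2 -> k^o}) :
  peval all_brp v != 0 -> exists A, v = flat_coords A.
Proof.
rewrite /all_brp !pevalM !peval_brp !mulf_eq0 !negb_or -!andbA.
move=> /andP[n01 /and5P[_ _ _ _ n23]].
have br0l (w : {ffun 'I_2 -> k^o}) : br 0 w = 0 by rewrite /br !ffunE !mul0r subrr.
have br0r (w : {ffun 'I_2 -> k^o}) : br w 0 = 0 by rewrite br_anti br0l oppr0.
have v0 : forall i, pt4 v i != 0.
  by apply: ord4P; [move: n01|move: n01|move: n23|move: n23];
    apply: contra_neq => ->; rewrite ?br0l ?br0r.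
exists (fun i => nz (v0 i)).
by apply/ffunP => -[i j]; rewrite !ffunE.
Qed.

Lemma cr_scaled A B : (forall i, line (A i) = line (B i)) ->
  exists2 c : k, c != 0 & cr_num B = c * cr_num A /\ cr_den B = c * cr_den A.
Proof.
move=> e; have H i : exists c : k, sval (B i) = c *: sval (A i) by apply/line_eq.
have [c0 e0] := H 'm0; have [c1 e1] := H 'm1; have [c2 e2] := H 'm2.
have [c3 e3] := H 'm3; exists (c0 * c1 * c2 * c3).
  by rewrite !mulf_neq0 // ?(line_scale_neq0 e0) ?(line_scale_neq0 e1)
    ?(line_scale_neq0 e2) ?(line_scale_neq0 e3).
by rewrite /cr_num /cr_den /brc e0 e1 e2 e3 !brZl !brZr; split; ring.
Qed.

Section Orbit.
Variable A : coords k.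
Hypothesis A_inj : injective (points A).
Let a := cr_num A.
Let b := cr_den A.

Lemma cr_generic : [/\ a != 0, b != 0 & a != b].
Proof.
have H := (points_inj A).1 A_inj.
split; [by apply: mulf_neq0; apply: H|by apply: mulf_neq0; apply: H|].
by rewrite eq_sym -subr_eq0 plucker mulf_neq0 ?H.
Qed.

Lemma orbit_cr_form B : PGL2_orbit (points A) (points B) ->
  peval (cr_form a b) (flat_coords B) = 0.
Proof.
move=> [g g0 gx]; have g0' : lker g == 0%VS by apply/eqP.
have [D D0 brg] := linear2_br g0'.
have eB i : line (nzmap g0' (A i)) = line (B i).
  by rewrite -pmap_line; apply: val_inj; rewrite /= -(gx i).
have [c c0 [en ed]] := cr_scaled eB.
rewrite peval_cr_flat en ed {1}/cr_num {1}/cr_den /brc /= !brg.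
by rewrite /a /b /cr_num /cr_den /brc; ring.
Qed.

Lemma cr_form_orbit B : injective (points B) ->
  peval (cr_form a b) (flat_coords B) = 0 -> PGL2_orbit (points A) (points B).
Proof.
move=> B_inj; have HA := (points_inj A).1 A_inj; have HB := (points_inj B).1 B_inj.
rewrite peval_cr_flat => /eqP; rewrite subr_eq0 => /eqP e.
have [g [g0 e0 e1 e2 e3]] := three_transitive
  (HA 'm0 'm1 isT) (HA 'm0 'm2 isT) (HA 'm1 'm2 isT)
  (HB 'm0 'm1 isT) (HB 'm0 'm2 isT) (HB 'm1 'm2 isT).
have g_line i : br (g (sval (A i))) (sval (B i)) = 0 ->
    sval (points B i) = (g @: sval (points A i))%VS.
  move=> H; have /line_eq2 : br (sval (nzmap g0 (A i))) (sval (B i)) = 0 by [].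
  by rewrite -pmap_line => /(congr1 sval).
exists g; first exact/eqP.
by apply: ord4P; apply: g_line => //; apply: e3.
Qed.

(** The zero locus of the form is closed and contains the orbit. Conversely, if a neighbourhood of B
    defined by p(B) != 0 missed the orbit, p would vanish at all distinct configurations among the
    zeros of the form, since these make up the orbit; p would be a multiple of the form, and p(B) =
    0. *)
Lemma orbit_closureE B :
  orbit_closure (points A) (points B) <-> peval (cr_form a b) (flat_coords B) = 0.
Proof.
have [a0 b0 ab] := cr_generic.
have P4 := presented_coinduced (@flat_coords k) (@points k).
split=> [cB|FB].
  apply: contrapT => /eqP FB.
  pose W y := exists2 B', y = points B' & peval (cr_form a b) (flat_coords B') != 0.
  have Wpoints B' : W (points B') <-> peval (cr_form a b) (flat_coords B') != 0.
    split=> [[C eC]|FB']; last by exists B'.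
    have [|c c0 [en ed]] := @cr_scaled C B'.
      by move=> i; rewrite -[line (C i)]/(points C i) -eC.
    rewrite !peval_cr_flat en ed; apply: contra_neq => /eqP.
    rewrite (_ : _ - _ = c * (b * cr_num C - a * cr_den C)); last by ring.
    by rewrite mulf_eq0 (negPf c0) => /eqP.
  have [||y [C ey FC] oy] := cB W.
  - apply/(presented_open P4); exists (eq (cr_form a b)) => B'; rewrite /= Wpoints.
    by split=> [H|[_ <-]] //; exists (cr_form a b).
  - exact/Wpoints.
  - by subst y; rewrite orbit_cr_form ?eqxx in FC.
move=> W /(presented_open P4) [S WS] /(WS B) [p Sp pB].
apply: contrapT => H.
have [Q ep] : pdvd (cr_form a b) p.
  apply: (cr_form_nullstellensatz a0 b0 ab (D := all_brp)).
    exists (flat_coords A); last exact/points_inj_all_brp.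
    by rewrite peval_cr_flat /a /b; ring.
  move=> v Fv Dv; have [B' ev] := all_brp_flat Dv; subst v.
  apply: contrapT => /eqP pB'; apply: H; exists (points B').
    by apply/(WS B'); exists p.
  by apply: cr_form_orbit => //; apply/points_inj_all_brp.
by case/eqP: pB; rewrite ep pevalM FB mulr0.
Qed.

Lemma cr_form_generates : generates_ideal_of (cr_form a b)
  (fun v => exists2 B, v = flat_coords B & orbit_closure (points A) (points B)).
Proof.
have [a0 b0 ab] := cr_generic.
move=> G; split=> [H|[Q ->] v [B -> /orbit_closureE FB]]; last first.
  by rewrite pevalM FB mulr0.
apply: (cr_form_nullstellensatz a0 b0 ab (D := all_brp)).
  exists (flat_coords A); last exact/points_inj_all_brp.
  by rewrite peval_cr_flat /a /b; ring.
move=> v Fv Dv; have [B ev] := all_brp_flat Dv; subst v.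
by apply: H; exists B => //; apply/orbit_closureE.
Qed.

End Orbit.

(** The coefficients of index (0, 1, 0, 1) and (0, 0, 1, 1) are b and -a: the parameters are read on
    these two. *)
Lemma cr_coef_neq0 (a b : k) : (a != 0) || (b != 0) -> cr_coef a b != 0.
Proof.
move=> ab; apply/eqP => e; move: ab.
have := congr1 (fun c : {ffun monos -> k^o} => c (mono4 ('a0, 'a1, 'a0, 'a1))) e.
have := congr1 (fun c : {ffun monos -> k^o} => c (mono4 ('a0, 'a0, 'a1, 'a1))) e.
rewrite !ffunE /sgn2 /= !(mulr0, mulr1, mul0r, subr0, sub0r) => /eqP.
by rewrite oppr_eq0 => -> ->; rewrite eqxx.
Qed.

Lemma cr_coefZ (c a b : k) : cr_coef (c * a) (c * b) = c *: cr_coef a b.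
Proof. by apply/ffunP => s; rewrite !ffunE scale_regular; ring. Qed.

Lemma cr_coef_inj a b a' b' : cr_coef a b = cr_coef a' b' :> {ffun monos -> k^o} ->
  a = a' /\ b = b'.
Proof.
move=> e.
have := congr1 (fun c : {ffun monos -> k^o} => c (mono4 ('a0, 'a1, 'a0, 'a1))) e.
have := congr1 (fun c : {ffun monos -> k^o} => c (mono4 ('a0, 'a0, 'a1, 'a1))) e.
by rewrite !ffunE /sgn2 /= !(mulr0, mulr1, mul0r, subr0, sub0r) => /oppr_inj.
Qed.

Definition cr_vec (a b : k) (ab : (a != 0) || (b != 0)) : nonzero k monos :=
  exist (fun c : {ffun monos -> k^o} => c != 0) (cr_coef a b) (cr_coef_neq0 ab).

Definition cr_point a b ab : P15 k := line (@cr_vec a b ab).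

Lemma cr_point_eq a b ab a' b' ab' :
  @cr_point a b ab = @cr_point a' b' ab' <-> a * b' = b * a'.
Proof.
rewrite /cr_point line_eq /=; split=> [[c]|e].
  by rewrite -cr_coefZ => /cr_coef_inj[-> ->]; ring.
have [a0|a0] := eqVneq a 0.
  have b0 : b != 0 by move: ab; rewrite a0 eqxx.
  exists (b' / b); rewrite -cr_coefZ divfK //; congr (cr_coef _ _).
  by rewrite a0 mulr0; apply: (mulfI b0); rewrite -e a0 mul0r mulr0.
exists (a' / a); rewrite -cr_coefZ divfK //; congr (cr_coef _ _).
by apply: (mulfI a0); rewrite e; field.
Qed.

Lemma mpoly_unitP (n : nat) (p : {mpoly k[n]}) :
  p \is a GRing.unit <-> exists2 c : k, c != 0 & p = c%:MP.
Proof.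
split=> [/andP[/eqP e u]|[c c0 ->]].
  by exists p@_0; last exact: e; rewrite -unitfE.
by apply/unitrP; exists (c^-1)%:MP; rewrite -!mpolyCM mulVf ?mulfV.
Qed.

Lemma irreducibleZ (n : nat) (p : {mpoly k[n]}) (c : k) :
  c != 0 -> irreducible p -> irreducible (c *: p).
Proof.
move=> c0 [p0 pnU pirr].
have unitZ (d : k) (q : {mpoly k[n]}) : d != 0 ->
    (d *: q) \is a GRing.unit -> q \is a GRing.unit.
  move=> d0 /mpoly_unitP [e e0 dq]; apply/mpoly_unitP; exists (d^-1 * e).
    by rewrite mulf_neq0 ?invr_eq0.
  by rewrite mpolyCM mul_mpolyC -dq scalerA mulVf // scale1r.
split=> [||G H e].
- by rewrite scaler_eq0 negb_or c0.
- by apply: contra pnU; apply: unitZ.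
have /pirr [|] : p = (c^-1 *: G) * H.
- by rewrite -scalerAl -e scalerA mulVf // scale1r.
- by move/unitZ; rewrite invr_eq0 => /(_ c0); left.
- by right.
Qed.

(** Hilbert: two generators of one ideal differ by a unit, that is, a constant. Chow: a form
    vanishing on the orbit closure is a multiple of the cross-ratio form and, being irreducible, a
    constant multiple. *)
Lemma cr_point_orbit A (A_inj : injective (points A))
    (ab : (cr_num A != 0) || (cr_den A != 0)) (h : P15 k) :
  (hilbert_point (orbit_closure (points A)) h <-> h = cr_point ab) /\
  (chow_point (orbit_closure (points A)) h <-> h = cr_point ab).
Proof.
have [a0 b0 anb] := cr_generic A_inj.
have gen := cr_form_generates A_inj.
have irr := cr_form_irreducible a0 b0 anb.
have [u ->] := line_surj h.
have u_in : sval u \in sval (line u) by apply/in_line; exists 1; rewrite scale1r.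
have lineE c : c \in sval (cr_point ab) -> c != 0 ->
    exists2 d : k, d != 0 & form c = d *: cr_form (cr_num A) (cr_den A).
  move=> /in_line [d ->]; rewrite scaler_eq0 negb_or => /andP[d0 _].
  by exists d => //; rewrite formZ /= form_cr_coef.
have lineI (d : k) : form (sval u) = d *: cr_form (cr_num A) (cr_den A) ->
    line u = cr_point ab.
  move=> e; apply/esym/line_eq; exists d; apply: form_inj.
  by rewrite formZ form_cr_coef.
split; split.
- move=> /(_ _ (svalP u) u_in) genu.
  have [H1 e1] : pdvd (cr_form (cr_num A) (cr_den A)) (form (sval u)).
    by apply/gen/(genu _).2; exists 1; rewrite mul1r.
  have [H2 e2] : pdvd (form (sval u)) (cr_form (cr_num A) (cr_den A)).
    by apply/genu/(gen _).2; exists 1; rewrite mul1r.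
  case: irr => F0 _ _.
  have /eqP : (H2 * H1 - 1) * cr_form (cr_num A) (cr_den A) = 0.
    by rewrite mulrBl mul1r -mulrA -e1 -e2 subrr.
  rewrite mulf_eq0 (negPf F0) orbF subr_eq0 => /eqP H21.
  have /mpoly_unitP [c _ ec] : H1 \is a GRing.unit.
    by apply/unitrP; exists H2; rewrite [H1 * _]mulrC.
  by apply: (lineI c); rewrite e1 ec mul_mpolyC.
- move=> -> c c0 /lineE /(_ c0) [d d0 ->] G.
  rewrite gen; split=> [] [H ->]; first by exists (d^-1 *: H); rewrite -scalerAr -scalerAl scalerA divff // scale1r.
  by exists (d *: H); rewrite -scalerAr -scalerAl.
- move=> /(_ _ (svalP u) u_in) [[_ _ irru] locus].
  have [H e] : pdvd (cr_form (cr_num A) (cr_den A)) (form (sval u)).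
    by apply/gen => v [B -> cB]; apply/locus.
  have [/mpoly_unitP [c c0 ec]|U] := irru _ _ e.
    by apply: (lineI c); rewrite e ec mul_mpolyC.
  by case: irr => _ /negP [].
- move=> -> c c0 /lineE /(_ c0) [d d0 ->]; split.
    exact: irreducibleZ.
  by move=> B; rewrite orbit_closureE // pevalZ; split=> [->|/eqP]; rewrite ?mulr0 // mulf_eq0 (negPf d0) => /eqP.
Qed.

End OrbitClosures.

(** * Plane conics *)

Section PlaneConics.
Variable k : closedFieldType.
Local Notation V := {ffun 'I_3 -> k^o}.
Local Notation conics := {ffun mono2 -> k^o}.
Implicit Types (u v w : V) (c : conics).

Definition vec3 (a b c : k) : V := [ffun i => nth 0 [:: a; b; c] (val i)].

Lemma vec3E (a b c : k) : (vec3 a b c 'c0 = a) * (vec3 a b c 'c1 = b) *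
  (vec3 a b c 'c2 = c).
Proof. by rewrite !ffunE. Qed.

Lemma vec3P u v : u 'c0 = v 'c0 -> u 'c1 = v 'c1 -> u 'c2 = v 'c2 -> u = v.
Proof. by move=> *; apply/ffunP; apply: ord3P. Qed.

Definition det3 u v w : k :=
  u 'c0 * (v 'c1 * w 'c2 - v 'c2 * w 'c1)
  - u 'c1 * (v 'c0 * w 'c2 - v 'c2 * w 'c0)
  + u 'c2 * (v 'c0 * w 'c1 - v 'c1 * w 'c0).

Definition cols3 u v w : 'End(V) :=
  lin (fun j i => if i == 'c0 then u j else if i == 'c1 then v j else w j).

Lemma cols3E u v w x : cols3 u v w x = x 'c0 *: u + x 'c1 *: v + x 'c2 *: w.
Proof.
rewrite linE; apply/ffunP => j; rewrite !ffunE !big_ord_recl big_ord0 /=.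
by rewrite addr0 addrA !scale_regular /= ![_ * x _]mulrC.
Qed.

Lemma cols3_basis u v w : [/\ cols3 u v w (vec3 1 0 0) = u,
  cols3 u v w (vec3 0 1 0) = v & cols3 u v w (vec3 0 0 1) = w].
Proof.
by split; rewrite cols3E !vec3E !scale0r ?scale1r ?addr0 ?add0r.
Qed.

Lemma lker_cols3 u v w : det3 u v w != 0 -> lker (cols3 u v w) == 0%VS.
Proof.
move=> D0; apply/lker0P => x y e.
have e0 j : cols3 u v w (x - y) j = 0 by rewrite raddfB /= e subrr ffunE.
suff xy0 : x - y = 0 by apply/eqP; rewrite -subr_eq0 xy0.
move: (x - y) e0 => z e0.
have E j : z 'c0 * u j + z 'c1 * v j + z 'c2 * w j = 0.
  by have := e0 j; rewrite cols3E !ffunE !scale_regular.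
have E0 := E 'c0; have E1 := E 'c1; have E2 := E 'c2.
apply: vec3P; rewrite ffunE; apply: (mulfI D0); rewrite mulr0.
- transitivity (det3 [ffun j => (z 'c0 * u j + z 'c1 * v j + z 'c2 * w j : k^o)] v w).
    by rewrite /det3 !ffunE; ring.
  by rewrite /det3 !ffunE E0 E1 E2; ring.
- transitivity (det3 u [ffun j => (z 'c0 * u j + z 'c1 * v j + z 'c2 * w j : k^o)] w).
    by rewrite /det3 !ffunE; ring.
  by rewrite /det3 !ffunE E0 E1 E2; ring.
- transitivity (det3 u v [ffun j => (z 'c0 * u j + z 'c1 * v j + z 'c2 * w j : k^o)]).
    by rewrite /det3 !ffunE; ring.
  by rewrite /det3 !ffunE E0 E1 E2; ring.
Qed.

Definition q00 : mono2 := exist (fun ij : 'I_3 * 'I_3 => (ij.1 <= ij.2)%N) ('c0, 'c0) isT.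
Definition q01 : mono2 := exist (fun ij : 'I_3 * 'I_3 => (ij.1 <= ij.2)%N) ('c0, 'c1) isT.
Definition q02 : mono2 := exist (fun ij : 'I_3 * 'I_3 => (ij.1 <= ij.2)%N) ('c0, 'c2) isT.
Definition q11 : mono2 := exist (fun ij : 'I_3 * 'I_3 => (ij.1 <= ij.2)%N) ('c1, 'c1) isT.
Definition q12 : mono2 := exist (fun ij : 'I_3 * 'I_3 => (ij.1 <= ij.2)%N) ('c1, 'c2) isT.
Definition q22 : mono2 := exist (fun ij : 'I_3 * 'I_3 => (ij.1 <= ij.2)%N) ('c2, 'c2) isT.

Lemma mono2P (P : mono2 -> Prop) :
  P q00 -> P q01 -> P q02 -> P q11 -> P q12 -> P q22 -> forall ij, P ij.
Proof.
move=> P00 P01 P02 P11 P12 P22 [[i j]].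
by move: i j; apply: ord3P; apply: ord3P => // H;
  match goal with |- P ?x =>
    first [have -> : x = q00 by apply: val_inj |have -> : x = q01 by apply: val_inj
    |have -> : x = q02 by apply: val_inj |have -> : x = q11 by apply: val_inj
    |have -> : x = q12 by apply: val_inj |have -> : x = q22 by apply: val_inj] end.
Qed.

Lemma sum_mono2 (G : mono2 -> k) : \sum_ij G ij =
  G q00 + (G q01 + (G q02 + (G q11 + (G q12 + G q22)))).
Proof.
have E : perm_eq (index_enum mono2) [:: q00; q01; q02; q11; q12; q22].
  apply: uniq_perm => //; first exact: index_enum_uniq.
  by move=> x; rewrite mem_index_enum; apply/esym; move: x; apply: mono2P.
by rewrite (perm_big _ E) !big_cons big_nil /= addr0.
Qed.

Definition qf c v : k := peval (conic_form c) v.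

Lemma qfE c v : qf c v =
  c q00 * (v 'c0 * v 'c0) + (c q01 * (v 'c0 * v 'c1) + (c q02 * (v 'c0 * v 'c2)
  + (c q11 * (v 'c1 * v 'c1) + (c q12 * (v 'c1 * v 'c2) + c q22 * (v 'c2 * v 'c2))))).
Proof.
rewrite /qf /conic_form peval_sum sum_mono2.
by rewrite !pevalZ !pevalM !peval_var.
Qed.

(** The form q(u + v) - q(u) - q(v). In characteristic 2 it does not determine q, since
    [polar c u u] is 2 q(u); the values of q on a basis are therefore kept alongside. *)
Definition polar c u v : k :=
  c q00 * (2%:R * u 'c0 * v 'c0) + c q01 * (u 'c0 * v 'c1 + u 'c1 * v 'c0)
  + c q02 * (u 'c0 * v 'c2 + u 'c2 * v 'c0) + c q11 * (2%:R * u 'c1 * v 'c1)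
  + c q12 * (u 'c1 * v 'c2 + u 'c2 * v 'c1) + c q22 * (2%:R * u 'c2 * v 'c2).

Lemma qf_comb c (x y z : k) u v w : qf c (x *: u + y *: v + z *: w) =
  x ^+ 2 * qf c u + y ^+ 2 * qf c v + z ^+ 2 * qf c w +
  x * y * polar c u v + x * z * polar c u w + y * z * polar c v w.
Proof. by rewrite !qfE /polar !ffunE !scale_regular; ring. Qed.

Lemma qfZ c (x : k) v : qf c (x *: v) = x ^+ 2 * qf c v.
Proof. by rewrite !qfE !ffunE !scale_regular; ring. Qed.

Definition conic6 (a00 a01 a02 a11 a12 a22 : k) : conics :=
  [ffun ij : mono2 => if ij == q00 then a00 else if ij == q01 then a01 else
    if ij == q02 then a02 else if ij == q11 then a11 else
    if ij == q12 then a12 else a22].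

Lemma qf_conic6 a00 a01 a02 a11 a12 a22 v :
  qf (conic6 a00 a01 a02 a11 a12 a22) v =
  a00 * (v 'c0 * v 'c0) + (a01 * (v 'c0 * v 'c1) + (a02 * (v 'c0 * v 'c2)
  + (a11 * (v 'c1 * v 'c1) + (a12 * (v 'c1 * v 'c2) + a22 * (v 'c2 * v 'c2))))).
Proof. by rewrite qfE !ffunE. Qed.

Lemma conic6P c c' : c q00 = c' q00 -> c q01 = c' q01 -> c q02 = c' q02 ->
  c q11 = c' q11 -> c q12 = c' q12 -> c q22 = c' q22 -> c = c'.
Proof. by move=> *; apply/ffunP; apply: mono2P. Qed.

Lemma qf_cols3 c u v w x : qf c (cols3 u v w x) =
  qf (conic6 (qf c u) (polar c u v) (polar c u w) (qf c v) (polar c v w) (qf c w)) x.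
Proof. by rewrite cols3E qf_comb qf_conic6; ring. Qed.

Lemma qf_inj0 c : (forall v, qf c v = 0) -> c = 0.
Proof.
move=> H.
have c00 : c q00 = 0 by have := H (vec3 1 0 0); rewrite qfE !vec3E => <-; ring.
have c11 : c q11 = 0 by have := H (vec3 0 1 0); rewrite qfE !vec3E => <-; ring.
have c22 : c q22 = 0 by have := H (vec3 0 0 1); rewrite qfE !vec3E => <-; ring.
apply: conic6P; rewrite ffunE //.
- by have := H (vec3 1 1 0); rewrite qfE !vec3E c00 c11 c22 => <-; ring.
- by have := H (vec3 1 0 1); rewrite qfE !vec3E c00 c11 c22 => <-; ring.
- by have := H (vec3 0 1 1); rewrite qfE !vec3E c00 c11 c22 => <-; ring.
Qed.

Lemma conic_locus_line c (v : nonzero k 'I_3) :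
  conic_locus c (line v) <-> qf c (sval v) = 0.
Proof.
split=> [H|H u /in_line [x ->]].
  by apply: H; apply/in_line; exists 1; rewrite scale1r.
by rewrite -[LHS]/(qf _ _) qfZ H mulr0.
Qed.

(** A polynomial vanishing on the new conic is moved to the old one by the inverse substitution,
    divided there, and moved back. *)
Lemma pull_reduced c c' (t : k) (g : 'End(V)) : t != 0 -> lker g == 0%VS ->
  (forall v, qf c' v = t * qf c (g v)) ->
  generates_ideal_of (conic_form c) (fun v => peval (conic_form c) v = 0) ->
  generates_ideal_of (conic_form c') (fun v => peval (conic_form c') v = 0).
Proof.
move=> t0 g0 E gen G.
pose subst (h : 'End(V)) (H : {mpoly k[#|'I_3|]}) := pcomp H (lfun_poly h).
have substE h H v : peval (subst h H) v = peval H (h v).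
  rewrite /subst peval_comp; congr peval; apply/ffunP => j.
  by rewrite ffunE peval_lfun.
split=> [GZ|[H ->] v Zv]; last by rewrite pevalM Zv mulr0.
have /gen [H eH] : forall v, peval (conic_form c) v = 0 -> peval (subst g^-1%VF G) v = 0.
  move=> v Zv; rewrite substE GZ // -[LHS]/(qf c' _) E lker0_lfunVK //.
  by rewrite /qf Zv mulr0.
exists (t^-1 *: subst g H); apply: peval_inj => v.
rewrite pevalM pevalZ substE -[peval _ v in RHS]/(qf c' v) E.
have := congr1 (fun P => peval P (g v)) eH; rewrite substE pevalM lker0_lfunK // => ->.
by rewrite /qf; field.
Qed.

(** The change of coordinates behind every normalization of marked conics; [t] allows the equation
    to be rescaled at the same time. *)
Lemma pull_conic (Q : marked_conic k) (t : k) (g : 'End(V)) (g0 : lker g == 0%VS)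
    (c' : nonzero k mono2) (m : 'I_4 -> nonzero k 'I_3) :
  t != 0 -> (forall v, qf (sval c') v = t * qf (sval (conic Q)) (g v)) ->
  (forall i, pmap g0 (line (m i)) = line (conic_mark Q i)) ->
  exists Q', [/\ conic Q' = c', conic_mark Q' = m &
    pointed_iso (conic_curve Q') (conic_curve Q)].
Proof.
move=> t0 E mE.
have red := pull_reduced t0 g0 E (@conic_reduced _ Q).
have locE L : conic_locus (sval c') L <-> conic_locus (sval (conic Q)) (pmap g0 L).
  have [v ->] := line_surj L.
  rewrite pmap_line !conic_locus_line /= E; split=> [/eqP|->]; last exact: mulr0.
  by rewrite mulf_eq0 (negPf t0) => /eqP.
have mP i : conic_locus (sval c') (line (m i)).
  by apply/locE; rewrite mE; apply: conic_markP.
exists (MarkedConic red mP); split=> //.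
pose f (x : {L | conic_locus (sval c') L}) :
    {L | conic_locus (sval (conic Q)) L} :=
  exist _ (pmap g0 (sval x)) ((locE _).1 (svalP x)).
exists f; last by move=> i; apply: eq_exist; rewrite /= mE.
by apply: (pmap_subspace_iso (g_inj := g0)) => // L /locE.
Qed.

End PlaneConics.

(** * Stable curves *)

Section Forests.
Variables (T : finType) (e : rel T).
Hypotheses (e_sym : forall x y, e x y = e y x) (e_irr : irreflexive e).
Hypothesis acyclic : forall s, ucycle e s -> (size s <= 2)%N.

Definition degree_in (S : {set T}) x : nat := #|[set y in S | e x y]|.

(** A path is prolonged at its head by a neighbour other than the next vertex. If that neighbour
    were already on the path, a cycle of length at least 3 would close up. *)
Lemma long_path (S : {set T}) : S != set0 ->
  (forall x, x \in S -> 2 <= degree_in S x)%N ->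
  forall n, exists x p, [/\ size p = n, path e x p, uniq (x :: p) & {subset x :: p <= S}].
Proof.
move=> /set0Pn[x0 x0S] deg; elim=> [|n [x [p [sp pp up pS]]]].
  by exists x0, [::]; split=> // y; rewrite inE => /eqP ->.
have xS : x \in S by apply: pS; rewrite mem_head.
(* [head x p] is the vertex after [x], or [x] itself for a trivial path; one of the two neighbours
   of [x] in [S] differs from it. *)
have [w [wS exw wp]] : exists w, [/\ w \in S, e x w & w != head x p].
  have := deg x xS; rewrite /degree_in (cardsD1 (head x p)) => d2.
  have /card_gt0P [w] : (0 < #|[set y in S | e x y] :\ head x p|)%N.
    by move: d2; case: (_ \in _); lia.
  by rewrite !inE => /and3P[w1 w2 w3]; exists w.
have wx : w != x by apply/eqP => wx; rewrite wx e_irr in exw.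
exists w, (x :: p); split=> /=; rewrite ?sp ?pp ?andbT //.
- by rewrite e_sym.
- rewrite -cons_uniq cons_uniq up andbT; apply/negP; rewrite inE (negPf wx) /= => w_in.
  case: p sp pp up pS wp w_in => // x1 p _ pp up _ /= wx1.
  rewrite inE (negPf wx1) /= => w_in; case/splitPr: w_in pp up => p1 p2 pp up.
  suff /acyclic : ucycle e (x :: x1 :: rcons p1 w) by rewrite /= size_rcons.
  move: pp up; rewrite /ucycle /= -cat_rcons cat_path -!cat_cons cat_uniq.
  move=> /and3P[-> pw _] /and3P[xn x1n /andP[uw _]].
  rewrite rcons_path pw last_rcons e_sym exw uw /= andbT; apply/andP; split.
    by move: xn; rewrite mem_cat negb_or => /andP[].
  by move: x1n; rewrite mem_cat negb_or => /andP[].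
- by move=> y; rewrite inE => /orP[/eqP -> //|/pS].
Qed.

Lemma leaf (S : {set T}) : S != set0 -> exists2 x, x \in S & (degree_in S x <= 1)%N.
Proof.
move=> S0; apply: contrapT => H.
have [x xS|x [p [sp _ up _]]] := @long_path S S0 _ #|T|.
  by rewrite ltnNge; apply/negP => d1; apply: H; exists x.
by have := max_card (mem (x :: p)); rewrite (card_uniqP up) /= sp ltnn.
Qed.

(** A forest has fewer edges than vertices: by induction, removing a leaf lowers the sum of the
    degrees by at most 2. *)
Lemma degree_sum (S : {set T}) : S != set0 ->
  (\sum_(x in S) degree_in S x + 2 <= 2 * #|S|)%N.
Proof.
have [n] := ubnP #|S|; elim: n S => // n IHn S; rewrite ltnS => leSn S0.
have [x xS dx] := leaf S0.
have cS := cardsD1 x S; rewrite xS in cS.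
have deg y : y \in S :\ x -> degree_in S y = ((e y x) + degree_in (S :\ x) y)%N.
  move=> _; rewrite /degree_in (cardsD1 x) inE xS; congr (_ + _)%N.
  by apply: eq_card => z; rewrite !inE; case: (z == x) => //=.
have sx : (\sum_(y in S :\ x) e y x)%N = degree_in S x.
  rewrite /degree_in -sum1_card big_mkcond [RHS]big_mkcond /=.
  apply: eq_bigr => y _; rewrite !inE e_sym.
  by have [->|_] := eqVneq y x; rewrite ?e_irr ?andbF //=; case: (y \in S); case: (e x y).
rewrite (big_setD1 x) //= (eq_bigr _ deg) big_split /= sx.
have [S'0|S'0] := eqVneq (S :\ x) set0.
  have -> : (\sum_(y in S :\ x) degree_in (S :\ x) y)%N = 0%N by rewrite S'0 big_set0.
  have -> : degree_in S x = 0%N by rewrite -sx S'0 big_set0.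
  by rewrite cS; lia.
have lt : (#|S :\ x| < n)%N by rewrite (leq_trans _ leSn) // cS.
have := IHn _ lt S'0; rewrite cS => IH.
by lia.
Qed.

End Forests.

(** * Components of a stable curve and distribution of the marks *)

Section StableCurves.
Variable k : closedFieldType.

(** The components are indexed by [bool] so that [~~ b] names the other one; [y b] is the node as
    seen on the component [b]. *)
Record two_lines (C : pointed_curve k) (phi : bool -> P1 k -> curve_pt C)
    (y : bool -> P1 k) : Prop := TwoLines {
  two_lines_inj : forall b, injective (phi b);
  two_lines_surj : forall x, exists b z, x = phi b z;
  two_lines_open : forall W, zopen (curve_space C) W <->
    forall b, zopen (P1_space k) (W \o phi b);
  two_lines_regular : forall W f, zregular (curve_space C) W f <->
    forall b, zregular (P1_space k) (W \o phi b) (f \o phi b);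
  two_lines_meet : forall b z z', phi b z = phi (~~ b) z' <-> z = y b /\ z' = y (~~ b) }.

Record nodal_marking (C : pointed_curve k) (phi : bool -> P1 k -> curve_pt C)
    (y : bool -> P1 k) (chi : 'I_4 -> bool) (x : 'I_4 -> P1 k) : Prop := NodalMarking {
  nodal_lines : two_lines phi y;
  nodal_mark : forall i, mark C i = phi (chi i) (x i);
  nodal_mark_inj : forall i j, chi i = chi j -> x i = x j -> i = j;
  nodal_mark_node : forall i, x i <> y (chi i);
  nodal_card : forall b, #|[set i | chi i == b]| = 2%N }.

Section Components.
Variables (C : pointed_curve k) (V : finType) (phi : V -> P1 k -> curve_pt C).
Hypotheses (tree : tree_of_lines phi) (marked : stable_marking phi).

Let adj := adjacent phi.

Lemma adjacent_sym v w : adj v w = adj w v.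
Proof.
rewrite /adj /adjacent eq_sym; congr (_ && _).
by apply: asbool_equiv_eq; split=> -[y [z e]]; exists z, y.
Qed.

Lemma adjacent_irr : irreflexive adj.
Proof. by move=> v; rewrite /adj /adjacent eqxx. Qed.

Definition marks_on (v : V) : {set 'I_4} :=
  [set i | `[< exists y, mark C i = phi v y >]].

Lemma marks_onP v i : reflect (exists y, mark C i = phi v y) (i \in marks_on v).
Proof. by rewrite inE; apply: asboolP. Qed.

(** A special point is encoded by another component through it or by its mark. The code is injective
    because two components meet in at most one point. *)
Lemma three_special v : (3 <= degree_in adj setT v + #|marks_on v|)%N.
Proof.
have [_ _ _ [meet _] _] := tree; have [_ _ /(_ v) [t t_inj t_spec]] := marked.
pose good j (c : V + 'I_4) := match c with
  | inl w => w != v /\ exists z, phi v (t j) = phi w z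
  | inr i => mark C i = phi v (t j) end.
have ex_code j : exists c, good j c.
  case: (t_spec j) => [[w [z [wv e]]]|[i e]]; first by exists (inl w); split=> //; exists z.
  by exists (inr i).
pose code j := sval (cid (ex_code j)).
have codeP j : good j (code j) by rewrite /code; case: cid.
have [[phi_inj _] _ _ _ _] := tree.
have code_inj : injective code.
  move=> i j e; apply: t_inj; have := codeP i; have := codeP j; rewrite -e.
  case: (code i) => [w [wv [z ez]] [_ [z' ez']]|l /= -> /phi_inj //].
  by apply: (meet v w _ _ _ _ _ ez' ez); rewrite eq_sym.
suff : (#|codom code| <= degree_in adj setT v + #|marks_on v|)%N.
  by rewrite card_codom // card_ord.
rewrite /degree_in.
rewrite -(card_imset (mem [set y in setT | adj v y]) (@inl_inj V 'I_4)).
rewrite -(card_imset (mem (marks_on v)) (@inr_inj V 'I_4)).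
apply: leq_trans (leq_card_setU _ _); apply/subset_leq_card/subsetP => _ /codomP[j ->].
have := codeP j; rewrite in_setU; case: (code j) => [w [wv [z ez]]|i /= e].
  apply/orP; left; apply: imset_f; rewrite !inE /adj /adjacent eq_sym wv /=.
  by apply/asboolP; exists (t j), z.
by apply/orP; right; apply: imset_f; apply/marks_onP; exists (t j).
Qed.

Lemma marks_on_sum : (\sum_v #|marks_on v| <= 4)%N.
Proof.
have [_ notnode _] := marked.
have -> : (\sum_v #|marks_on v| = \sum_(i < 4) #|[set v | i \in marks_on v]|)%N.
  transitivity (\sum_v \sum_(i < 4) (i \in marks_on v))%N.
    by apply: eq_bigr => v _; rewrite -sum1_card big_mkcond.
  rewrite exchange_big; apply: eq_bigr => i _.
  by rewrite -sum1_card [RHS]big_mkcond; apply: eq_bigr => v _; rewrite inE.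
apply: (@leq_trans (\sum_(i < 4) 1)%N); last by rewrite sum1_card card_ord.
apply: leq_sum => i _.
apply/card_le1_eqP => v w; rewrite !inE => /asboolP[y ey] /asboolP[z ez].
apply/eqP; apply: contraT => vw; case: (notnode i v y ey).
by exists w, z; split; rewrite -?ey.
Qed.

(** With n components, 3 n <= (2 n - 2) + 4: three special points on each, a sum of degrees at most
    2 n - 2 in a tree, and four marks. *)
Lemma two_components : (0 < #|V| <= 2)%N.
Proof.
have [[_ phi_surj] _ _ _ [_ acyc]] := tree.
have V0 : [set: V] != set0.
  have [v _] := phi_surj (mark C ord0); apply/set0Pn; exists v; exact: in_setT.
have := degree_sum adjacent_sym adjacent_irr acyc V0.
have H3 : (\sum_(v : V) 3 <= \sum_v (degree_in adj setT v + #|marks_on v|))%N.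
  by apply: leq_sum => v _; apply: three_special.
rewrite big_split /= sum_nat_const cardsT in H3 *.
rewrite -cardsT card_gt0 V0 cardsT (eq_bigl xpredT) => [|v]; last by rewrite in_setT.
have e : #|(xpredT : pred V)| = #|V| by apply: eq_card.
move: H3 marks_on_sum; rewrite e.
set a := (\sum_i degree_in _ _ _)%N; set b := (\sum_v #|_|)%N; set n := #|V|.
by clearbody a b n; move=> H1 H2 H3; rewrite /=; lia.
Qed.

Lemma one_component_smooth : #|V| = 1%N ->
  exists2 x, injective x & pointed_iso (config_curve x) C.
Proof.
move=> cV; have /card_gt0P [v0 _] : (0 < #|V|)%N by rewrite cV.
have allv v : v = v0.
  by apply: (card_le1_eqP (A := mem V)) => //; rewrite cV.
have [[phi_inj phi_surj] phi_open phi_reg _ _] := tree.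
have inv x : exists y, x = phi v0 y.
  by have [v [y e]] := phi_surj x; exists y; rewrite e (allv v).
pose g x := sval (cid (inv x)).
have gK x : phi v0 (g x) = x by rewrite /g; case: cid.
have Kg : cancel (phi v0) g by move=> y; apply: (phi_inj v0); rewrite gK.
have [mark_inj _ _] := marked.
exists (g \o mark C); first by move=> i j /= /(can_inj gK) /mark_inj.
exists (phi v0); last by move=> i; rewrite /= gK.
have ext W : (W \o g) \o phi v0 = W.
  by apply/funext => y /=; rewrite Kg.
have extf (h : P1 k -> k) : (h \o g) \o phi v0 = h.
  by apply/funext => y /=; rewrite Kg.
exists g; split=> //.
  by split=> [W /phi_open //|W f /phi_reg //].
split=> [W oW|W h rW].
  by apply/phi_open => v; rewrite (allv v) ext.
by apply/phi_reg => v; rewrite (allv v) ext extf.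
Qed.

(** Each component has at most one neighbour, hence at least two marks, and exactly two since there
    are four in all. Connectedness provides the node. *)
Lemma two_components_nodal : #|V| = 2%N ->
  exists psi y chi x, @nodal_marking C psi y chi x.
Proof.
move=> cV.
have [[phi_inj phi_surj] phi_open phi_reg [meet _] [conn acyc]] := tree.
have [mark_inj notnode _] := marked.
have [v0 [v1 [v01 allv]]] : exists v0 v1 : V, v0 != v1 /\ forall v, v = v0 \/ v = v1.
  have /cards2P [v0 [v1 [v01 e]]] : #|[set: V]| == 2%N by rewrite cardsT cV.
  exists v0, v1; split=> // v; have := in_setT v; rewrite e !inE.
  by case/orP => /eqP; [left|right].
have N1 v : (degree_in adj setT v <= 1)%N.
  rewrite -ltnS -cV -cardsT [X in (_ < X)%N](cardsD1 v) in_setT add1n ltnS.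
  apply/subset_leq_card/subsetP => w; rewrite !inE /= => H.
  by rewrite andbT; apply: contraTneq H => ->; rewrite /= adjacent_irr.
have M2 v : (2 <= #|marks_on v|)%N by move: (three_special v) (N1 v); lia.
have Me v : #|marks_on v| = 2%N.
  have := marks_on_sum.
  rewrite (bigD1 v0) //= (bigD1 v1) 1?eq_sym //=.
  have two_two (a b r : nat) : (1 < a)%N -> (1 < b)%N -> (a + (b + r) <= 4)%N ->
      a = 2%N /\ b = 2%N by lia.
  by move/(two_two _ _ _ (M2 v0) (M2 v1)) => [e0 e1]; case: (allv v) => ->.
have /existsP[w] : [exists w, adj v0 w].
  apply: contraT; rewrite negb_exists => /forallP H.
  have /connectP [[|w p] /=] := conn v0 v1; first by move=> _ e; rewrite e eqxx in v01.
  by move=> /andP[e _]; have := H w; rewrite /adj e.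
rewrite /adj /adjacent => /andP[v0w /asboolP[y0 [y1]]].
have -> : w = v1 by case: (allv w) => // e; rewrite e eqxx in v0w.
move=> ey; pose h b := if b then v1 else v0; pose y b := if b then y1 else y0.
have h_inj b b' : h b = h b' -> b = b'.
  by case: b b' => -[] //= e; rewrite e eqxx in v01.
have h_surj v : exists b, v = h b.
  by case: (allv v) => ->; [exists false|exists true].
have ey' b : phi (h b) (y b) = phi (h (~~ b)) (y (~~ b)) by case: b.
have lines : two_lines (fun b => phi (h b)) y.
  split.
  - by move=> b; apply: phi_inj.
  - move=> x; have [v [z ->]] := phi_surj x; have [b ->] := h_surj v.
    by exists b, z.
  - move=> W; rewrite phi_open; split=> [H b|H v]; first exact: H.
    by have [b ->] := h_surj v.
  - move=> W f; rewrite phi_reg; split=> [H b|H v]; first exact: H.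
    by have [b ->] := h_surj v.
  - move=> b z z'; split=> [e|[-> ->] //].
    have hb : h b != h (~~ b) by case: (b) => //=; rewrite eq_sym.
    split; first exact: meet hb e (ey' b).
    apply: (meet (h (~~ b)) (h b) _ z _ (y b)); first by rewrite eq_sym.
      by rewrite e.
    exact: esym (ey' b).
have coordsP i : exists bz, mark C i = phi (h bz.1) bz.2.
  by have [b [z e]] := two_lines_surj lines (mark C i); exists (b, z).
pose cz i := sval (cid (coordsP i)).
have czP i : mark C i = phi (h (cz i).1) (cz i).2 by rewrite /cz; case: cid.
exists (fun b => phi (h b)), y, (fun i => (cz i).1), (fun i => (cz i).2); split=> //.
- by move=> i j e1 e2; apply: mark_inj; rewrite !czP e1 e2.
- move=> i e; apply: (notnode i _ _ (czP i)); exists (h (~~ (cz i).1)), (y (~~ (cz i).1)).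
  split; last by rewrite e ey'.
  by apply/eqP => /h_inj; case: (cz i).1.
- move=> b; apply: etrans (Me (h b)); apply: eq_card => i; rewrite [LHS]inE.
  apply/eqP/marks_onP => [<-|[z ez]]; first by exists (cz i).2.
  apply: h_inj; apply/eqP; apply: contraT => H.
  case: (notnode i _ _ (czP i)); exists (h b), z; rewrite eq_sym H; split=> //.
  by rewrite -czP.
Qed.

End Components.

Lemma stable_smooth_or_nodal (C : pointed_curve k) : stable C ->
  (exists2 x, injective x & pointed_iso (config_curve x) C) \/
  (exists psi y chi x, @nodal_marking C psi y chi x).
Proof.
move=> [V [phi [tree marked]]].
have := two_components tree marked.
case cV : #|V| => [|[|[|]]] // _; [left|right].
  exact: one_component_smooth tree marked cV.
exact: two_components_nodal tree marked cV.
Qed.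

End StableCurves.

(** * Separation of points by open sets, and gluing of isomorphisms *)

Section Separation.
Variable k : closedFieldType.

Lemma P1_open_meet (W W' : P1 k -> Prop) x x' :
  zopen (P1_space k) W -> zopen (P1_space k) W' -> W x -> W' x' ->
  exists y, W y /\ W' y.
Proof.
move=> /(presented_open (presented_proj k _)) [S WS].
move=> /(presented_open (presented_proj k _)) [S' WS'].
have [v ->] := line_surj x; have [v' ->] := line_surj x'.
move=> /(WS v) [p Sp /peval_nz p0] /(WS' v') [p' Sp' /peval_nz p'0].
have X0 : pvar k 'a0 != 0.
  by apply: (@peval_nz _ _ _ (vec2 1 0)); rewrite peval_var vec2_0 oner_eq0.
(* The last factor makes [u] a nonzero vector. *)
have /peval_neq0 [u] : p * p' * pvar k 'a0 != 0 by rewrite !mulf_neq0.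
rewrite !pevalM !mulf_eq0 !negb_or peval_var => /andP[/andP[pu p'u] /nonzero_at u0].
exists (line (nz u0)); split.
  by apply/(WS (nz u0)); exists p.
by apply/(WS' (nz u0)); exists p'.
Qed.

Lemma P1_open_compl (y : P1 k) : zopen (P1_space k) (fun x => x <> y).
Proof.
have [v ->] := line_surj y; apply/(presented_open (presented_proj k _)).
pose p : {mpoly k[#|'I_2|]} := sval v 'a0 *: pvar k 'a1 - sval v 'a1 *: pvar k 'a0.
have pE u : peval p u = br (sval v) u by rewrite !pevalE.
exists (eq p) => w; split=> [/= wv|[_ <-]].
  by exists p => //; rewrite pE; apply/line_neq2 => vw; apply: wv.
by rewrite pE => /line_neq2 vw wv; apply: vw.
Qed.

Lemma P1_open0 : zopen (P1_space k) (fun=> False).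
Proof.
by apply/(presented_open (presented_proj k _)); exists (fun=> False) => v; split=> // -[].
Qed.

Definition separated (C : pointed_curve k) (x y : curve_pt C) : Prop :=
  exists W W', [/\ zopen (curve_space C) W, zopen (curve_space C) W', W x, W' y &
    forall z, W z -> W' z -> False].

Definition sep (C : pointed_curve k) (i j : 'I_4) : Prop :=
  separated (mark C i) (mark C j).

Lemma separated_iso (C D : pointed_curve k) (f : curve_pt C -> curve_pt D) x y :
  zisomorphism (curve_space C) (curve_space D) f ->
  separated x y -> separated (f x) (f y).
Proof.
move=> [g [fg gf mf [og _]]] [W [W' [oW oW' Wx W'y WW']]].
by exists (W \o g), (W' \o g); split; rewrite /= ?fg; auto => z /= /WW'.
Qed.

Lemma sep_iso (C D : pointed_curve k) i j : pointed_iso C D -> sep C i j -> sep D i j.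
Proof. by move=> [f isof fm]; rewrite /sep -!fm; apply: separated_iso. Qed.

Lemma P1_image_not_separated (C : pointed_curve k) (f : P1 k -> curve_pt C) x y :
  zmorphism (P1_space k) (curve_space C) f -> ~ separated (f x) (f y).
Proof.
move=> [of_ _] [W [W' [/of_ oW /of_ oW' Wx W'y WW']]].
have [z [Wz W'z]] := P1_open_meet oW oW' Wx W'y.
exact: WW' Wz W'z.
Qed.

Lemma config_not_separated (C : pointed_curve k) x0 (x y : curve_pt C) :
  pointed_iso (config_curve x0) C -> ~ separated x y.
Proof.
move=> [f [g [fg gf mf mg]] _]; rewrite -(gf x) -(gf y).
exact: P1_image_not_separated.
Qed.

(** A component without the node is open: its traces on the two lines are the complement of a point
    and the empty set. Two marks on different components lie in two such disjoint sets. *)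
Lemma nodal_sep (C : pointed_curve k) psi y chi x i j :
  @nodal_marking k C psi y chi x -> chi i != chi j -> sep C i j.
Proof.
move=> [[psi_inj psi_surj oC rC meet] mk _ mn _] ij.
have oW b : zopen (curve_space C) (fun p => exists2 z, p = psi b z & z <> y b).
  apply/oC => b'; have [<-|bb'] := eqVneq b b'.
    rewrite (_ : _ \o _ = (fun z => z <> y b)); first exact: P1_open_compl.
    apply/funext => z; apply/propext; split=> [[z' /psi_inj -> //]|H].
    by exists z.
  rewrite (_ : _ \o _ = (fun=> False)); first exact: P1_open0.
  have eb : b' = ~~ b by case: (b) (b') bb' => -[].
  apply/funext => z; apply/propext; split=> // -[z' e]; apply.
  by move/esym: e; rewrite eb => /meet[].
exists (fun p => exists2 z, p = psi (chi i) z & z <> y (chi i)).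
exists (fun p => exists2 z, p = psi (chi j) z & z <> y (chi j)).
split=> //; [by exists (x i)|by exists (x j)|].
move=> p [z -> zy] [z' e _]; apply: zy.
have eb : chi j = ~~ chi i by case: (chi i) (chi j) ij => -[].
by move: e; rewrite eb => /meet[].
Qed.

(** [f] is defined through some parametrization of each point. The choice is ambiguous only at the
    node, and harmless there since [g] sends nodes to nodes. *)
Lemma glue_morphism (C D : pointed_curve k) phi y psi y' (g : bool -> P1 k -> P1 k) :
  @two_lines k C phi y -> @two_lines k D psi y' ->
  (forall b, zmorphism (P1_space k) (P1_space k) (g b)) ->
  (forall b, g b (y b) = y' b) ->
  exists2 f, zmorphism (curve_space C) (curve_space D) f &
    forall b z, f (phi b z) = psi b (g b z).
Proof.
move=> [phi_inj phi_surj oC rC meetC] [psi_inj psi_surj oD rD meetD] mg gy.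
have ex p : exists bz, p = phi bz.1 bz.2.
  by have [b [z e]] := phi_surj p; exists (b, z).
pose f p := let bz := sval (cid (ex p)) in psi bz.1 (g bz.1 bz.2).
have fE b z : f (phi b z) = psi b (g b z).
  rewrite /f; case: cid => -[b' z'] /= e; have [eb|bb'] := eqVneq b b'.
    by subst b'; move/phi_inj: e => ->.
  have eb : b' = ~~ b by case: (b) (b') bb' => -[].
  subst b'; move: e => /meetC [-> ->]; rewrite !gy.
  by apply/esym/meetD.
exists f => //; split=> [W /oD oW|W h /rD rW].
  apply/oC => b; rewrite (_ : _ \o _ = (W \o psi b) \o g b); first exact: (mg b).1.
  by apply/funext => z; rewrite /= fE.
apply/rC => b; rewrite (_ : _ \o _ = (W \o psi b) \o g b); last first.
  by apply/funext => z; rewrite /= fE.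
rewrite (_ : (h \o f) \o _ = (h \o psi b) \o g b); first exact: (mg b).2.
by apply/funext => z; rewrite /= fE.
Qed.

Lemma glue_isomorphism (C D : pointed_curve k) phi y psi y' (g : bool -> P1 k -> P1 k) :
  @two_lines k C phi y -> @two_lines k D psi y' ->
  (forall b, zisomorphism (P1_space k) (P1_space k) (g b)) ->
  (forall b, g b (y b) = y' b) ->
  exists2 f, zisomorphism (curve_space C) (curve_space D) f &
    forall b z, f (phi b z) = psi b (g b z).
Proof.
move=> LC LD ig gy.
pose gi b := sval (cid (ig b)).
have giP b : [/\ cancel (g b) (gi b), cancel (gi b) (g b),
    zmorphism (P1_space k) (P1_space k) (g b) &
    zmorphism (P1_space k) (P1_space k) (gi b)] by rewrite /gi; case: cid.
have [f mf fE] := glue_morphism LC LD (fun b => let: And4 _ _ m _ := giP b in m) gy.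
have gy' b : gi b (y' b) = y b by have [K _ _ _] := giP b; rewrite -gy K.
have [h mh hE] := glue_morphism LD LC (fun b => let: And4 _ _ _ m := giP b in m) gy'.
exists f => //; exists h; split=> //.
  move=> p; have [b [z ->]] := two_lines_surj LC p; rewrite fE hE.
  by have [K _ _ _] := giP b; rewrite K.
move=> p; have [b [z ->]] := two_lines_surj LD p; rewrite hE fE.
by have [_ K _ _] := giP b; rewrite K.
Qed.

Lemma stable_iso (C D : pointed_curve k) : pointed_iso C D -> stable C -> stable D.
Proof.
move=> [f [g [fg gf mf mg]] fm] [V [phi [tree marked]]].
have f_inj : injective f := can_inj fg.
have oD W : zopen (curve_space D) W <-> zopen (curve_space C) (W \o f).
  split=> [/mf.1 //|/mg.1]; congr (zopen _ _).
  by apply/funext => y; rewrite /= gf.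
have rD W h : zregular (curve_space D) W h <-> zregular (curve_space C) (W \o f) (h \o f).
  split=> [/mf.2 //|/mg.2]; congr (zregular _ _ _);
  by apply/funext => y; rewrite /= gf.
have adjE : adjacent (C := D) (fun v => f \o phi v) = adjacent phi.
  apply/funext => v; apply/funext => w; congr (_ && _); apply: asbool_equiv_eq.
  by split=> -[y [z e]]; exists y, z; [apply: f_inj|rewrite /= e].
have nodeE v y : node_at (C := D) (fun v => f \o phi v) v y <-> node_at phi v y.
  by split=> -[w [z [wv e]]]; exists w, z; split=> //; [apply: f_inj|rewrite /= e].
have [[phi_inj phi_surj] oC rC [meet node2] [conn acyc]] := tree.
have [m_inj m_node m_spec] := marked.
exists V, (fun v => f \o phi v); split; split.
- split=> [v y z /f_inj /phi_inj //|p].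
  have [v [y e]] := phi_surj (g p); exists v, y.
  by rewrite /= -e gf.
- by move=> W; rewrite oD oC.
- by move=> W h; rewrite rD rC.
- split=> [v w y z y' z' vw /f_inj e1 /f_inj e2|u v w x y z /f_inj e1 /f_inj e2].
    exact: meet vw e1 e2.
  exact: node2 e1 e2.
- by rewrite adjE.
- by move=> i j; rewrite -!fm => /f_inj /m_inj.
- by move=> i v y; rewrite -fm => /f_inj /m_node H /nodeE.
- move=> v; have [t t_inj t_spec] := m_spec v; exists t => // j.
  case: (t_spec j) => [/nodeE|[i e]]; first by left.
  by right; exists i; rewrite -fm e.
Qed.

End Separation.

(** * Lines contained in plane conics and split conics *)

Section StableConics.
Variable k : closedFieldType.
Local Notation V := {ffun 'I_3 -> k^o}.
Local Notation U := {ffun 'I_2 -> k^o}.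
Local Notation conics := {ffun mono2 -> k^o}.
Implicit Types (u v w : V) (c : conics).

Definition cols2 u v : 'Hom(U, V) :=
  lin (fun j i => if i == 'a0 then u j else v j).

Lemma cols2E u v x : cols2 u v x = x 'a0 *: u + x 'a1 *: v.
Proof.
rewrite linE; apply/ffunP => j; rewrite !ffunE !big_ord_recl big_ord0 /=.
by rewrite addr0 !scale_regular /= ![_ * x _]mulrC.
Qed.

(** Otherwise the linear form [det3 u v] is zero; its coefficients form the cross product of [u] and
    [v], which would then be proportional. *)
Lemma det3_complete u v : u != 0 -> (forall x : k, v != x *: u) ->
  exists w, det3 u v w != 0.
Proof.
move=> u0 nv; apply: contrapT => H.
have E w : det3 u v w = 0 by apply: contrapT => /eqP Hw; apply: H; exists w.
have E0 := E (vec3 1 0 0); have E1 := E (vec3 0 1 0); have E2 := E (vec3 0 0 1).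
rewrite /det3 !vec3E in E0 E1 E2.
have P01 : u 'c0 * v 'c1 = u 'c1 * v 'c0.
  by apply/eqP; rewrite -subr_eq0 -E2; apply/eqP; ring.
have P02 : u 'c0 * v 'c2 = u 'c2 * v 'c0.
  by apply/eqP; rewrite -subr_eq0 -[0]oppr0 -E1; apply/eqP; ring.
have P12 : u 'c1 * v 'c2 = u 'c2 * v 'c1.
  by apply/eqP; rewrite -subr_eq0 -E0; apply/eqP; ring.
have [i ui] := nonzero_coord (nz u0); rewrite /= in ui.
case/eqP: (nv (v i / u i)); apply: vec3P; rewrite ffunE scale_regular;
  apply: (mulfI ui); rewrite mulrA [u i * (_ / _)]mulrC divfK //;
  move: i {ui}; apply: ord3P; rewrite ?P01 ?P02 ?P12 //; by [rewrite mulrC | rewrite -?P01 -?P02 -?P12 mulrC].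
Qed.

Lemma lker_cols2 u v w : det3 u v w != 0 -> lker (cols2 u v) == 0%VS.
Proof.
move=> D0; apply/lker0P => x y e.
have /(lker0P (lker_cols3 D0)) exy : cols3 u v w (vec3 (x 'a0) (x 'a1) 0) =
    cols3 u v w (vec3 (y 'a0) (y 'a1) 0).
  by rewrite !cols3E !vec3E !scale0r !addr0 -!cols2E.
apply: vec2P.
  by have := congr1 (fun z : V => z 'c0) exy; rewrite !vec3E.
by have := congr1 (fun z : V => z 'c1) exy; rewrite !vec3E.
Qed.

Lemma cramer3 u v w x : det3 u v w *: x =
  det3 x v w *: u + det3 u x w *: v + det3 u v x *: w.
Proof. by apply: vec3P; rewrite !ffunE !scale_regular /det3; ring. Qed.

Lemma line_in_conic c (g : 'Hom(U, V)) (g0 : lker g == 0%VS) :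
  (forall x, qf c (g x) = 0) ->
  exists2 f : P1 k -> {L | conic_locus c L},
    zmorphism (P1_space k) (subspace (proj_space k 'I_3) (conic_locus c)) f &
    forall L, sval (f L) = pmap g0 L.
Proof.
move=> gc; have inc L : conic_locus c (pmap g0 L).
  by have [x ->] := line_surj L; rewrite pmap_line; apply/conic_locus_line/gc.
exists (fun L => exist _ (pmap g0 L) (inc L)) => //.
apply: (poly_lift_morphism (presented_proj k 'I_2) (presented_subspace (conic_locus c))).
move=> e; exists 1, (lfun_poly g); rewrite peval1 oner_eq0; split=> // x _.
have cx : conic_locus c (line (nzmap g0 x)) by apply/conic_locus_line/gc.
exists (exist (fun n : nonzero k 'I_3 => conic_locus c (line n)) _ cx); split=> [|j].
  by apply: eq_exist; rewrite pmap_line.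
by rewrite peval_lfun.
Qed.

Lemma line_not_separated (Q : marked_conic k) (g : 'Hom(U, V)) (g0 : lker g == 0%VS)
    (x y : nonzero k 'I_2) (p q : curve_pt (conic_curve Q)) :
  (forall x, qf (sval (conic Q)) (g x) = 0) ->
  sval p = pmap g0 (line x) -> sval q = pmap g0 (line y) -> ~ separated p q.
Proof.
move=> gc ep eq; have [f mf fE] := line_in_conic g0 gc.
have -> : p = f (line x) by case: p ep => P HP /= eP; have := fE (line x);
  case: (f _) => P' HP' /= eP'; apply: eq_exist; rewrite eP.
have -> : q = f (line y) by case: q eq => P HP /= eP; have := fE (line y);
  case: (f _) => P' HP' /= eP'; apply: eq_exist; rewrite eP.
exact: (@P1_image_not_separated k (conic_curve Q)).
Qed.

Definition dot u v : k := u 'c0 * v 'c0 + u 'c1 * v 'c1 + u 'c2 * v 'c2.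

Lemma dotZ l (t : k) v : dot l (t *: v) = t * dot l v.
Proof. by rewrite /dot !ffunE !scale_regular; ring. Qed.

(** On the conic l m = 0 the open sets l != 0 and m != 0 are disjoint. *)
Lemma split_separated (Q : marked_conic k) (l m : V)
    (p q : nonzero k 'I_3) (x y : curve_pt (conic_curve Q)) :
  (forall v, qf (sval (conic Q)) v = dot l v * dot m v) ->
  sval x = line p -> sval y = line q ->
  dot l (sval p) != 0 -> dot m (sval q) != 0 -> separated x y.
Proof.
move=> split ex ey lp mq.
pose A := conic_locus (sval (conic Q)).
pose W (l : V) (z : {L | A L}) := exists e : cone A,
  z = cone_line e /\ dot l (cone_val e) != 0.
have WE n (e : cone A) : W n (cone_line e) <-> dot n (cone_val e) != 0.
  split=> [[e' [/(congr1 sval) /line_eq [t et] H]]|H]; last by exists e.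
  by apply: contra_neq H; rewrite /cone_val et dotZ => ->; rewrite mulr0.
have oW n : zopen (curve_space (conic_curve Q)) (W n).
  apply/(presented_open (presented_subspace A)).
  pose p' : {mpoly k[#|'I_3|]} := n 'c0 *: pvar k 'c0 + n 'c1 *: pvar k 'c1 + n 'c2 *: pvar k 'c2.
  have pE v : peval p' v = dot n v by rewrite !pevalE.
  exists (eq p') => e; rewrite /= WE.
  by split=> [H|[_ <-]]; [exists p' => //; rewrite pE|rewrite pE].
exists (W l), (W m); split=> //.
- have [e ee] := cone_line_surj x; move: ex; rewrite ee => /= /esym /line_eq [t et].
  by apply/WE; apply: contra_neq lp => H; move: H; rewrite /cone_val et dotZ => /eqP;
    rewrite mulf_eq0 (negPf (line_scale_neq0 et)) => /eqP.
- have [e ee] := cone_line_surj y; move: ey; rewrite ee => /= /esym /line_eq [t et].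
  by apply/WE; apply: contra_neq mq => H; move: H; rewrite /cone_val et dotZ => /eqP;
    rewrite mulf_eq0 (negPf (line_scale_neq0 et)) => /eqP.
- move=> z; have [e ->] := cone_line_surj z => /WE le /WE me.
  have /conic_locus_line := svalP e.
  by rewrite split => /eqP; rewrite mulf_eq0 (negPf le) (negPf me).
Qed.

End StableConics.

(** * Marks of a stable conic are in general position *)

Section GeneralPosition.
Variable k : closedFieldType.
Local Notation V := {ffun 'I_3 -> k^o}.
Local Notation conics := {ffun mono2 -> k^o}.
Implicit Types (Q : marked_conic k).

Definition mk Q i : V := sval (conic_mark Q i).

Lemma mk_on Q i : qf (sval (conic Q)) (mk Q i) = 0.
Proof. exact/conic_locus_line/conic_markP. Qed.

Lemma reducible_conic_separated Q (l m : V) :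
  (forall v, qf (sval (conic Q)) v = dot l v * dot m v) ->
  (exists u, dot l u = 0 /\ dot m u != 0) ->
  (exists u, dot m u = 0 /\ dot l u != 0) ->
  exists x y : curve_pt (conic_curve Q), separated x y.
Proof.
move=> E [u [lu mu]] [u' [mu' lu']].
have nz_dot (n v : V) : dot n v != 0 -> v != 0.
  by apply: contra_neq => ->; rewrite /dot !ffunE !mulr0 !addr0.
pose p := nz (nz_dot _ _ mu); pose p' := nz (nz_dot _ _ lu').
have pQ : conic_locus (sval (conic Q)) (line p).
  by apply/conic_locus_line; rewrite E /= lu mul0r.
have p'Q : conic_locus (sval (conic Q)) (line p').
  by apply/conic_locus_line; rewrite E /= mu' mulr0.
exists (exist _ (line p') p'Q), (exist _ (line p) pQ).
exact: (split_separated E (p := p') (q := p)).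
Qed.

Section Collinear.
Variable Q : marked_conic k.
Hypothesis sQ : stable (conic_curve Q).
Variables i j l : 'I_4.
Hypotheses (ij : i != j) (il : i != l) (jl : j != l).

Lemma mk_not_prop a b (x : k) : a != b -> mk Q b != x *: mk Q a.
Proof.
move=> ab; apply/eqP => e; have [V' [phi [_ [m_inj _ _]]]] := sQ.
move: ab; rewrite (m_inj a b) ?eqxx //; apply: eq_exist.
by apply/line_eq; exists x.
Qed.

(* Three marks on a line would force the conic to contain that line: then the
   three marks cannot be separated, and the conic is reducible. *)
Lemma stable_det3 : det3 (mk Q i) (mk Q j) (mk Q l) != 0.
Proof.
apply/eqP => D0.
have [w Dw] := det3_complete (svalP (conic_mark Q i)) (fun x => mk_not_prop x ij).
rewrite -/(mk Q i) -/(mk Q j) in Dw.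
have := cramer3 (mk Q i) (mk Q j) w (mk Q l); rewrite D0 scale0r addr0.
set D := det3 _ _ w in Dw *; set x := det3 (mk Q l) _ _; set y := det3 _ (mk Q l) _.
move=> el.
have x0 : x != 0.
  apply/eqP => x0; case/negP: (mk_not_prop (y / D) jl); apply/eqP.
  apply: (scalerI Dw); rewrite el x0 scale0r add0r scalerA.
  by rewrite mulrC divfK.
have y0 : y != 0.
  apply/eqP => y0; case/negP: (mk_not_prop (x / D) il); apply/eqP.
  apply: (scalerI Dw); rewrite el y0 scale0r addr0 scalerA.
  by rewrite mulrC divfK.
set c := sval (conic Q).
have on n : qf c (mk Q n) = 0 := mk_on Q n.
(* The quadratic form at D m_l = x m_i + y m_j reduces to x y times this polar value, and x, y are
   nonzero. *)
have Bij : polar c (mk Q i) (mk Q j) = 0.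
  have := qfZ c D (mk Q l); rewrite el on mulr0.
  have := qf_comb c x y 0 (mk Q i) (mk Q j) w; rewrite scale0r addr0 => ->.
  rewrite !on !mulr0 !mul0r expr0n /= mul0r !addr0 !add0r => /eqP.
  by rewrite !mulf_eq0 (negPf x0) (negPf y0) => /eqP.
have g0 := lker_cols2 Dw.
have gc u : qf c (cols2 (mk Q i) (mk Q j) u) = 0.
  rewrite cols2E; have := qf_comb c (u 'a0) (u 'a1) 0 (mk Q i) (mk Q j) w.
  by rewrite scale0r addr0 => ->; rewrite !on Bij; ring.
have n10 : vec2 1 0 != 0 :> {ffun 'I_2 -> k^o}.
  by apply: (@nonzero_at _ _ _ 'a0); rewrite vec2_0 oner_eq0.
have n01 : vec2 0 1 != 0 :> {ffun 'I_2 -> k^o}.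
  by apply: (@nonzero_at _ _ _ 'a1); rewrite vec2_1 oner_eq0.
have nxy : vec2 x y != 0 :> {ffun 'I_2 -> k^o}.
  by apply: (@nonzero_at _ _ _ 'a0); rewrite vec2_0.
have mark_line a (u : nonzero k 'I_2) (t : k) :
    cols2 (mk Q i) (mk Q j) (sval u) = t *: mk Q a ->
    sval (mark (conic_curve Q) a) = pmap g0 (line u).
  by move=> e; rewrite pmap_line; apply/line_eq; exists t.
have mi := @mark_line i (nz n10) 1; have mj := @mark_line j (nz n01) 1.
have ml := @mark_line l (nz nxy) D.
rewrite /= !cols2E !vec2_0 !vec2_1 !scale0r !scale1r ?addr0 ?add0r -?el in mi mj ml.
have nsij : ~ sep (conic_curve Q) i j.
  by apply: (@line_not_separated k Q _ g0 (nz n10) (nz n01) _ _ gc); [apply: mi|apply: mj].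
have nsil : ~ sep (conic_curve Q) i l.
  by apply: (@line_not_separated k Q _ g0 (nz n10) (nz nxy) _ _ gc); [apply: mi|apply: ml].
have [[x' _ iso]|[psi [y' [chi [x' nod]]]]] := stable_smooth_or_nodal sQ; last first.
  have eij : chi i = chi j by apply/eqP; apply: contraT => /(nodal_sep nod) /nsij.
  have eil : chi i = chi l by apply/eqP; apply: contraT => /(nodal_sep nod) /nsil.
  (* On a nodal curve the three unseparated marks would share a component, which carries only
     two. *)
  have := nodal_card nod (chi i).
  have : [set i; j; l] \subset [set a | chi a == chi i].
    by apply/subsetP => a; rewrite !inE => /orP[/orP[]|] /eqP ->; rewrite ?eij -?eil ?eqxx // eij.
  move/subset_leq_card; rewrite -setUA cardsU1 cards2 !inE negb_or ij il jl.
  by move=> h e; rewrite e in h.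
(* On a smooth curve: in coordinates where the line is x2 = 0, the conic is x2 (a x0 + b x1 + d x2).
   If it is a pair of distinct lines it has separated points, unlike the projective line. *)
pose G := cols3 (mk Q i) (mk Q j) w; have G0 := lker_cols3 Dw.
have Ec := qf_cols3 c (mk Q i) (mk Q j) w.
rewrite !on Bij in Ec.
set a := polar c (mk Q i) w in Ec; set b := polar c (mk Q j) w in Ec.
set d := qf c w in Ec.
have c'0 : conic6 0 0 a 0 b d != 0 :> conics.
  apply: contra_neq (svalP (conic Q)) => c'0; apply: qf_inj0 => v.
  rewrite -/c -(lker0_lfunVK G0 v) Ec c'0.
  by rewrite qfE !ffunE !mul0r !addr0.
have mG n : G (G^-1%VF (mk Q n)) = mk Q n by rewrite lker0_lfunVK.
have GV0 n : (G^-1)%VF (mk Q n) != 0.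
  apply: contra_neq (svalP (conic_mark Q n)) => e.
  by rewrite -/(mk Q n) -mG e linear0.
have [Q' [cQ' mQ' isoQ']] : exists Q', [/\ conic Q' = nz c'0,
    conic_mark Q' = (fun n => nz (GV0 n)) & pointed_iso (conic_curve Q') (conic_curve Q)].
  apply: (pull_conic (t := 1) (g0 := G0)) => [|v|n]; first exact: oner_neq0.
    by rewrite /= Ec mul1r.
  by rewrite pmap_line; congr line; apply: val_inj; rewrite /= mG.
have Ec' v : qf (sval (conic Q')) v = dot (vec3 0 0 1) v * dot (vec3 a b d) v.
  by rewrite cQ' qf_conic6 /dot !vec3E; ring.
(* Otherwise the equation is d x2^2: the polynomial x2 vanishes on its zeros without being a
   multiple of it, against reducedness. *)
have ab : (a != 0) || (b != 0).
  apply: contraT; rewrite negb_or !negbK => /andP[/eqP a0 /eqP b0].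
  have d0 : d != 0.
    have := c'0; apply: contra_neq => d0; rewrite a0 b0 d0; apply/ffunP => z.
    by rewrite !ffunE; do ?case: ifP.
  pose Z : {mpoly k[#|'I_3|]} := pvar k 'c2.
  have formE : conic_form (sval (conic Q')) = d *: (Z * Z).
    apply: peval_inj => v; rewrite -[LHS]/(qf _ v) Ec' a0 b0 pevalZ pevalM peval_var.
    by rewrite /dot !vec3E; ring.
  have [H eH] : pdvd (conic_form (sval (conic Q'))) Z.
    apply/(@conic_reduced _ Q') => v /eqP; rewrite formE pevalZ pevalM peval_var.
    by rewrite mulf_eq0 (negPf d0) mulf_eq0 orbb => /eqP.
  have Z0 : Z != 0.
    by apply: (@peval_nz _ _ _ (vec3 0 0 1)); rewrite peval_var vec3E oner_eq0.
  have /(congr1 (fun P => peval P 0)) : H * (d *: Z) = 1.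
    apply: (mulIf Z0); rewrite mul1r [RHS]eH formE -!scalerAr -scalerAl mulrA //.
  by rewrite peval1 pevalM pevalZ peval_var ffunE !mulr0 => /esym/eqP; rewrite oner_eq0.
have [p [q]] : exists p q : curve_pt (conic_curve Q'), separated p q.
  apply: (reducible_conic_separated Ec'); have [a0|a0] := eqVneq a 0.
  - have b0 : b != 0 by move: ab; rewrite a0 eqxx.
    by exists (vec3 0 1 0); rewrite /dot !vec3E; split; [ring|rewrite !mulr0 mulr1 addr0 add0r].
  - by exists (vec3 1 0 0); rewrite /dot !vec3E; split; [ring|rewrite !mulr0 mulr1 !addr0].
  - have b0 : b != 0 by move: ab; rewrite a0 eqxx.
    exists (vec3 0 (- d / b) 1); rewrite /dot !vec3E; split; first by field.
    by rewrite !mul0r !add0r mulr1 oner_eq0.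
  - exists (vec3 (- d / a) 0 1); rewrite /dot !vec3E; split; first by field.
    by rewrite !mul0r !add0r mulr1 oner_eq0.
by apply: config_not_separated; apply: pointed_iso_trans iso (pointed_iso_sym isoQ').
Qed.

End Collinear.
End GeneralPosition.

(** * The pencil of conics through four fixed points *)

Section NormalForm.
Variable k : closedFieldType.
Local Notation V := {ffun 'I_3 -> k^o}.
Local Notation conics := {ffun mono2 -> k^o}.
Implicit Types (Q : marked_conic k) (u v w : V) (c : conics).

Lemma polar_comb c u (x y z : k) u' v' w' :
  polar c u (x *: u' + y *: v' + z *: w') =
  x * polar c u u' + y * polar c u v' + z * polar c u w'.
Proof. by rewrite /polar !ffunE !scale_regular; ring. Qed.

Lemma polarZ c u (x y : k) v : polar c (x *: u) (y *: v) = x * y * polar c u v.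
Proof. by rewrite /polar !ffunE !scale_regular; ring. Qed.

Lemma polarZr c u (x : k) v : polar c u (x *: v) = x * polar c u v.
Proof. by rewrite /polar !ffunE !scale_regular; ring. Qed.

Lemma polar_sym c u v : polar c u v = polar c v u.
Proof. by rewrite /polar; ring. Qed.

Lemma polar_self c u : polar c u u = 2%:R * qf c u.
Proof. by rewrite /polar qfE; ring. Qed.

Lemma det3Z (x y z : k) u v w :
  det3 (x *: u) (y *: v) (z *: w) = x * y * z * det3 u v w.
Proof. by rewrite /det3 !ffunE !scale_regular; ring. Qed.

(* On the Veronese image of four points of the line, [ij] being their brackets,
   the determinants are products of three brackets and polar is the squared
   bracket: conic_num and conic_den are then, up to the common factor
   [03][13][23], the numbers [01][23] and [02][13]. *)
Definition conic_num Q : k :=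
  det3 (mk Q 'm0) (mk Q 'm1) (mk Q 'm3) *
  polar (sval (conic Q)) (mk Q 'm2) (mk Q 'm3).
Definition conic_den Q : k :=
  det3 (mk Q 'm0) (mk Q 'm2) (mk Q 'm3) *
  polar (sval (conic Q)) (mk Q 'm1) (mk Q 'm3).

(** No square terms, because of the coordinate points [emark i], i < 3; coefficients of sum zero,
    because of the last mark (1 : 1 : 1). *)
Definition pencil (a b : k) : conics := conic6 0 (- a) b 0 (a - b) 0.

Definition emark (i : 'I_4) : V :=
  [ffun j : 'I_3 => (((i == 3 :> nat) || (i == j :> nat))%:R : k^o)].

Lemma emark_neq0 i : emark i != 0.
Proof.
move: i; apply: ord4P; [apply: (@nonzero_at _ _ _ 'c0)|apply: (@nonzero_at _ _ _ 'c1)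
  |apply: (@nonzero_at _ _ _ 'c2)|apply: (@nonzero_at _ _ _ 'c0)];
by rewrite ffunE /= oner_eq0.
Qed.

Lemma emarkE : (emark 'm0 = vec3 1 0 0) * (emark 'm1 = vec3 0 1 0) *
  (emark 'm2 = vec3 0 0 1) * (emark 'm3 = vec3 1 1 1).
Proof. by do !split; apply: vec3P; rewrite !ffunE. Qed.

Lemma qf_pencil a b v : qf (pencil a b) v =
  - a * (v 'c0 * v 'c1) + b * (v 'c0 * v 'c2) + (a - b) * (v 'c1 * v 'c2).
Proof. by rewrite qf_conic6; ring. Qed.

Definition in_pencil Q (a b : k) : Prop :=
  sval (conic Q) = pencil a b /\ forall i, mk Q i = emark i.

(** By Cramer's rule D m3 = x m0 + y m1 + z m2, so the matrix with columns x m0, y m1, z m2 sends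
    each [emark i] to a multiple of the i-th mark. Pulled back, the conic has coefficients x y, x z,
    y z times polar values; their sum vanishes because m3 lies on it, and they are those of the
    pencil at D times ([conic_num], [conic_den]). Hence d = D. *)
Lemma normal_form Q : stable (conic_curve Q) ->
  exists Q' (d : k), [/\ d != 0, in_pencil Q' (d * conic_num Q) (d * conic_den Q)
    & pointed_iso (conic_curve Q') (conic_curve Q)].
Proof.
move=> sQ.
have D012 := stable_det3 sQ (i := 'm0) (j := 'm1) (l := 'm2) isT isT isT.
have D312 := stable_det3 sQ (i := 'm3) (j := 'm1) (l := 'm2) isT isT isT.
have D032 := stable_det3 sQ (i := 'm0) (j := 'm3) (l := 'm2) isT isT isT.
have D013 := stable_det3 sQ (i := 'm0) (j := 'm1) (l := 'm3) isT isT isT.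
have on := mk_on Q.
(* The second Cramer coefficient y has its columns in the order 0, 3, 2, whence the sign in b. *)
have det023 : det3 (mk Q 'm0) (mk Q 'm2) (mk Q 'm3) =
    - det3 (mk Q 'm0) (mk Q 'm3) (mk Q 'm2) by rewrite /det3; ring.
have := cramer3 (mk Q 'm0) (mk Q 'm1) (mk Q 'm2) (mk Q 'm3).
set D := det3 _ _ (mk Q 'm2) in D012 *.
rewrite /conic_num /conic_den det023.
set x := det3 _ _ _ in D312 *; set y := det3 _ (mk Q 'm3) _ in D032 *.
set z := det3 _ _ _ in D013 *; set c := sval (conic Q) in on *.
move=> e3.
have S : x * y * polar c (mk Q 'm0) (mk Q 'm1) + x * z * polar c (mk Q 'm0) (mk Q 'm2)
     + y * z * polar c (mk Q 'm1) (mk Q 'm2) = 0.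
  by have := qfZ c D (mk Q 'm3); rewrite e3 qf_comb !on !mulr0 !add0r.
have B23 : D * polar c (mk Q 'm2) (mk Q 'm3) =
    x * polar c (mk Q 'm0) (mk Q 'm2) + y * polar c (mk Q 'm1) (mk Q 'm2).
  rewrite -polarZr e3 polar_comb polar_self on !mulr0 addr0.
  by rewrite (polar_sym c (mk Q 'm2) (mk Q 'm0)) (polar_sym c (mk Q 'm2) (mk Q 'm1)).
have B13 : D * polar c (mk Q 'm1) (mk Q 'm3) =
    x * polar c (mk Q 'm0) (mk Q 'm1) + z * polar c (mk Q 'm1) (mk Q 'm2).
  rewrite -polarZr e3 polar_comb polar_self on !mulr0 addr0.
  by rewrite (polar_sym c (mk Q 'm1) (mk Q 'm0)).
set a := z * _; set b := - y * _.
have Da : D * a = - (x * y * polar c (mk Q 'm0) (mk Q 'm1)).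
  apply/eqP; rewrite -subr_eq0 -S; apply/eqP.
  rewrite /a mulrCA B23; ring.
have Db : D * b = x * z * polar c (mk Q 'm0) (mk Q 'm2).
  apply/eqP; rewrite -subr_eq0 -[0]oppr0 -S; apply/eqP.
  rewrite /b mulrCA B13; ring.
have detM : det3 (x *: mk Q 'm0) (y *: mk Q 'm1) (z *: mk Q 'm2) != 0.
  by rewrite det3Z !mulf_neq0.
pose M := cols3 (x *: mk Q 'm0) (y *: mk Q 'm1) (z *: mk Q 'm2).
have M0 : lker M == 0%VS := lker_cols3 detM.
have EM v : qf (pencil (D * a) (D * b)) v = qf c (M v).
  rewrite qf_cols3 !qfZ !polarZ !on !mulr0 qf_conic6 qf_pencil Da Db.
  rewrite (_ : _ - _ = y * z * polar c (mk Q 'm1) (mk Q 'm2)); first by ring.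
  by apply/eqP; rewrite -subr_eq0 -[0]oppr0 -S; apply/eqP; ring.
have p0 : pencil (D * a) (D * b) != 0.
  apply: contra_neq (svalP (conic Q)) => p0; apply: qf_inj0 => v.
  rewrite -/c -(lker0_lfunVK M0 v) -EM p0.
  by rewrite qfE !ffunE !mul0r !addr0.
have [|||Q' [cQ' mQ' iso]] := pull_conic (Q := Q) (t := 1) (g0 := M0) (c' := nz p0)
    (m := fun i => nz (emark_neq0 i)); last first.
- exists Q', D; split=> //; split; first by rewrite cQ'.
  by move=> i; rewrite /mk mQ'.
- have [M1 M2 M3] := cols3_basis (x *: mk Q 'm0) (y *: mk Q 'm1) (z *: mk Q 'm2).
  have mE i (t : k) : M (emark i) = t *: mk Q i -> t != 0 ->
      pmap M0 (line (nz (emark_neq0 i))) = line (conic_mark Q i).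
    move=> e t0; rewrite pmap_line; apply/esym/line_eq; exists t.
    by rewrite /= e.
  apply: ord4P; [apply: (mE _ x)|apply: (mE _ y)|apply: (mE _ z)|apply: (mE _ D)] => //.
  + by rewrite emarkE M1.
  + by rewrite emarkE M2.
  + by rewrite emarkE M3.
  + by rewrite emarkE /M cols3E !vec3E !scale1r e3.
- by move=> v; rewrite /= EM mul1r.
- exact: oner_neq0.
Qed.

Lemma in_pencil_scale Q a b (t : k) : t != 0 -> in_pencil Q a b ->
  exists2 Q', in_pencil Q' (t * a) (t * b) & pointed_iso (conic_curve Q') (conic_curve Q).
Proof.
move=> t0 [cQ mQ]; have id0 : lker (\1%VF : 'End(V)) == 0%VS.
  by apply/lker0P => u v; rewrite !id_lfunE.
have p0 : pencil (t * a) (t * b) != 0.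
  apply: contra_neq (svalP (conic Q)) => p0; apply: qf_inj0 => v; rewrite cQ.
  apply: (mulfI t0); have := qf_pencil (t * a) (t * b) v; rewrite p0 qf_pencil.
  by rewrite qfE !ffunE !mul0r !addr0 mulr0 => e; rewrite [RHS]e; ring.
have [|||Q' [cQ' mQ' iso]] := pull_conic (Q := Q) (t := t) (g0 := id0) (c' := nz p0)
    (m := conic_mark Q) => //.
- by move=> v; rewrite id_lfunE cQ /= !qf_pencil; ring.
- by move=> i; rewrite pmap_line; congr line; apply: val_inj; rewrite /= id_lfunE.
by exists Q' => //; split=> [|i]; rewrite ?cQ' // /mk mQ' -/(mk Q i) mQ.
Qed.

Section PencilSeparation.
Variables (Q : marked_conic k) (a b : k).
Hypothesis Qab : in_pencil Q a b.

Let split_sep (l m : V) i j :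
  (forall v, qf (pencil a b) v = dot l v * dot m v) ->
  dot l (emark i) != 0 -> dot m (emark j) != 0 -> sep (conic_curve Q) i j.
Proof.
have [cQ mQ] := Qab; move=> E li mj.
apply: (@split_separated _ Q l m (conic_mark Q i) (conic_mark Q j)) => //.
- by move=> v; rewrite cQ.
- by rewrite -/(mk Q i) mQ.
- by rewrite -/(mk Q j) mQ.
Qed.

(** A conic through two points with vanishing polar value contains the line joining them; [w] only
    witnesses that the two points are distinct. *)
Lemma pencil_line_not_sep i j w : det3 (emark i) (emark j) w != 0 ->
  polar (pencil a b) (emark i) (emark j) = 0 -> ~ sep (conic_curve Q) i j.
Proof.
have [cQ mQ] := Qab; move=> D0 B0.
have n10 : vec2 1 0 != 0 :> {ffun 'I_2 -> k^o}.
  by apply: (@nonzero_at _ _ _ 'a0); rewrite vec2_0 oner_eq0.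
have n01 : vec2 0 1 != 0 :> {ffun 'I_2 -> k^o}.
  by apply: (@nonzero_at _ _ _ 'a1); rewrite vec2_1 oner_eq0.
have g0 := lker_cols2 D0.
apply: (@line_not_separated k Q _ g0 (nz n10) (nz n01)).
- move=> u; have on n := mk_on Q n; rewrite cQ cols2E.
  have := qf_comb (pencil a b) (u 'a0) (u 'a1) 0 (emark i) (emark j) w.
  by rewrite scale0r addr0 => ->; rewrite -!mQ -cQ !on cQ !mQ B0; ring.
- rewrite pmap_line; apply/line_eq; exists 1.
  by rewrite -/(mk Q i) mQ /= cols2E vec2_0 vec2_1 scale0r addr0.
- rewrite pmap_line; apply/line_eq; exists 1.
  by rewrite -/(mk Q j) mQ /= cols2E vec2_0 vec2_1 scale0r add0r.
Qed.

Lemma pencil_neq0 : (a != 0) || (b != 0).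
Proof.
apply: contraT; rewrite negb_or !negbK => /andP[/eqP a0 /eqP b0].
have [cQ _] := Qab; have /eqP[] := svalP (conic Q).
rewrite cQ a0 b0; apply: qf_inj0 => v; rewrite qf_pencil; ring.
Qed.

Ltac eval_emark :=
  rewrite ?emarkE ?/dot ?/det3 !vec3E;
  rewrite !(mul1r, mulr0, mul0r, mulr1, addr0, add0r, subr0, sub0r, mulrN1, oppr_eq0)
    ?oner_eq0.

Ltac eval_polar := rewrite ?emarkE /polar !vec3E !ffunE /=.

(** The degenerate members are b x2 (x0 - x1) for a = 0, a x1 (x2 - x0) for b = 0 and a x0 (x2 - x1)
    for a = b; the marks split as 01|23, 02|13 and 03|12. This and the next two lemmas record how
    mark 0 is separated from the others. *)
Lemma pencil_sep_num : a = 0 ->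
  [/\ sep (conic_curve Q) 'm0 'm2, sep (conic_curve Q) 'm0 'm3 &
      ~ sep (conic_curve Q) 'm0 'm1].
Proof.
move=> a0; have b0 : b != 0 by move: pencil_neq0; rewrite a0 eqxx.
have E v : qf (pencil a b) v = dot (vec3 1 (-1) 0) v * dot (vec3 0 0 b) v.
  by rewrite qf_pencil /dot !vec3E a0; ring.
split; [apply: (split_sep E)|apply: (split_sep E)|]; try by eval_emark.
apply: (@pencil_line_not_sep _ _ (vec3 0 0 1)); first by eval_emark.
by eval_polar; rewrite a0; ring.
Qed.

Lemma pencil_sep_den : b = 0 ->
  [/\ sep (conic_curve Q) 'm0 'm1, sep (conic_curve Q) 'm0 'm3 &
      ~ sep (conic_curve Q) 'm0 'm2].
Proof.
move=> b0; have a0 : a != 0 by move: pencil_neq0; rewrite b0 eqxx orbF.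
have E v : qf (pencil a b) v = dot (vec3 (-1) 0 1) v * dot (vec3 0 a 0) v.
  by rewrite qf_pencil /dot !vec3E b0; ring.
split; [apply: (split_sep E)|apply: (split_sep E)|]; try by eval_emark.
apply: (@pencil_line_not_sep _ _ (vec3 0 1 0)); first by eval_emark.
by eval_polar; rewrite b0; ring.
Qed.

Lemma pencil_sep_eq : a = b ->
  [/\ sep (conic_curve Q) 'm0 'm1, sep (conic_curve Q) 'm0 'm2 &
      ~ sep (conic_curve Q) 'm0 'm3].
Proof.
move=> ab; have a0 : a != 0 by move: pencil_neq0; rewrite -ab orbb.
have E v : qf (pencil a b) v = dot (vec3 a 0 0) v * dot (vec3 0 (-1) 1) v.
  by rewrite qf_pencil /dot !vec3E ab; ring.
split; [apply: (split_sep E)|apply: (split_sep E)|]; try by eval_emark.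
apply: (@pencil_line_not_sep _ _ (vec3 0 0 1)); first by eval_emark.
by eval_polar; rewrite ab; ring.
Qed.

End PencilSeparation.

End NormalForm.

(** * Smooth curves as Veronese conics *)

Section Veronese.
Variable k : closedFieldType.
Local Notation V := {ffun 'I_3 -> k^o}.
Local Notation U := {ffun 'I_2 -> k^o}.
Implicit Types (u w : nonzero k 'I_2).

Definition smooth_conic : {ffun mono2 -> k^o} := conic6 0 0 1 (- 1) 0 0.

Lemma qf_smooth (v : V) : qf smooth_conic v = v 'c0 * v 'c2 - v 'c1 * v 'c1.
Proof. by rewrite qf_conic6; ring. Qed.

Lemma smooth_conic_neq0 : smooth_conic != 0.
Proof. by apply: (@nonzero_at _ _ _ q02); rewrite ffunE /= oner_eq0. Qed.

(** The equation x0 x2 - x1^2 is linear in x0, with prime leading coefficient x2, which does not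
    divide x1^2. *)
Lemma smooth_conic_reduced : generates_ideal_of (conic_form smooth_conic)
  (fun v => peval (conic_form smooth_conic) v = 0).
Proof.
pose A : {mpoly k[#|'I_3|]} := pvar k 'c2.
pose B : {mpoly k[#|'I_3|]} := - (pvar k 'c1 * pvar k 'c1).
move=> G; split=> [GZ|[H ->] v Zv]; last by rewrite pevalM Zv mulr0.
apply: (@nullstellensatz_linear k 'I_3 'c0 _ A B).
- by apply: (@peval_nz _ _ _ (vec3 0 0 1)); rewrite peval_var vec3E oner_eq0.
- exact: free_ofX.
- by rewrite /B -sub0r; apply: free_ofB; [exact: free_of0|apply: free_ofM; apply: free_ofX].
- by apply: peval_inj => v; rewrite -[LHS]/(qf _ _) qf_smooth !pevalE; ring.
- move=> H /prime_var [//|[R /(congr1 (fun P => peval P (vec3 0 1 0)))]].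
  by rewrite !pevalE !vec3E mulr0 mulr1 => /eqP; rewrite oppr_eq0 oner_eq0.
- by move=> v Zv _; apply: GZ.
Qed.

Definition ver (u : U) : V := vec3 (u 'a0 * u 'a0) (u 'a0 * u 'a1) (u 'a1 * u 'a1).

Lemma ver_neq0 u : ver (sval u) != 0.
Proof.
have [i] := nonzero_coord u; move: i; apply: ord2P => ui.
  by apply: (@nonzero_at _ _ _ 'c0); rewrite vec3E mulf_neq0.
by apply: (@nonzero_at _ _ _ 'c2); rewrite vec3E mulf_neq0.
Qed.

Lemma qf_ver (u : U) : qf smooth_conic (ver u) = 0.
Proof. by rewrite qf_smooth !vec3E; ring. Qed.

Lemma verZ (c : k) (u : U) : ver (c *: u) = (c * c) *: ver u.
Proof. by apply: vec3P; rewrite !ffunE /= !scale_regular; ring. Qed.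

Lemma ver_on u : conic_locus smooth_conic (line (nz (ver_neq0 u))).
Proof. exact/conic_locus_line/qf_ver. Qed.

Definition ver_map (L : P1 k) : {L | conic_locus smooth_conic L} :=
  exist _ _ (@ver_on (sval (cid (line_surj L)))).

Lemma ver_map_line u (v : nonzero k 'I_3) (t : k)
    (Hv : conic_locus smooth_conic (line v)) :
  ver (sval u) = t *: sval v -> ver_map (line u) = exist _ (line v) Hv.
Proof.
rewrite /ver_map; case: cid => w /= /line_eq [c ew] e; apply: eq_exist.
apply/esym/line_eq; exists (c * c * t).
by rewrite /= ew verZ e scalerA.
Qed.

(** The inverse is (x0 : x1) where x0 != 0 and (x1 : x2) where x2 != 0; these two loci cover the
    conic. *)
Lemma ver_map_iso : zisomorphism (P1_space k)
  (subspace (proj_space k 'I_3) (conic_locus smooth_conic)) ver_map.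
Proof.
apply: (poly_lift_isomorphism (presented_proj k 'I_2)
  (presented_subspace (conic_locus smooth_conic))).
- move=> L L'; have [u ->] := line_surj L; have [w ->] := line_surj L'.
  rewrite (ver_map_line (@ver_on u) (t := 1)) ?scale1r //.
  rewrite (ver_map_line (@ver_on w) (t := 1)) ?scale1r //.
  move=> /(congr1 sval) /line_eq [c /= e]; apply/line_eq2.
  have e0 := congr1 (fun v : V => v 'c0) e; have e1 := congr1 (fun v : V => v 'c1) e.
  have e2 := congr1 (fun v : V => v 'c2) e.
  rewrite !ffunE !scale_regular /= in e0 e1 e2.
  (* The squared bracket of u and w is the polar value of the conic at their Veronese images, which
     vanishes when these are proportional. *)
  have : br (sval u) (sval w) * br (sval u) (sval w) = 0.
    rewrite /br; transitivity (sval u 'a0 * sval u 'a0 * (sval w 'a1 * sval w 'a1)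
      - (sval u 'a0 * sval u 'a1 * (sval w 'a0 * sval w 'a1)) *+ 2
      + sval u 'a1 * sval u 'a1 * (sval w 'a0 * sval w 'a0)); first by ring.
    by rewrite e0 e1 e2; ring.
  by move/eqP; rewrite mulf_eq0 orbb => /eqP.
- exact: cone_line_surj.
- move=> e; exists 1, (fun j : 'I_3 => nth 0 [:: pvar k 'a0 * pvar k 'a0;
    pvar k 'a0 * pvar k 'a1; pvar k 'a1 * pvar k 'a1] j).
  rewrite peval1 oner_eq0; split=> // u _.
  exists (exist (fun n : nonzero k 'I_3 => conic_locus smooth_conic (line n)) _ (@ver_on u)).
  split; last by apply: ord3P; rewrite /= ffunE /= pevalM !peval_var.
  by rewrite (ver_map_line (@ver_on u) (t := 1)) ?scale1r //; apply: eq_exist.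
- move=> e; have on (x : cone (conic_locus smooth_conic)) :
      cone_val x 'c0 * cone_val x 'c2 = cone_val x 'c1 * cone_val x 'c1.
    have /conic_locus_line := svalP x; rewrite qf_smooth => /eqP.
    by rewrite subr_eq0 => /eqP.
  have [e0|e0] := eqVneq (cone_val e 'c0) 0; last first.
    exists (pvar k 'c0), (fun j => if j == 'a0 then pvar k 'c0 else pvar k 'c1).
    rewrite peval_var; split=> // x; rewrite peval_var => x0.
    have n : vec2 (cone_val x 'c0) (cone_val x 'c1) != 0.
      by apply: (@nonzero_at _ _ _ 'a0); rewrite vec2_0.
    exists (nz n); split; last by apply: ord2P; rewrite /= ?vec2_0 ?vec2_1 peval_var.
    rewrite (ver_map_line (svalP x) (t := cone_val x 'c0)) //=.
    by apply: vec3P; rewrite vec3E !ffunE scale_regular //= -on.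
  have e2 : cone_val e 'c2 != 0.
    apply: contra_neq (svalP (sval e)) => e2; apply: vec3P; rewrite [RHS]ffunE //.
    have := on e; rewrite e0 mul0r => /esym/eqP.
    by rewrite mulf_eq0 orbb => /eqP.
  exists (pvar k 'c2), (fun j => if j == 'a0 then pvar k 'c1 else pvar k 'c2).
  rewrite peval_var; split=> // x; rewrite peval_var => x2.
  have n : vec2 (cone_val x 'c1) (cone_val x 'c2) != 0.
    by apply: (@nonzero_at _ _ _ 'a1); rewrite vec2_1.
  exists (nz n); split; last by apply: ord2P; rewrite /= ?vec2_0 ?vec2_1 peval_var.
  rewrite (ver_map_line (svalP x) (t := cone_val x 'c2)) //=.
  apply: vec3P; rewrite vec3E !ffunE scale_regular //= -?on; first exact: mulrC.
  by rewrite mulrC.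
Qed.

Lemma config_conic (A : coords k) : injective (points A) ->
  exists Q, [/\ stable (conic_curve Q),
    pointed_iso (config_curve (points A)) (conic_curve Q) &
    exists2 t, t != 0 & conic_num Q = t * cr_num A /\ conic_den Q = t * cr_den A].
Proof.
move=> A_inj; have A0 := (points_inj A).1 A_inj.
pose Q := @MarkedConic k (nz smooth_conic_neq0) smooth_conic_reduced
  (fun i => nz (ver_neq0 (A i))) (fun i => @ver_on (A i)).
have iso : pointed_iso (config_curve (points A)) (conic_curve Q).
  exists ver_map; first exact: ver_map_iso.
  by move=> i; apply: (ver_map_line (t := 1)); rewrite scale1r.
exists Q; split=> //; first exact: stable_iso iso (config_stable A_inj).
exists (brc A 'm0 'm3 * brc A 'm1 'm3 * brc A 'm2 'm3).
  by rewrite !mulf_neq0 ?A0.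
rewrite /conic_num /conic_den /mk /= /det3 /polar !vec3E !ffunE /=.
by rewrite /cr_num /cr_den /brc /br; split; ring.
Qed.

End Veronese.

(** * The conic x0 x1 = 0 as two glued projective lines *)

Section CrossingLines.
Variable k : closedFieldType.
Local Notation V := {ffun 'I_3 -> k^o}.
Local Notation U := {ffun 'I_2 -> k^o}.

Definition crossing : {ffun mono2 -> k^o} := conic6 0 1 0 0 0 0.

Lemma qf_crossing (v : V) : qf crossing v = v 'c0 * v 'c1.
Proof. by rewrite qf_conic6; ring. Qed.

Lemma crossing_neq0 : crossing != 0.
Proof. by apply: (@nonzero_at _ _ _ q01); rewrite ffunE /= oner_eq0. Qed.

Lemma var_nullstellensatz (I : finType) (i : I) (G : {mpoly k[#|I|]}) :
  (forall v : {ffun I -> k^o}, v i = 0 -> peval G v = 0) -> pdvd (pvar k i) G.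
Proof.
move=> GZ; apply: (@nullstellensatz_linear k I i _ 1 0).
- exact: oner_neq0.
- exact: free_of1.
- exact: free_of0.
- by rewrite mul1r addr0.
- by move=> H _; exists H; rewrite mulr1.
- by move=> v; rewrite peval_var => vi _; apply: GZ.
Qed.

(** [G] vanishes on x0 = 0, so x0 divides it; it also vanishes on x1 = 0, and the prime x1, which
    does not divide x0, divides the cofactor. *)
Lemma crossing_reduced : generates_ideal_of (conic_form crossing)
  (fun v => peval (conic_form crossing) v = 0).
Proof.
have E : conic_form crossing = pvar k 'c0 * pvar k 'c1.
  by apply: peval_inj => v; rewrite -[LHS]/(qf _ _) qf_crossing pevalM !peval_var.
move=> G; split=> [GZ|[H ->] v Zv]; last by rewrite pevalM Zv mulr0.
rewrite E in GZ *; have [H eH] : pdvd (pvar k 'c0) G.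
  by apply: var_nullstellensatz => v v0; apply: GZ; rewrite pevalM !peval_var v0 mul0r.
have /prime_var [[H' eH']|[R /(congr1 (fun P => peval P (vec3 1 0 0)))]] :
    pdvd (pvar k 'c1) (H * pvar k 'c0).
- by rewrite -eH; apply: var_nullstellensatz => v v1; apply: GZ;
    rewrite pevalM !peval_var v1 mulr0.
- by exists H'; rewrite eH eH' -mulrA [pvar k 'c1 * _]mulrC.
- by rewrite pevalM !peval_var !vec3E mulr0 => /eqP; rewrite oner_eq0.
Qed.

(** The coordinate left free on the line of index [b], on which [axis (~~ b)] vanishes. *)
Definition axis (b : bool) : 'I_3 := if b then 'c0 else 'c1.
Definition axis_vec (b : bool) : V := if b then vec3 1 0 0 else vec3 0 1 0.

Lemma lker_axis b : lker (cols2 (axis_vec b) (vec3 0 0 1)) == 0%VS.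
Proof.
by case: b; [apply: (@lker_cols2 _ _ _ (vec3 0 1 0))|apply: (@lker_cols2 _ _ _ (vec3 1 0 0))];
  rewrite /det3 !vec3E !(mulr0, mul0r, mulr1, subr0, addr0, sub0r, mul1r, opprK, add0r) ?oppr_eq0 oner_eq0.
Qed.

Lemma axis_in_crossing b x : qf crossing (cols2 (axis_vec b) (vec3 0 0 1) x) = 0.
Proof.
rewrite qf_crossing cols2E !ffunE !scale_regular.
by case: b; rewrite /axis_vec !ffunE /=; ring.
Qed.

Definition axis_map (b : bool) : P1 k -> {L | conic_locus crossing L} :=
  sval (cid2 (line_in_conic (lker_axis b) (axis_in_crossing b))).

Lemma axis_map_morphism b : zmorphism (P1_space k)
  (subspace (proj_space k 'I_3) (conic_locus crossing)) (axis_map b).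
Proof. by rewrite /axis_map; case: cid2. Qed.

Lemma axis_mapE b L : sval (axis_map b L) = pmap (lker_axis b) L.
Proof. by rewrite /axis_map; case: cid2. Qed.

Local Notation E := (cone (conic_locus crossing)).

Definition axis_coords (b : bool) (v : V) : U := vec2 (v (axis b)) (v 'c2).

Lemma on_crossing (e : E) b : cone_val e (axis b) * cone_val e (axis (~~ b)) = 0.
Proof.
have /conic_locus_line := svalP e; rewrite qf_crossing => H.
by case: b => //=; rewrite mulrC.
Qed.

Lemma on_axis (e : E) b : cone_val e (axis (~~ b)) = 0 ->
  exists2 u : nonzero k 'I_2, sval u = axis_coords b (cone_val e) &
    axis_map b (line u) = cone_line e.
Proof.
move=> e0.
have eE : cols2 (axis_vec b) (vec3 0 0 1) (axis_coords b (cone_val e)) = cone_val e.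
  by rewrite cols2E vec2_0 vec2_1; case: (b) e0 => /= e0; apply: vec3P;
    rewrite !ffunE !scale_regular /= ?e0 ?(mulr0, mulr1, addr0, add0r).
have u0 : axis_coords b (cone_val e) != 0.
  by apply: contra_neq (svalP (sval e)) => u0; rewrite -/(cone_val e) -eE u0 linear0.
exists (nz u0) => //; have := axis_mapE b (line (nz u0)).
case: (axis_map _ _) => L HL /= eL; apply: eq_exist.
by rewrite eL pmap_line; congr line; apply: val_inj.
Qed.

(** Extends a polynomial on the line [b] to the plane, along the projection [axis_coords b]. *)
Definition restrict (b : bool) (p : {mpoly k[#|'I_2|]}) : {mpoly k[#|'I_3|]} :=
  pcomp p (fun j => if j == 'a0 then pvar k (axis b) else pvar k 'c2).

Lemma peval_restrict b p (v : V) : peval (restrict b p) v = peval p (axis_coords b v).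
Proof.
rewrite peval_comp; congr peval; apply: vec2P; rewrite !ffunE /= peval_var //.
Qed.

Lemma peval_glued (X A1 B1 A2 B2 : {mpoly k[#|'I_3|]}) (f : k) (v : V) :
  peval (X * (A1 * B2 + A2 * B1 - f *: (B1 * B2))) v =
  peval X v * (peval A1 v * peval B2 v + peval A2 v * peval B1 v
    - f * (peval B1 v * peval B2 v)).
Proof. by rewrite !pevalE. Qed.

Lemma peval_glued_den (X B1 B2 : {mpoly k[#|'I_3|]}) (v : V) :
  peval (X * (B1 * B2)) v = peval X v * (peval B1 v * peval B2 v).
Proof. by rewrite !pevalE. Qed.

Lemma node_neq0 : vec2 0 1 != 0 :> U.
Proof. by apply: (@nonzero_at _ _ _ 'a1); rewrite vec2_1 oner_eq0. Qed.

Definition node : P1 k := line (nz node_neq0).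

Lemma nodeP (u : nonzero k 'I_2) : line u = node <-> sval u 'a0 = 0.
Proof.
rewrite /node; split=> [/esym/line_eq2|u0]; last apply/esym/line_eq2.
  by rewrite /br vec2_0 vec2_1 mul0r mul1r sub0r => /eqP; rewrite oppr_eq0 => /eqP.
by rewrite /br vec2_0 vec2_1 u0 mul0r mulr0 subrr.
Qed.

Lemma some_axis (e : E) : exists b, cone_val e (axis (~~ b)) = 0.
Proof.
have /eqP := on_crossing e true; rewrite mulf_eq0 => /orP[] /eqP e0.
  by exists false.
by exists true.
Qed.

Lemma axis_of_neq0 (e : E) b : cone_val e (axis b) != 0 -> cone_val e (axis (~~ b)) = 0.
Proof.
move=> eb; have /eqP := on_crossing e b; rewrite mulf_eq0 (negPf eb) => /eqP //.
Qed.

Let X := subspace (proj_space k 'I_3) (conic_locus crossing).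

Lemma crossing_open W : (forall b, zopen (P1_space k) (W \o axis_map b)) -> zopen X W.
Proof.
move=> oW; apply/(presented_open (presented_subspace (conic_locus crossing))).
have {}oW b : exists S : {mpoly k[#|'I_2|]} -> Prop, forall u : nonzero k 'I_2,
    W (axis_map b (line u)) <-> exists2 p, S p & peval p (sval u) != 0.
  by have /(presented_open (presented_proj k 'I_2)) := oW b.
pose S b := sval (cid (oW b)).
have WS b u : W (axis_map b (line u)) <-> exists2 p, S b p & peval p (sval u) != 0.
  by rewrite /S; case: cid => S0 /= H; apply: H.
(* a neighbourhood of the node is cut out by a product of one equation on each
   of the two lines *)
exists (fun P => (exists b p, S b p /\ P = pvar k (axis b) * restrict b p) \/
  exists p p', [/\ S true p, S false p' & P = restrict true p * restrict false p']).
move=> e; split=> /= [We|].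
  have [b eb] := some_axis e; have [u eu ue] := on_axis eb.
  have [p Sp] : exists2 p, S b p & peval p (sval u) != 0 by apply/WS; rewrite ue.
  rewrite eu -peval_restrict => pe.
  (* Off the node, the factor of index [axis b] confines the neighbourhood to the line b. *)
  have [eb0|eb0] := eqVneq (cone_val e (axis b)) 0; last first.
    exists (pvar k (axis b) * restrict b p); first by left; exists b, p.
    by rewrite pevalM peval_var mulf_neq0.
  have [u' eu' ue'] := @on_axis e (~~ b) (etrans (congr1 (fun b => cone_val e (axis b)) (negbK b)) eb0).
  have [p' Sp'] : exists2 p, S (~~ b) p & peval p (sval u') != 0 by apply/WS; rewrite ue'.
  rewrite eu' -peval_restrict => pe'.
  case: b {eb u eu ue eb0 u' eu' ue'} Sp pe Sp' pe' => /= Sp pe Sp' pe'.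
    exists (restrict true p * restrict false p'); first by right; exists p, p'.
    by rewrite pevalM; apply: mulf_neq0; [exact: pe|exact: pe'].
  exists (restrict true p' * restrict false p); first by right; exists p', p.
  by rewrite pevalM; apply: mulf_neq0; [exact: pe'|exact: pe].
move=> [P [[b [p [Sp ->]]]|[p [p' [Sp Sp' ->]]]]].
  rewrite pevalM peval_var mulf_eq0 negb_or peval_restrict => /andP[eb pe].
  have [u eu <-] := on_axis (axis_of_neq0 eb).
  by apply/WS; exists p => //; rewrite eu.
rewrite pevalM !peval_restrict mulf_eq0 negb_or => /andP[pe p'e].
have [b eb] := some_axis e; have [u eu <-] := on_axis eb; apply/WS.
by case: b {eb} eu => eu; [exists p|exists p'] => //; rewrite eu.
Qed.

Lemma crossing_regular W h :
  (forall b, zregular (P1_space k) (W \o axis_map b) (h \o axis_map b)) -> zregular X W h.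
Proof.
move=> rW; apply/(presented_regular (presented_subspace (conic_locus crossing))).
have rP b : areg sval (W \o axis_map b \o @line k 'I_2) (h \o axis_map b \o @line k 'I_2).
  by have /(presented_regular (presented_proj k 'I_2)) := rW b.
split.
  apply/(presented_open (presented_subspace (conic_locus crossing)))/crossing_open => b.
  by apply/(presented_open (presented_proj k 'I_2)); have [] := rP b.
have {}rP b (u : nonzero k 'I_2) : W (axis_map b (line u)) ->
    exists p q, peval q (sval u) != 0 /\ forall w : nonzero k 'I_2,
      W (axis_map b (line w)) -> peval q (sval w) != 0 ->
      h (axis_map b (line w)) = peval p (sval w) / peval q (sval w).
  by have [_ H] := rP b; apply: H.
move=> e We; have [b eb] := some_axis e; have [u eu ue] := on_axis eb.
have [|p [q [qu hpq]]] := rP b u; first by rewrite ue.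
have [eb0|eb0] := eqVneq (cone_val e (axis b)) 0; last first.
  exists (pvar k (axis b) * restrict b p), (pvar k (axis b) * restrict b q).
  rewrite !pevalM !peval_restrict peval_var -eu mulf_neq0 //; split=> // e1 We1.
  rewrite !pevalM !peval_restrict peval_var mulf_eq0 negb_or => /andP[e1b q1].
  have [u1 eu1 ue1] := on_axis (axis_of_neq0 e1b).
  rewrite /= -ue1 hpq ?ue1 // eu1 //.
  by rewrite -mulf_div divff ?mul1r.
have eNb : cone_val e (axis (~~ ~~ b)) = 0 by rewrite negbK.
have [u' eu' ue'] := on_axis eNb.
have [|p' [q' [qu' hpq']]] := rP (~~ b) u'; first by rewrite ue'.
have e2 : cone_val e 'c2 != 0.
  apply: contra_neq (svalP (sval e)) => e2; rewrite -/(cone_val e).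
  by case: (b) eb eb0 => /= eb eb0; apply: vec3P; rewrite [RHS]ffunE.
pose f0 := h (cone_line e).
(* near the node, h is the sum of its restrictions to the two lines, extended
   along the other line, minus its value at the node *)
exists (pvar k 'c2 * (restrict b p * restrict (~~ b) q' + restrict (~~ b) p' * restrict b q
   - f0 *: (restrict b q * restrict (~~ b) q'))).
exists (pvar k 'c2 * (restrict b q * restrict (~~ b) q')).
rewrite peval_glued_den peval_var !peval_restrict -eu -eu' !mulf_neq0 //; split=> // e1 We1.
rewrite peval_glued peval_glued_den peval_var !peval_restrict.
rewrite !mulf_eq0 !negb_or => /andP[z1 /andP[qe qe']].
(* A point of one line projects to the node of the other, where the fraction of that other line
   takes the value [f0]. The factor x2 keeps the projection nonzero. *)
have node_val c (p1 q1 : {mpoly k[#|'I_2|]}) : cone_val e1 (axis c) = 0 ->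
    peval q1 (axis_coords c (cone_val e1)) != 0 ->
    cone_line e = axis_map c node ->
    (forall w : nonzero k 'I_2,
      W (axis_map c (line w)) -> peval q1 (sval w) != 0 ->
      h (axis_map c (line w)) = peval p1 (sval w) / peval q1 (sval w)) ->
    f0 = peval p1 (axis_coords c (cone_val e1)) / peval q1 (axis_coords c (cone_val e1)).
  move=> e1c q1c ec H; have n0 : axis_coords c (cone_val e1) != 0.
    by apply: (@nonzero_at _ _ _ 'a1); rewrite vec2_1.
  have en : line (nz n0) = node by apply/nodeP; rewrite /= vec2_0.
  by have := H (nz n0); rewrite en -ec /= => <-.
have en : cone_line e = axis_map b node.
  by rewrite -ue; congr axis_map; apply/nodeP; rewrite eu vec2_0.
have en' : cone_line e = axis_map (~~ b) node.
  by rewrite -ue'; congr axis_map; apply/nodeP; rewrite eu' vec2_0.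
have val c (p1 q1 : {mpoly k[#|'I_2|]}) : cone_val e1 (axis (~~ c)) = 0 ->
    peval q1 (axis_coords c (cone_val e1)) != 0 ->
    (forall w : nonzero k 'I_2,
      W (axis_map c (line w)) -> peval q1 (sval w) != 0 ->
      h (axis_map c (line w)) = peval p1 (sval w) / peval q1 (sval w)) ->
    h (cone_line e1) = peval p1 (axis_coords c (cone_val e1)) / peval q1 (axis_coords c (cone_val e1)).
  move=> e1c q1c H; have [u1 eu1 ue1] := on_axis e1c.
  by rewrite -eu1 -H ?ue1 ?eu1.
have [e1b|e1b] := eqVneq (cone_val e1 (axis (~~ b))) 0.
  rewrite /= (val b p q) // (node_val (~~ b) p' q') //.
  by field; rewrite qe qe' z1.
have e1Nb : cone_val e1 (axis (~~ ~~ b)) = 0 by apply: axis_of_neq0.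
rewrite /= (val (~~ b) p' q') // (node_val b p q) //; last by rewrite negbK in e1Nb.
by field; rewrite qe qe' z1.
Qed.

Lemma crossing_two_lines (m : 'I_4 -> {L | conic_locus crossing L}) :
  two_lines (C := PointedCurve X m) axis_map (fun=> node).
Proof.
have mx b u j : (cols2 (axis_vec b) (vec3 0 0 1) u) j =
    u 'a0 * axis_vec b j + u 'a1 * vec3 0 0 1 j.
  by rewrite cols2E !ffunE !scale_regular.
split.
- move=> b L L' /(congr1 sval); rewrite !axis_mapE; exact: pmap_inj.
- move=> x; have [e ->] := cone_line_surj x; have [b eb] := some_axis e.
  by have [u _ <-] := on_axis eb; exists b, (line u).
- move=> W; split=> [oW b|]; last exact: crossing_open.
  by have [H _] := axis_map_morphism b; apply: H.
- move=> W h; split=> [rW b|]; last exact: crossing_regular.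
  by have [_ H] := axis_map_morphism b; apply: H.
- move=> b L L'; have [u ->] := line_surj L; have [w ->] := line_surj L'.
  split=> [/(congr1 sval)|[-> ->]].
    rewrite !axis_mapE !pmap_line => /line_eq [c e]; rewrite !nodeP.
    have c0 := line_scale_neq0 e.
    have eb := congr1 (fun v : V => v (axis b)) e.
    have eb' := congr1 (fun v : V => v (axis (~~ b))) e.
    have sc (x : V) j : (c *: x) j = c * x j by rewrite ffunE scale_regular.
    move: eb eb'; rewrite /= !sc !mx.
    case: (b) => /=; rewrite !vec3E !(mulr0, mulr1, addr0, add0r) => e1 e2.
      by split=> //; move/esym/eqP: e1; rewrite mulf_eq0 (negPf c0) => /eqP.
    by split=> //; move/esym/eqP: e1; rewrite mulf_eq0 (negPf c0) => /eqP.
  have nv c : sval (axis_map c node) = line (nz (emark_neq0 k 'm2)).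
    rewrite axis_mapE pmap_line; apply/esym/line_eq; exists 1; rewrite scale1r /=.
    by rewrite cols2E vec2_0 vec2_1 emarkE scale0r scale1r add0r.
  have := nv b; have := nv (~~ b); case: (axis_map _ _) => L1 H1 /= e1.
  by case: (axis_map _ _) => L2 H2 /= e2; apply: eq_exist; rewrite e1 e2.
Qed.

End CrossingLines.

(** * Nodal curves as marked crossing lines *)

Section NodalCurves.
Variable k : closedFieldType.
Local Notation V := {ffun 'I_3 -> k^o}.

Lemma nodal_stable (C : pointed_curve k) psi y chi x :
  @nodal_marking k C psi y chi x -> stable C.
Proof.
move=> [[psi_inj psi_surj oC rC meet] mk_ mk_inj mk_node card2].
have neg b b' : b != b' -> b' = ~~ b by case: b b' => -[].
have nodeP b : psi b (y b) = psi (~~ b) (y (~~ b)) by apply/meet.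
have meetP b b' z z' : b != b' -> psi b z = psi b' z' -> z = y b /\ z' = y b'.
  by move=> /neg -> /meet.
exists bool, psi; split; split.
- by split=> // p; have [b [z ->]] := psi_surj p; exists b, z.
- exact: oC.
- exact: rC.
- split=> [b b' z1 z2 z3 z4 bb' /(meetP _ _ _ _ bb') [-> _] /(meetP _ _ _ _ bb') [-> _] //|].
  by move=> [] [] [] *; [constructor 1|constructor 1|constructor 3|constructor 2|constructor 2
     |constructor 3|constructor 1|constructor 1].
- have adj b b' : adjacent psi b b' = (b != b').
    rewrite /adjacent; case: eqVneq => //= bb'; apply/asboolP.
    by exists (y b), (y b'); rewrite (neg _ _ bb').
  split=> [b b'|s /andP[_ us]].
    by have [->|bb'] := eqVneq b b'; [exact: connect0|apply: connect1; rewrite adj].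
  by have := max_card (mem s); rewrite (card_uniqP us) card_bool.
- move=> i j; rewrite !mk_ => e; have [eb|bb'] := eqVneq (chi i) (chi j).
    by apply: mk_inj => //; apply: (psi_inj (chi j)); rewrite -{1}eb e.
  by have [/mk_node] := meetP _ _ _ _ bb' e.
- move=> i b z; rewrite mk_ => e [b' [z' [b'b ez]]].
  have bb' : b != b' by rewrite eq_sym.
  have [zy _] := meetP _ _ _ _ bb' ez.
  have [eb|nb] := eqVneq (chi i) b.
    by subst b; apply: (mk_node i); move/psi_inj: e => ->.
  by have [/mk_node] := meetP _ _ _ _ nb e.
- move=> b; have /cards2P [i [j [ij eij]]] : #|[set i | chi i == b]| == 2%N by rewrite card2.
  have /eqP ib : chi i == b by have := set21 i j; rewrite -eij inE.
  have /eqP jb : chi j == b by have := set22 i j; rewrite -eij inE.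
  have xij : x i <> x j.
    by move=> e; move: ij; rewrite (mk_inj i j) ?eqxx // ib jb.
  have xiy : x i <> y b by rewrite -ib; exact: mk_node.
  have xjy : x j <> y b by rewrite -jb; exact: mk_node.
  exists (fun l : 'I_3 => nth (y b) [:: y b; x i; x j] l).
    by apply: ord3P; apply: ord3P => //= e; case: (xij e) || case: (xiy e) || case: (xjy e)
      || case: (xij (esym e)) || case: (xiy (esym e)) || case: (xjy (esym e)).
  apply: ord3P => /=.
  + left; exists (~~ b), (y (~~ b)); split; last exact: nodeP.
    by case: (b).
  + by right; exists i; rewrite mk_ ib.
  + by right; exists j; rewrite mk_ jb.
Qed.

(** The first row (-v_1, v_0) of the matrix kills v; the second is whichever coordinate form makes
    the determinant nonzero. *)
Lemma move_to_node (y : P1 k) : exists2 g : P1 k -> P1 k,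
  zisomorphism (P1_space k) (P1_space k) g & g y = node k.
Proof.
have [v ->] := line_surj y.
have [v1|v1] := eqVneq (sval v 'a1) 0; last first.
  have D0 : - sval v 'a1 * 1 - sval v 'a0 * 0 != 0.
    by rewrite mulr0 subr0 mulr1 oppr_eq0.
  exists (pmap (@lker_mx2 k _ _ _ _ D0)); first exact: (pmap_proj_iso (@lker_mx2 k _ _ _ _ D0)).
  by rewrite pmap_line; apply/nodeP; rewrite /= mx2E vec2_0; ring.
have v0 : sval v 'a0 != 0.
  by apply: contra_neq (svalP v) => v0; apply: vec2P; rewrite [RHS]ffunE.
have D0 : - sval v 'a1 * 0 - sval v 'a0 * 1 != 0.
  by rewrite mulr0 sub0r mulr1 oppr_eq0.
exists (pmap (@lker_mx2 k _ _ _ _ D0)); first exact: (pmap_proj_iso (@lker_mx2 k _ _ _ _ D0)).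
by rewrite pmap_line; apply/nodeP; rewrite /= mx2E vec2_0; ring.
Qed.

Lemma nodal_conic (C : pointed_curve k) psi y chi x :
  @nodal_marking k C psi y chi x -> exists Q, pointed_iso C (conic_curve Q).
Proof.
move=> [lines mk_ _ _ _].
have gP b : exists g, zisomorphism (P1_space k) (P1_space k) g /\ g (y b) = node k.
  by have [g ig gy] := move_to_node (y b); exists g.
pose g b := sval (cid (gP b)).
have g_iso b : zisomorphism (P1_space k) (P1_space k) (g b).
  by rewrite /g; case: cid => f [].
have gy b : g b (y b) = node k by rewrite /g; case: cid => f [].
pose m i := axis_map (chi i) (g (chi i) (x i)).
pose n i := sval (cid (line_surj (sval (m i)))).
have nE i : line (n i) = sval (m i) by rewrite /n; case: cid.
have n_on i : conic_locus (sval (nz (crossing_neq0 k))) (line (n i)).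
  by rewrite nE; apply: (svalP (m i)).
pose Q := MarkedConic (conic := nz (crossing_neq0 k)) (@crossing_reduced k) n_on.
exists Q; have [f isof fE] := glue_isomorphism lines
  (@crossing_two_lines k (mark (conic_curve Q))) g_iso gy.
exists f => // i; rewrite mk_ fE -/(m i).
by have := nE i; case: (m i) => L HL /= eL; apply: eq_exist; rewrite eL.
Qed.

(* chi i is the line of the i-th mark, c i its affine coordinate, 0 or 1. *)
Lemma crossing_marked (chi c : 'I_4 -> bool) :
  (forall i j, chi i = chi j -> c i = c j -> i = j) ->
  (forall b, #|[set i | chi i == b]| = 2%N) ->
  exists Q psi y x, @nodal_marking k (conic_curve Q) psi y chi x.
Proof.
move=> c_inj card2.
have n0 i : vec2 1 (c i)%:R != 0 :> {ffun 'I_2 -> k^o}.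
  by apply: (@nonzero_at _ _ _ 'a0); rewrite vec2_0 oner_eq0.
pose x i : P1 k := line (nz (n0 i)).
pose m i := axis_map (chi i) (x i).
pose n i := sval (cid (line_surj (sval (m i)))).
have nE i : line (n i) = sval (m i) by rewrite /n; case: cid.
have n_on i : conic_locus (sval (nz (crossing_neq0 k))) (line (n i)).
  by rewrite nE; apply: (svalP (m i)).
pose Q := MarkedConic (conic := nz (crossing_neq0 k)) (@crossing_reduced k) n_on.
exists Q, (@axis_map k), (fun=> node k), x; split=> //.
- exact: crossing_two_lines.
- by move=> i; rewrite -/(m i); have := nE i; case: (m i) => L HL /= eL; apply: eq_exist; rewrite eL.
- move=> i j eb /line_eq2; rewrite /br !vec2_0 !vec2_1 mul1r mulr1 => /eqP.
  rewrite subr_eq0 => /eqP ec; apply: c_inj => //; move/eqP: ec.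
  by case: (c i) (c j) => -[] //=; rewrite ?oner_eq0 // eq_sym oner_eq0.
- by move=> i /nodeP /=; rewrite vec2_0 => /eqP; rewrite oner_eq0.
Qed.

(** [s] lists the marks of one line and [c] gives their affine coordinates. The hypotheses are
    boolean, so that a concrete distribution is checked by evaluation. *)
Lemma boundary_conic (s : seq 'I_4) (c : seq bool) :
  let chi := fun i : 'I_4 => i \in s in let c := fun i : 'I_4 => nth false c i in
  [forall i : 'I_4, forall j : 'I_4, (chi i == chi j) ==> (c i == c j) ==> (i == j)] ->
  [forall b, #|[set i | chi i == b]| == 2%N] ->
  exists Q : marked_conic k, stable (conic_curve Q) /\
    forall i j, chi i != chi j -> sep (conic_curve Q) i j.
Proof.
move=> chi c' /forallP c_inj /forallP card2.
have [Q [psi [y [x nod]]]] : exists Q psi y x,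
    @nodal_marking k (conic_curve Q) psi y chi x.
  apply: (@crossing_marked chi c') => [i j eb ec|b]; last exact/eqP.
  by have /forallP/(_ j) := c_inj i; rewrite eb ec !eqxx => /eqP.
exists Q; split; first exact: nodal_stable nod.
by move=> i j; apply: nodal_sep nod.
Qed.

End NodalCurves.

(** * Automorphisms of the projective line *)

Section Rigidity.
Variable k : closedFieldType.
Local Notation U := {ffun 'I_2 -> k^o}.

Definition locally_rational (f : k -> k) : Prop :=
  forall z, exists p q : {poly k}, q.[z] != 0 /\
    forall w, q.[w] != 0 -> f w = p.[w] / q.[w].

(** All local fractions agree after cross multiplication. In lowest terms the denominator divides
    every local one, so it has no root, and over an algebraically closed field it is constant. *)
Lemma locally_rational_poly f : locally_rational f ->
  exists p : {poly k}, forall z, f z = p.[z].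
Proof.
move=> rf; have [p [q [q0 fpq]]] := rf 0.
have q_neq0 : q != 0 by apply: contra_neq q0 => ->; rewrite horner0.
have cross p' q' : q' != 0 -> (forall w, q'.[w] != 0 -> f w = p'.[w] / q'.[w]) ->
    p * q' = p' * q.
  move=> q'0 f'; have : (p * q' - p' * q) * (q * q') = 0.
    apply: poly_fun_eq0 => w; rewrite !(hornerM, hornerD, hornerN).
    have [->|qw] := eqVneq q.[w] 0; first by rewrite !(mulr0, mul0r).
    have [->|q'w] := eqVneq q'.[w] 0; first by rewrite !(mulr0, mul0r).
    have := fpq w qw; rewrite (f' w q'w) => /eqP; rewrite eqr_div // => /eqP e.
    by rewrite e subrr mul0r.
  move/eqP; rewrite !mulf_eq0 (negPf q_neq0) (negPf q'0) !orbF subr_eq0.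
  by move/eqP.
pose d := gcdp p q; have d0 : d != 0 by rewrite gcdp_eq0 (negPf q_neq0) andbF.
have ep : p = p %/ d * d by rewrite divpK // dvdp_gcdl.
have eq : q = q %/ d * d by rewrite divpK // dvdp_gcdr.
have cop : coprimep (p %/ d) (q %/ d) by apply: coprimep_div_gcd; rewrite q_neq0 orbT.
set p1 := p %/ d in ep cop; set q1 := q %/ d in eq cop.
have cross1 p' q' : q' != 0 -> (forall w, q'.[w] != 0 -> f w = p'.[w] / q'.[w]) ->
    p1 * q' = p' * q1.
  move=> q'0 f'; apply: (mulIf d0); rewrite -mulrA [q' * d]mulrC mulrA -ep.
  by rewrite -mulrA -eq; apply: cross.
have nzq z (q' : {poly k}) : q'.[z] != 0 -> q' != 0.
  by apply: contra_neq => ->; rewrite horner0.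
have q1_no_root z : q1.[z] != 0.
  apply/negP => q1z; have [p' [q' [q'z f']]] := rf z.
  have /(congr1 (fun r => r.[z])) := cross1 p' q' (nzq _ _ q'z) f'.
  rewrite !hornerM (eqP q1z) mulr0 => /eqP; rewrite mulf_eq0 (negPf q'z) orbF => p1z.
  by have := coprimep_root cop p1z; rewrite q1z.
have /size_poly1P [c c0 eq1] : size q1 == 1%N.
  by apply/negPn/negP => /closed_rootP [z]; rewrite /root (negPf (q1_no_root z)).
exists (c^-1 *: p1) => z; have [p' [q' [q'z f']]] := rf z.
have /(congr1 (fun r => r.[z])) := cross1 p' q' (nzq _ _ q'z) f'.
rewrite (f' z q'z) eq1 !hornerE => e; apply: (mulIf c0).
by rewrite mulrAC -e; field; rewrite c0 q'z.
Qed.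

Lemma dehomogenize2 (a : {mpoly k[#|'I_2|]}) :
  exists p : {poly k}, forall z, peval a (vec2 z 1) = p.[z].
Proof.
elim/(@mpoly_varind k 'I_2): a => [c|i|a b [p ep] [q eq]|a b [p ep] [q eq]].
- by exists c%:P => z; rewrite pevalC hornerC.
- move: i; apply: ord2P.
    by exists 'X => z; rewrite peval_var vec2_0 hornerX.
  by exists 1 => z; rewrite peval_var vec2_1 hornerE.
- by exists (p + q) => z; rewrite pevalD hornerD ep eq.
- by exists (p * q) => z; rewrite pevalM hornerM ep eq.
Qed.

Lemma aff_neq0 z : vec2 z 1 != 0 :> U.
Proof. by apply: (@nonzero_at _ _ _ 'a1); rewrite vec2_1 oner_eq0. Qed.

Lemma infty_neq0 : vec2 1 0 != 0 :> U.
Proof. by apply: (@nonzero_at _ _ _ 'a0); rewrite vec2_0 oner_eq0. Qed.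

Definition aff (z : k) : P1 k := line (nz (aff_neq0 z)).
Definition infty : P1 k := line (nz infty_neq0).

Definition coord (L : P1 k) : k :=
  let u := sval (cid (line_surj L)) in sval u 'a0 / sval u 'a1.

Lemma coord_line (u : nonzero k 'I_2) : coord (line u) = sval u 'a0 / sval u 'a1.
Proof.
rewrite /coord; case: cid => w /= /line_eq [c e]; have c0 := line_scale_neq0 e.
rewrite e !ffunE !scale_regular invfM.
by rewrite mulrACA divff ?mul1r.
Qed.

Lemma coord_aff z : coord (aff z) = z.
Proof. by rewrite coord_line /= vec2_0 vec2_1 divr1. Qed.

Lemma line_infty (u : nonzero k 'I_2) : line u = infty <-> sval u 'a1 = 0.
Proof.
rewrite line_eq2 /br /= vec2_0 vec2_1 mulr0 mulr1 sub0r.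
by split=> [/eqP|->]; rewrite ?oppr0 // oppr_eq0 => /eqP.
Qed.

Lemma aff_coord L : L <> infty -> aff (coord L) = L.
Proof.
have [u ->] := line_surj L => /line_infty /eqP u1.
apply/line_eq2; rewrite /= coord_line /br vec2_0 vec2_1 mul1r divfK ?subrr //.
Qed.

Lemma aff_neq_infty z : aff z <> infty.
Proof. by move/line_infty => /=; rewrite vec2_1 => /eqP; rewrite oner_eq0. Qed.

Lemma coord_regular : zregular (P1_space k) (fun L => L <> infty) coord.
Proof.
have oI : zopen (P1_space k) (fun L => L <> infty) by exact: P1_open_compl.
apply/(presented_regular (presented_proj k 'I_2)); split.
  exact/(presented_open (presented_proj k 'I_2)).
move=> u /line_infty /eqP u1; exists (pvar k 'a0), (pvar k 'a1).
by rewrite peval_var; split=> // w _ _; rewrite /= coord_line !peval_var.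
Qed.

(** [f] preserves the affine line, so [coord] composed with [f] is a locally rational function on
    all of it, hence a polynomial. *)
Lemma morphism_fixing_infty (f : P1 k -> P1 k) :
  zmorphism (P1_space k) (P1_space k) f -> (forall L, L <> infty -> f L <> infty) ->
  exists p : {poly k}, forall z, f (aff z) = aff p.[z].
Proof.
move=> [_ rf] f_infty.
have /(presented_regular (presented_proj k 'I_2)) [_ H] := rf _ _ coord_regular.
have [|p ep] := @locally_rational_poly (fun z => coord (f (aff z))).
  move=> z; have [|a [b [bz ab]]] := H (nz (aff_neq0 z)).
    by apply: f_infty; apply: aff_neq_infty.
  have [p ep] := dehomogenize2 a; have [q eq] := dehomogenize2 b.
  exists p, q; rewrite -eq; split=> // w; rewrite -eq -ep => bw.
  apply: (ab (nz (aff_neq0 w))) => //.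
  by apply: f_infty; apply: aff_neq_infty.
by exists p => z; rewrite -ep aff_coord //; apply: f_infty; apply: aff_neq_infty.
Qed.

(* On the affine line f and its inverse are polynomials, so their degrees are 1:
   the inverse matters, since Frobenius is a bijective morphism. *)
Lemma P1_rigid (f : P1 k -> P1 k) : zisomorphism (P1_space k) (P1_space k) f ->
  f infty = infty -> f (aff 0) = aff 0 -> f (aff 1) = aff 1 -> forall L, f L = L.
Proof.
move=> [g [fg gf mf mg]] f_oo f0 f1.
have g_oo : g infty = infty by rewrite -{1}f_oo fg.
have [|p ep] := morphism_fixing_infty mf.
  by move=> L H e; apply: H; rewrite -(fg L) e g_oo.
have [|q eq] := morphism_fixing_infty mg.
  by move=> L H e; apply: H; rewrite -(gf L) e f_oo.
have aff_inj : injective aff := can_inj coord_aff.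
have pq : p \Po q = 'X.
  apply/eqP; rewrite -subr_eq0; apply/eqP/poly_fun_eq0 => z.
  rewrite !hornerE horner_comp; apply/eqP; rewrite subr_eq0; apply/eqP/aff_inj.
  by rewrite -ep -eq gf.
have p0 : p.[0] = 0 by apply: aff_inj; rewrite -ep.
have p1 : p.[1] = 1 by apply: aff_inj; rewrite -ep.
have size_p : (size p <= 2)%N.
  have := size_comp_poly p q; rewrite pq size_polyX /= => /esym/eqP.
  by rewrite muln_eq1 => /andP[/eqP e _]; case: (size p) e => // n /= ->.
have pX z : p.[z] = z.
  move: p0 p1; rewrite !(horner_coef_wide _ size_p) !big_ord_recl !big_ord0 /=.
  rewrite !expr0 !expr1 !mulr1 !addr0 mulr0 addr0 => p0; rewrite p0 !add0r => ->.
  by rewrite mul1r.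
move=> L; have [->//|H] := pselect (L = infty).
by rewrite -(aff_coord H) ep pX.
Qed.

(** With the first three points of both configurations moved to infinity, 0 and 1, the isomorphism
    becomes the identity, so the fourth points agree as well; linear maps multiply all brackets by
    one constant and preserve the cross-ratio. *)
Lemma config_iso_cr (A B : coords k) : injective (points A) -> injective (points B) ->
  pointed_iso (config_curve (points A)) (config_curve (points B)) ->
  cr_num A * cr_den B = cr_den A * cr_num B.
Proof.
move=> A_inj B_inj [f isof fm].
have HA := (points_inj A).1 A_inj; have HB := (points_inj B).1 B_inj.
have o0 : br (vec2 1 0) (vec2 0 1) != 0 :> k.
  by rewrite /br !vec2_0 !vec2_1 mul0r mul1r subr0 oner_eq0.
have o1 : br (vec2 1 0) (vec2 1 1) != 0 :> k.
  by rewrite /br !vec2_0 !vec2_1 mul0r mul1r subr0 oner_eq0.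
have z1 : br (vec2 0 1) (vec2 1 1) != 0 :> k.
  by rewrite /br !vec2_0 !vec2_1 mul0r mul1r sub0r oppr_eq0 oner_eq0.
have norm (C : coords k) : (forall i j, i != j -> brc C i j != 0) ->
    exists g : 'End(U), exists g0 : lker g == 0%VS,
    [/\ pmap g0 (points C 'm0) = infty, pmap g0 (points C 'm1) = aff 0 &
        pmap g0 (points C 'm2) = aff 1].
  move=> HC; have [g [g0 e0 e1 e2 _]] := three_transitive
    (HC 'm0 'm1 isT) (HC 'm0 'm2 isT) (HC 'm1 'm2 isT) o0 o1 z1.
  by exists g, g0; split; rewrite pmap_line; apply/line_eq2.
have [g [g0 [gA0 gA1 gA2]]] := norm A HA; have [h [h0 [hB0 hB1 hB2]]] := norm B HB.
have [g' [gg' g'g mg mg']] := pmap_proj_iso g0.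
have isog' : zisomorphism (P1_space k) (P1_space k) g' by exists (pmap g0).
pose F := pmap h0 \o f \o g'.
have isoF : zisomorphism (P1_space k) (P1_space k) F.
  by apply: zisomorphism_comp (pmap_proj_iso h0); apply: zisomorphism_comp isof.
have FE i : F (pmap g0 (points A i)) = pmap h0 (points B i).
  by rewrite /F /= gg'; congr pmap; apply: fm.
have Fid : forall L, F L = L.
  apply: P1_rigid => //.
  - by rewrite -{1}gA0 FE.
  - by rewrite -{1}gA1 FE.
  - by rewrite -{1}gA2 FE.
have lineE i : line (nzmap g0 (A i)) = line (nzmap h0 (B i)).
  by rewrite -!pmap_line -[LHS]Fid FE.
have [c c0 [en ed]] := cr_scaled lineE.
have [D D0 brg] := linear2_br g0; have [D' D'0 brh] := linear2_br h0.
move: en ed; rewrite /cr_num /cr_den /brc /= !brg !brh => en ed.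
apply: (mulfI (mulf_neq0 D'0 D'0)); apply: (mulfI c0).
transitivity (c * (br (sval (A 'm0)) (sval (A 'm1)) * br (sval (A 'm2)) (sval (A 'm3))) *
  (D' * br (sval (B 'm0)) (sval (B 'm2)) * (D' * br (sval (B 'm1)) (sval (B 'm3))))).
  by ring.
rewrite ed; transitivity (c * (br (sval (A 'm0)) (sval (A 'm2)) * br (sval (A 'm1)) (sval (A 'm3))) *
  (D' * br (sval (B 'm0)) (sval (B 'm1)) * (D' * br (sval (B 'm2)) (sval (B 'm3))))); last by ring.
by rewrite en; ring.
Qed.

End Rigidity.

(** * The cross-ratio map *)

Section ModuliOfConics.
Variable k : closedFieldType.
Implicit Types Q : marked_conic k.

Lemma marked_conic_eq Q Q' :
  conic Q = conic Q' -> conic_mark Q = conic_mark Q' -> Q = Q'.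
Proof.
case: Q Q' => [c r m mP] [c' r' m' mP'] /= ec em; subst c' m'.
by rewrite (Prop_irrelevance r r') (Prop_irrelevance mP mP').
Qed.

Lemma in_pencil_eq Q Q' a b : in_pencil Q a b -> in_pencil Q' a b -> Q = Q'.
Proof.
move=> [c m] [c' m']; apply: marked_conic_eq; first by apply: val_inj; rewrite /= c c'.
by apply/funext => i; apply: val_inj; rewrite /= -/(mk Q i) -/(mk Q' i) m m'.
Qed.

Lemma in_pencil_num_den Q a b : in_pencil Q a b -> conic_num Q = a /\ conic_den Q = b.
Proof.
move=> [cQ mQ]; rewrite /conic_num /conic_den !mQ cQ !emarkE /det3 /polar.
by rewrite !vec3E !ffunE /=; split; ring.
Qed.

(** The points are infinity, 0, 1 and (-b : a - b), the last one solved from [01][23] = a and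
    [02][13] = b. *)
Lemma config_of_cr (a b : k) : a != 0 -> b != 0 -> a != b ->
  exists A : coords k, [/\ injective (points A), cr_num A = a & cr_den A = b].
Proof.
move=> a0 b0 ab.
have n0 : vec2 1 0 != 0 :> {ffun 'I_2 -> k^o}.
  by apply: (@nonzero_at _ _ _ 'a0); rewrite vec2_0 oner_eq0.
have n1 : vec2 0 1 != 0 :> {ffun 'I_2 -> k^o}.
  by apply: (@nonzero_at _ _ _ 'a1); rewrite vec2_1 oner_eq0.
have n2 : vec2 1 1 != 0 :> {ffun 'I_2 -> k^o}.
  by apply: (@nonzero_at _ _ _ 'a1); rewrite vec2_1 oner_eq0.
have n3 : vec2 (- b) (a - b) != 0 :> {ffun 'I_2 -> k^o}.
  by apply: (@nonzero_at _ _ _ 'a0); rewrite vec2_0 oppr_eq0.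
pose A : coords k := fun i => nth (nz n3) [:: nz n0; nz n1; nz n2] i.
exists A; split; last 2 first.
- by rewrite /cr_num /brc /br /= !vec2_0 !vec2_1; ring.
- by rewrite /cr_den /brc /br /= !vec2_0 !vec2_1; ring.
apply/points_inj_all_brp; rewrite !pevalM !peval_brp !pt4_flat /br /= !vec2_0 !vec2_1.
rewrite !(mul0r, mul1r, mulr0, mulr1, subr0, sub0r, oppr0, mulN1r, opprK).
rewrite !mulf_neq0 ?oppr_eq0 ?oner_eq0 ?subr_eq0 //.
by rewrite subrK.
Qed.

(** A configuration of parameters (a, b) is embedded as a Veronese conic, normalized and rescaled:
    it ends in the pencil at the same (a, b), and [Q] is the only such marked conic. *)
Lemma generic_pencil Q a b : in_pencil Q a b -> a != 0 -> b != 0 -> a != b ->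
  exists A : coords k, [/\ injective (points A), cr_num A = a, cr_den A = b &
    pointed_iso (config_curve (points A)) (conic_curve Q)].
Proof.
move=> Qab a0 b0 ab; have [A [A_inj en ed]] := config_of_cr a0 b0 ab.
exists A; split=> //; have [Q1 [sQ1 iso1 [t t0 [n1 d1]]]] := config_conic A_inj.
have [Q2 [d [d0 Q2p iso2]]] := normal_form sQ1.
rewrite n1 d1 en ed !mulrA in Q2p; have dt0 : d * t != 0 by rewrite mulf_neq0.
have [Q3 Q3p iso3] := in_pencil_scale (invr_neq0 dt0) Q2p.
rewrite !mulKf // in Q3p.
rewrite (in_pencil_eq Qab Q3p); apply: pointed_iso_trans iso1 _.
exact: pointed_iso_sym (pointed_iso_trans iso3 iso2).
Qed.

(* The separation pattern tells the three nodal members of the pencil from each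
   other and from the smooth ones. *)
Variant pencil_type Q a b : Prop :=
| PencilNum of a = 0 & sep (conic_curve Q) 'm0 'm2 & sep (conic_curve Q) 'm0 'm3
    & ~ sep (conic_curve Q) 'm0 'm1
| PencilDen of b = 0 & sep (conic_curve Q) 'm0 'm1 & sep (conic_curve Q) 'm0 'm3
    & ~ sep (conic_curve Q) 'm0 'm2
| PencilEq of a = b & sep (conic_curve Q) 'm0 'm1 & sep (conic_curve Q) 'm0 'm2
    & ~ sep (conic_curve Q) 'm0 'm3
| PencilGeneric A of injective (points A) & cr_num A = a & cr_den A = b
    & pointed_iso (config_curve (points A)) (conic_curve Q)
    & (forall i j, ~ sep (conic_curve Q) i j).

Lemma pencilP Q a b : in_pencil Q a b -> pencil_type Q a b.
Proof.
move=> Qab; have [a0|a0] := eqVneq a 0.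
  by have [] := pencil_sep_num Qab a0; constructor 1.
have [b0|b0] := eqVneq b 0.
  by have [] := pencil_sep_den Qab b0; constructor 2.
have [ab|ab] := eqVneq a b.
  by have [] := pencil_sep_eq Qab ab; constructor 3.
have [A [A_inj en ed iso]] := generic_pencil Qab a0 b0 ab.
apply: (PencilGeneric A_inj en ed iso) => i j.
exact: config_not_separated iso.
Qed.

Lemma pencil_unique Q a b Q' a' b' : in_pencil Q a b -> in_pencil Q' a' b' ->
  pointed_iso (conic_curve Q) (conic_curve Q') -> a * b' = b * a'.
Proof.
move=> /pencilP Qt /pencilP Qt' iso.
have s i j := sep_iso (i := i) (j := j) iso.
have s' i j := sep_iso (i := i) (j := j) (pointed_iso_sym iso).
(* Members of different types disagree on the separation of mark 0 from another mark. Among equal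
   types only the generic one is not immediate; it is settled by rigidity. *)
case: Qt => [-> /s s1 /s s2 _|-> /s s1 /s s2 _|-> /s s1 /s s2 _|A A_inj <- <- isoA nsep];
  case: Qt' => [-> /s' t1 /s' t2 n|-> /s' t1 /s' t2 n|-> /s' t1 /s' t2 n|B B_inj <- <- isoB nsep'];
  rewrite ?(mulr0, mul0r) //;
  try by [case: (n s1)|case: (n s2)|case: (nsep' _ _ s1)|case: (nsep _ _ t1)].
apply: config_iso_cr => //; apply: pointed_iso_trans isoA _.
exact: pointed_iso_trans iso (pointed_iso_sym isoB).
Qed.

Lemma conic_unique Q Q' : stable (conic_curve Q) -> stable (conic_curve Q') ->
  pointed_iso (conic_curve Q) (conic_curve Q') ->
  conic_num Q * conic_den Q' = conic_den Q * conic_num Q'.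
Proof.
move=> /normal_form [Q1 [d [d0 Q1p iso1]]] /normal_form [Q1' [d' [d'0 Q1p' iso1']]] iso.
have /(pencil_unique Q1p Q1p') : pointed_iso (conic_curve Q1) (conic_curve Q1').
  exact: pointed_iso_trans iso1 (pointed_iso_trans iso (pointed_iso_sym iso1')).
rewrite mulrACA [in RHS]mulrACA; apply: mulfI; exact: mulf_neq0.
Qed.

Lemma conic_num_den_neq0 Q : stable (conic_curve Q) ->
  (conic_num Q != 0) || (conic_den Q != 0).
Proof.
move=> /normal_form [Q1 [d [d0 Q1p _]]]; have := pencil_neq0 Q1p.
by rewrite !mulf_eq0 (negPf d0).
Qed.

Lemma conic_num_den_iso Q Q' : stable (conic_curve Q) -> stable (conic_curve Q') ->
  conic_num Q * conic_den Q' = conic_den Q * conic_num Q' ->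
  pointed_iso (conic_curve Q) (conic_curve Q').
Proof.
move=> sQ sQ' e; have nz' := conic_num_den_neq0 sQ'; have nz := conic_num_den_neq0 sQ.
have [t et] : exists t, conic_num Q' = t * conic_num Q /\ conic_den Q' = t * conic_den Q.
  have [n0|n0] := eqVneq (conic_num Q) 0.
    have d0 : conic_den Q != 0 by move: nz; rewrite n0 eqxx.
    exists (conic_den Q' / conic_den Q); rewrite divfK // n0 mulr0; split=> //.
    by apply: (mulfI d0); rewrite mulr0 -e n0 mul0r.
  exists (conic_num Q' / conic_num Q); rewrite divfK //; split=> //.
  by apply: (mulfI n0); rewrite e; field.
have t0 : t != 0.
  by apply: contraTneq nz' => t0; rewrite et.1 et.2 t0 !mul0r eqxx.
have [Q1 [d [d0 Q1p iso1]]] := normal_form sQ.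
have [Q1' [d' [d'0 Q1p' iso1']]] := normal_form sQ'.
have s0 : d' * t / d != 0 by rewrite !mulf_neq0 ?invr_eq0.
have [Q2 Q2p iso2] := in_pencil_scale s0 Q1p.
have eQ : Q2 = Q1'.
  apply: in_pencil_eq Q1p'; rewrite et.1 et.2.
  have E (x : k) : d' * (t * x) = d' * t / d * (d * x) by field.
  by rewrite !E.
apply: pointed_iso_trans (pointed_iso_sym iso1) _.
by apply: pointed_iso_trans (pointed_iso_sym iso2) _; rewrite eQ.
Qed.

(** A stable conic with the right ratio suffices, by normalization and rescaling. On the boundary it
    is a pair of crossing lines, whose ratio is not computed but recognized through [pencilP] from
    the separation of its marks. *)
Lemma stable_pencil a b : (a != 0) || (b != 0) ->
  exists Q, in_pencil Q a b /\ stable (conic_curve Q).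
Proof.
move=> ab0.
suff [Q [sQ e]] : exists Q, stable (conic_curve Q) /\ conic_num Q * b = conic_den Q * a.
  have [Q1 [d [d0 Q1p iso1]]] := normal_form sQ.
  have nz := conic_num_den_neq0 sQ.
  have [t [ea eb]] : exists t, a = t * (d * conic_num Q) /\ b = t * (d * conic_den Q).
    have [n0|n0] := eqVneq (conic_num Q) 0.
      have den0 : conic_den Q != 0 by move: nz; rewrite n0 eqxx.
      exists (b / (d * conic_den Q)); split; last by field; rewrite den0 d0.
      by apply: (mulfI den0); rewrite -e n0 !(mulr0, mul0r).
    exists (a / (d * conic_num Q)); split; first by field; rewrite n0 d0.
    by apply: (mulfI n0); rewrite e; field; rewrite n0 d0.
  have t0 : t != 0 by apply: contraTneq ab0 => t0; rewrite ea eb t0 !mul0r eqxx.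
  have [Q2 Q2p iso2] := in_pencil_scale t0 Q1p.
  exists Q2; rewrite {1}ea {1}eb; split=> //.
  exact: stable_iso (pointed_iso_sym (pointed_iso_trans iso2 iso1)) sQ.
have bd (s : seq 'I_4) (c : seq bool) (H : forall Q, (forall i j : 'I_4,
      (i \in s) != (j \in s) -> sep (conic_curve Q) i j) ->
      forall a' b', in_pencil Q a' b' -> a' * b = b' * a) :
    (exists Q : marked_conic k, stable (conic_curve Q) /\
      forall i j : 'I_4, (i \in s) != (j \in s) -> sep (conic_curve Q) i j) ->
    exists Q, stable (conic_curve Q) /\ conic_num Q * b = conic_den Q * a.
  move=> [Q [sQ sepQ]]; exists Q; split=> //.
  have [Q1 [d [d0 Q1p iso1]]] := normal_form sQ.
  have sep1 (i j : 'I_4) : (i \in s) != (j \in s) -> sep (conic_curve Q1) i j.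
    by move=> /sepQ; apply: sep_iso (pointed_iso_sym iso1).
  apply: (mulfI d0); have := H Q1 sep1 _ _ Q1p; rewrite -(mulrA d (conic_num Q)) => ->.
  exact: esym (mulrA _ _ _).
have all4 (P : pred 'I_4) : [&& P 'm0, P 'm1, P 'm2 & P 'm3] -> [forall i, P i].
  by move=> /and4P[? ? ? ?]; apply/forallP; apply: ord4P.
have card4 (s : seq 'I_4) (b' : bool) : uniq s -> size s = 2%N ->
    #|[set i | (i \in s) == b']| == 2%N.
  move=> us ss; have cs : #|[set i in s]| = 2%N by rewrite cardsE (card_uniqP us).
  case: b'; first by apply/eqP; apply: etrans cs; apply: eq_card => i; rewrite !inE eqb_id.
  have cC := cardsC [set i in s]; rewrite cs card_ord in cC.
  have /eqP : (2 + #|~: [set i in s]| = 2 + 2)%N by [].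
  rewrite eqn_add2l => /eqP e; apply/eqP; apply: etrans e; apply: eq_card => i.
  by rewrite !inE eqbF_neg.
have [a0|a0] := eqVneq a 0.
  (* For a = 0 marks 0 and 1 share a line. The booleans are affine coordinates, distinct for the two
     marks of each line. *)
  apply: (bd [:: 'm0; 'm1] [:: false; true; false; true]) => [Q sQ a' b' /pencilP|].
    by rewrite a0 mulr0; case=> [->|_ _ _ []|_ _ _ []|A _ _ _ _ /(_ 'm0 'm2) []];
      rewrite ?mul0r //; apply: sQ.
  apply: (@boundary_conic k _ [:: false; true; false; true]).
    by do 2!(apply: (all4 _); apply/and4P; split) => //.
  by apply/forallP => b'; apply: card4.
have [b0|b0] := eqVneq b 0.
  apply: (bd [:: 'm0; 'm2] [:: false; false; true; true]) => [Q sQ a' b' /pencilP|].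
    by rewrite b0 mulr0; case=> [_ _ _ []|->|_ _ _ []|A _ _ _ _ /(_ 'm0 'm1) []];
      rewrite ?mul0r //; apply: sQ.
  apply: (@boundary_conic k _ [:: false; false; true; true]).
    by do 2!(apply: (all4 _); apply/and4P; split) => //.
  by apply/forallP => b'; apply: card4.
have [ab|ab] := eqVneq a b.
  apply: (bd [:: 'm0; 'm3] [:: false; false; true; true]) => [Q sQ a' b' /pencilP|].
    by rewrite ab; case=> [_ _ _ []|_ _ _ []|->|A _ _ _ _ /(_ 'm0 'm1) []];
      rewrite ?mul0r //; apply: sQ.
  apply: (@boundary_conic k _ [:: false; false; true; true]).
    by do 2!(apply: (all4 _); apply/and4P; split) => //.
  by apply/forallP => b'; apply: card4.
have [A [A_inj en ed]] := config_of_cr a0 b0 ab.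
have [Q [sQ _ [t _ [n d]]]] := config_conic A_inj; exists Q; split=> //.
by rewrite n d en ed; ring.
Qed.

Lemma stable_is_conic (C : pointed_curve k) : stable C ->
  exists Q, stable (conic_curve Q) /\ pointed_iso C (conic_curve Q).
Proof.
move=> sC; have [[x x_inj iso]|[psi [y [chi [x nod]]]]] := stable_smooth_or_nodal sC.
  have [A ex] := points_surj x; subst x.
  have [Q [sQ isoQ _]] := config_conic x_inj; exists Q; split=> //.
  exact: pointed_iso_trans (pointed_iso_sym iso) isoQ.
have [Q iso] := nodal_conic nod; exists Q; split=> //.
exact: stable_iso iso sC.
Qed.

End ModuliOfConics.

(** * The map to P^15, its image and the two quotients *)

Section CrossRatioMap.
Variable k : closedFieldType.
Implicit Types (Q : stable_conic k) (m : Mbar04 k) (h : P15 k).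

Definition conic_cr Q : P15 k := cr_point (conic_num_den_neq0 (svalP Q)).

Lemma moduli_conic m : exists Q : stable_conic k, m = moduli_pt (svalP Q).
Proof.
case: m => m mP; have [C sC em] := mP; subst m.
have [Q [sQ iso]] := stable_is_conic sC.
exists (exist (fun Q : marked_conic k => stable (conic_curve Q)) Q sQ).
apply: eq_exist; exact/iso_class_eq.
Qed.

Definition cr_map m : P15 k := conic_cr (sval (cid (moduli_conic m))).

Lemma cr_map_conic Q : cr_map (moduli_pt (svalP Q)) = conic_cr Q.
Proof.
rewrite /cr_map; case: cid => Q' /= e; apply/cr_point_eq.
apply: (conic_unique (svalP Q') (svalP Q)).
exact: (moduli_pt_eq (svalP Q') (svalP Q)).1 (esym e).
Qed.

Lemma cr_map_inj : injective cr_map.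
Proof.
move=> m m'; have [Q ->] := moduli_conic m; have [Q' ->] := moduli_conic m'.
rewrite !cr_map_conic => /cr_point_eq e; apply/moduli_pt_eq.
exact: conic_num_den_iso (svalP Q) (svalP Q') e.
Qed.

Lemma cr_point_scale (a b a' b' t : k) ab ab' : a' = t * a -> b' = t * b ->
  @cr_point k a' b' ab' = @cr_point k a b ab.
Proof. by move=> ea eb; apply/cr_point_eq; rewrite ea eb; ring. Qed.

Lemma cr_map_config (A : coords k) (A_inj : injective (points A))
    (ab : (cr_num A != 0) || (cr_den A != 0)) :
  cr_map (of_config A_inj) = cr_point ab.
Proof.
have [Q [sQ iso [t t0 [en ed]]]] := config_conic A_inj.
pose Qs : stable_conic k := exist (fun Q : marked_conic k => stable (conic_curve Q)) Q sQ.
have -> : of_config A_inj = moduli_pt (svalP Qs) by apply/moduli_pt_eq.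
by rewrite cr_map_conic; apply: cr_point_scale en ed.
Qed.

Lemma cr_map_point a b (ab : (a != 0) || (b != 0)) :
  exists Q : stable_conic k, in_pencil (sval Q) a b /\
    cr_map (moduli_pt (svalP Q)) = cr_point ab.
Proof.
have [Q [Qab sQ]] := stable_pencil ab.
exists (exist (fun Q : marked_conic k => stable (conic_curve Q)) Q sQ); split=> //.
rewrite cr_map_conic; have [en ed] := in_pencil_num_den Qab.
by apply: (@cr_point_scale _ _ _ _ 1); rewrite mul1r.
Qed.

Definition coef_num (c : {ffun monos -> k^o}) : k := - c (mono4 ('a0, 'a0, 'a1, 'a1)).
Definition coef_den (c : {ffun monos -> k^o}) : k := c (mono4 ('a0, 'a1, 'a0, 'a1)).

Lemma coef_cr (a b : k) : coef_num (cr_coef a b) = a /\ coef_den (cr_coef a b) = b.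
Proof.
rewrite /coef_num /coef_den !ffunE /sgn2 /=.
by split; ring.
Qed.

Lemma image_cr_map h : image_of cr_map h <->
  exists a b (ab : (a != 0) || (b != 0)), h = @cr_point k a b ab.
Proof.
split=> [[m <-]|[a [b [ab ->]]]].
  have [Q ->] := moduli_conic m; rewrite cr_map_conic.
  by exists (conic_num (sval Q)), (conic_den (sval Q)), (conic_num_den_neq0 (svalP Q)).
by have [Q [_ e]] := cr_map_point ab; exists (moduli_pt (svalP Q)).
Qed.

(** Membership in the image is a system of linear equations: all coefficients are prescribed by the
    two from which a and b are read. *)
Lemma image_cr_line (v : nonzero k monos) : image_of cr_map (line v) <->
  sval v = cr_coef (coef_num (sval v)) (coef_den (sval v)).
Proof.
split=> [/image_cr_map [a [b [ab /esym/line_eq [t e]]]]|e].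
  rewrite e /= -cr_coefZ.
  by have [en ed] := coef_cr (t * a) (t * b); rewrite en ed.
have ab : (coef_num (sval v) != 0) || (coef_den (sval v) != 0).
  apply: contraT; rewrite negb_or !negbK => /andP[/eqP n0 /eqP d0].
  case/eqP: (svalP v); rewrite e n0 d0.
  by apply/ffunP => s; rewrite !ffunE !mul0r subrr.
apply/image_cr_map; exists _, _, ab; congr line; exact: val_inj.
Qed.

Local Notation Vars := (mono2 + 'I_4 * 'I_3)%type.
Local Notation mpolyV := {mpoly k[#|{: Vars}|]}.

Definition cvar (ij : mono2) : mpolyV := pvar k (inl ij : Vars).
Definition mvar (i : 'I_4) (j : 'I_3) : mpolyV := pvar k (inr (i, j) : Vars).

Definition det3_poly (i j l : 'I_4) : mpolyV :=
  mvar i 'c0 * (mvar j 'c1 * mvar l 'c2 - mvar j 'c2 * mvar l 'c1)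
  - mvar i 'c1 * (mvar j 'c0 * mvar l 'c2 - mvar j 'c2 * mvar l 'c0)
  + mvar i 'c2 * (mvar j 'c0 * mvar l 'c1 - mvar j 'c1 * mvar l 'c0).

Definition polar_poly (i j : 'I_4) : mpolyV :=
  cvar q00 * (2%:R *: mvar i 'c0 * mvar j 'c0)
  + cvar q01 * (mvar i 'c0 * mvar j 'c1 + mvar i 'c1 * mvar j 'c0)
  + cvar q02 * (mvar i 'c0 * mvar j 'c2 + mvar i 'c2 * mvar j 'c0)
  + cvar q11 * (2%:R *: mvar i 'c1 * mvar j 'c1)
  + cvar q12 * (mvar i 'c1 * mvar j 'c2 + mvar i 'c2 * mvar j 'c1)
  + cvar q22 * (2%:R *: mvar i 'c2 * mvar j 'c2).

Definition num_poly : mpolyV := det3_poly 'm0 'm1 'm3 * polar_poly 'm2 'm3.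
Definition den_poly : mpolyV := det3_poly 'm0 'm2 'm3 * polar_poly 'm1 'm3.

Lemma peval_num_den Q : peval num_poly (conic_coords Q) = conic_num (sval Q) /\
  peval den_poly (conic_coords Q) = conic_den (sval Q).
Proof.
have cE ij : peval (cvar ij) (conic_coords Q) = sval (conic (sval Q)) ij.
  by rewrite peval_var ffunE.
have mE i j : peval (mvar i j) (conic_coords Q) = mk (sval Q) i j.
  by rewrite peval_var ffunE.
have dE i j l : peval (det3_poly i j l) (conic_coords Q) =
    det3 (mk (sval Q) i) (mk (sval Q) j) (mk (sval Q) l).
  by rewrite /det3_poly !(pevalD, pevalN, pevalM) !mE.
have pE i j : peval (polar_poly i j) (conic_coords Q) =
    polar (sval (conic (sval Q))) (mk (sval Q) i) (mk (sval Q) j).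
  by rewrite /polar_poly !(pevalD, pevalM, pevalZ) !mE !cE /polar.
by rewrite !pevalM !dE !pE.
Qed.

Definition coef_poly (s : monos) : mpolyV :=
  (sgn2 k (s 'm0) (s 'm1) * sgn2 k (s 'm2) (s 'm3)) *: den_poly -
  (sgn2 k (s 'm0) (s 'm2) * sgn2 k (s 'm1) (s 'm3)) *: num_poly.

Lemma peval_coef_poly Q s : peval (coef_poly s) (conic_coords Q) =
  cr_coef (conic_num (sval Q)) (conic_den (sval Q)) s.
Proof.
rewrite pevalB !pevalZ; have [-> ->] := peval_num_den Q; rewrite ffunE.
by ring.
Qed.

Lemma presented_Mbar04 :
  presented (Mbar04_space k) (fun Q => moduli_pt (svalP Q)) (@conic_coords k).
Proof. exact: presented_coinduced. Qed.

Lemma cr_map_morphism : zmorphism (Mbar04_space k) (P15_space k) cr_map.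
Proof.
apply: (poly_lift_morphism presented_Mbar04 (presented_proj k monos)).
move=> Q; exists 1, coef_poly; rewrite peval1 oner_eq0; split=> // Q' _.
exists (cr_vec (conic_num_den_neq0 (svalP Q'))); rewrite cr_map_conic; split=> // s.
by rewrite peval_coef_poly.
Qed.

(** The inverse sends a point of the image to the member of the pencil with marks [emark], whose
    coordinates are linear or constant in the coefficients of the form. *)
Lemma cr_map_iso : iso_onto_image (Mbar04_space k) (P15_space k) cr_map.
Proof.
apply: (poly_lift_isomorphism presented_Mbar04 (presented_subspace (image_of cr_map))).
- by move=> m m' /(congr1 sval) /cr_map_inj.
- exact: cone_line_surj.
- move=> Q; exists 1, coef_poly; rewrite peval1 oner_eq0; split=> // Q' _.
  have im : image_of cr_map (line (cr_vec (conic_num_den_neq0 (svalP Q')))).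
    by exists (moduli_pt (svalP Q')); rewrite cr_map_conic.
  exists (exist (fun v => image_of cr_map (line v)) _ im); split.
    by apply: eq_exist; rewrite cr_map_conic.
  by move=> s; rewrite peval_coef_poly.
- move=> e.
  have [a aE] : exists a : {mpoly k[#|{: monos}|]}, forall c, peval a c = coef_num c.
    by exists (- pvar k (mono4 ('a0, 'a0, 'a1, 'a1))) => c; rewrite pevalN peval_var.
  have [b bE] : exists b : {mpoly k[#|{: monos}|]}, forall c, peval b c = coef_den c.
    by exists (pvar k (mono4 ('a0, 'a1, 'a0, 'a1))) => c; rewrite peval_var.
  pose P (z : Vars) : {mpoly k[#|{: monos}|]} := match z with
    | inl ij => if ij == q01 then - a else if ij == q02 then b else
                if ij == q12 then a - b else 0
    | inr ij => (emark k ij.1 ij.2)%:MP end.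
  exists 1, P; rewrite peval1 oner_eq0; split=> // x _.
  have xE := (image_cr_line (sval x)).1 (svalP x).
  rewrite -/(cone_val x) in xE.
  have ab : (coef_num (cone_val x) != 0) || (coef_den (cone_val x) != 0).
    apply: contraT; rewrite negb_or !negbK => /andP[/eqP n0 /eqP d0].
    case/eqP: (svalP (sval x)); rewrite -/(cone_val x) xE n0 d0.
    by apply/ffunP => s; rewrite !ffunE !mul0r subrr.
  have [Q [[cQ mQ] eQ]] := cr_map_point ab; exists Q; split.
    apply: eq_exist; rewrite eQ; congr line; apply: val_inj; exact: xE.
  case=> [ij|[i j]]; last by rewrite ffunE pevalC /= -/(mk _ _) mQ.
  by rewrite ffunE cQ /P; move: ij; apply: mono2P; rewrite ffunE /=
    ?pevalN ?pevalB ?aE ?bE ?peval0.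
Qed.

Lemma hilbert_point_config (x : 'I_4 -> P1 k) (x_inj : injective x) h :
  hilbert_point (orbit_closure x) h <-> h = cr_map (of_config x_inj).
Proof.
have [A eA] := points_surj x; subst x.
have [a0 b0 _] := cr_generic x_inj.
have ab : (cr_num A != 0) || (cr_den A != 0) by rewrite a0.
by rewrite (cr_map_config x_inj ab); have [] := cr_point_orbit x_inj ab h.
Qed.

Lemma chow_point_config (x : 'I_4 -> P1 k) (x_inj : injective x) h :
  chow_point (orbit_closure x) h <-> h = cr_map (of_config x_inj).
Proof.
have [A eA] := points_surj x; subst x.
have [a0 b0 _] := cr_generic x_inj.
have ab : (cr_num A != 0) || (cr_den A != 0) by rewrite a0.
by rewrite (cr_map_config x_inj ab); have [] := cr_point_orbit x_inj ab h.
Qed.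

(** The image lies in the closure because a nonempty open set of parameters (a : b) contains one of
    four distinct points; the closure lies in the image because the image is cut out by linear
    equations. *)
Lemma hilbert_quotient_image h : image_of cr_map h <-> hilbert_quotient h.
Proof.
split.
  move=> /image_cr_map [a [b [ab ->]]] W /(presented_open (presented_proj k monos)) [S WS].
  move=> /(WS (cr_vec ab)) [p Sp pab].
  pose c (s : monos) : {mpoly k[#|'I_2|]} :=
    (sgn2 k (s 'm0) (s 'm1) * sgn2 k (s 'm2) (s 'm3)) *: pvar k 'a1 -
    (sgn2 k (s 'm0) (s 'm2) * sgn2 k (s 'm1) (s 'm3)) *: pvar k 'a0.
  have pE u : peval (pcomp p c) u = peval p (cr_coef (u 'a0) (u 'a1)).
    rewrite peval_comp; congr peval; apply/ffunP => s.
    by rewrite !ffunE pevalB !pevalZ !peval_var; ring.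
  have p0 : pcomp p c != 0.
    by apply: (@peval_nz _ _ _ (vec2 a b)); rewrite pE vec2_0 vec2_1.
  pose X0 : {mpoly k[#|'I_2|]} := pvar k 'a0; pose X1 : {mpoly k[#|'I_2|]} := pvar k 'a1.
  have X00 : X0 != 0.
    by apply: (@peval_nz _ _ _ (vec2 1 0)); rewrite peval_var vec2_0 oner_eq0.
  have X10 : X1 != 0.
    by apply: (@peval_nz _ _ _ (vec2 0 1)); rewrite peval_var vec2_1 oner_eq0.
  have X01 : X0 - X1 != 0.
    by apply: (@peval_nz _ _ _ (vec2 1 0)); rewrite pevalB !peval_var vec2_0 vec2_1 subr0 oner_eq0.
  (* The factor X0 X1 (X0 - X1) forces the parameters found in the open set to be those of four
     distinct points. *)
  have /peval_neq0 [u] : pcomp p c * (X0 * (X1 * (X0 - X1))) != 0 by rewrite !mulf_neq0.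
  rewrite (pevalM (pcomp p c)) (pevalM X0) (pevalM X1) pevalB !peval_var pE.
  rewrite !mulf_eq0 !negb_or subr_eq0 => /and4P[pu u0 u1 u01].
  have [A [A_inj en ed]] := config_of_cr u0 u1 u01.
  have nz : (cr_num A != 0) || (cr_den A != 0) by rewrite en u0.
  exists (cr_point nz).
    by apply/(WS (cr_vec nz)); exists p => //=; rewrite en ed.
  by exists (points A) => //; apply/(hilbert_point_config A_inj); rewrite (cr_map_config A_inj nz).
move=> cl; apply: contrapT => nim; have [v ev] := line_surj h; subst h.
have [s vs] : exists s, sval v s != cr_coef (coef_num (sval v)) (coef_den (sval v)) s.
  apply: contrapT => H; apply: nim; apply/image_cr_line/ffunP => s.
  by apply: contrapT => /eqP vs; apply: H; exists s.
(* A linear equation of the image that fails at [v]; its nonvanishing locus is the required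
   neighbourhood. *)
pose p : {mpoly k[#|{: monos}|]} := pvar k s
  - ((sgn2 k (s 'm0) (s 'm1) * sgn2 k (s 'm2) (s 'm3)) *: pvar k (mono4 ('a0, 'a1, 'a0, 'a1))
  + (sgn2 k (s 'm0) (s 'm2) * sgn2 k (s 'm1) (s 'm3)) *: pvar k (mono4 ('a0, 'a0, 'a1, 'a1))).
have pE (u : {ffun monos -> k^o}) : peval p u = u s - cr_coef (coef_num u) (coef_den u) s.
  rewrite pevalB pevalD !pevalZ !peval_var [in RHS]ffunE /coef_num /coef_den; ring.
have pZ (t : k) (u : {ffun monos -> k^o}) : peval p (t *: u) = t * peval p u.
  by rewrite /p !(pevalD, pevalN, pevalZ, peval_var) !ffunE !scale_regular; ring.
pose W (L : P15 k) := exists w, L = line w /\ peval p (sval w) != 0.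
have Wline w : W (line w) <-> peval p (sval w) != 0.
  split=> [[w' [/line_eq [t et] pw]]|]; last by exists w.
  by apply: contra_neq pw => pw; rewrite et pZ pw mulr0.
have [||h' Wh' [x x_inj /(hilbert_point_config x_inj) eh]] := cl W.
- apply/(presented_open (presented_proj k monos)); exists (eq p) => w; rewrite /= Wline.
  by split=> [H|[_ <-]] //; exists p.
- by apply/Wline; rewrite pE subr_eq0.
have [w ew] := line_surj h'; rewrite ew in Wh' eh.
have /image_cr_line e : image_of cr_map (line w) by exists (of_config x_inj).
by move/Wline: Wh'; rewrite pE {1}e subrr eqxx.
Qed.

Lemma hilbert_chow_quotient h : hilbert_quotient h <-> chow_quotient h.
Proof.
by split=> cl W oW Wh; have [h' Wh' [x x_inj hx]] := cl W oW Wh; exists h' => //;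
  exists x => //; [apply/(chow_point_config x_inj)/(hilbert_point_config x_inj)
  |apply/(hilbert_point_config x_inj)/(chow_point_config x_inj)].
Qed.

End CrossRatioMap.

Theorem lemma1p6 (k : closedFieldType) :
  exists Phi : Mbar04 k -> P15 k,
    (zmorphism (Mbar04_space k) (P15_space k) Phi /\
     forall (x : 'I_4 -> P1 k) (x_inj : injective x),
       hilbert_point (orbit_closure x) (Phi (of_config x_inj))) /\
    iso_onto_image (Mbar04_space k) (P15_space k) Phi /\
    (forall h : P15 k, image_of Phi h <-> hilbert_quotient h) /\
    (forall h : P15 k, hilbert_quotient h <-> chow_quotient h).
Proof.
exists (@cr_map k); split; last split.
- by split=> [|x x_inj]; [exact: cr_map_morphism|apply/hilbert_point_config].
- exact: cr_map_iso.
- by split=> h; [exact: hilbert_quotient_image|exact: hilbert_chow_quotient].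
Qed.
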